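(* Let $k$ be a field (not necessarily algebraically closed). Let $Q$ be the quiver with two vertices $1,2$ and exactly four arrows: two arrows $\alpha,\beta: 1\to 2$ and two arrows $\gamma,\delta: 2\to 1$. Let $r\subseteq kQ$ be the two-sided ideal generated by all paths of length $1$, and let $A = kQ/r^3$. Then the mutation quiver $Q(s\tau\text{-tilt } A)$ has exactly two connected components.
   Context: Let $A$ be a finite-dimensional $k$-algebra. $\mathrm{mod}\,A$ denotes finite-dimensional left $A$-modules, identified with representations of the quiver of $A$ (satisfying the relations). $\tau$ is the Auslander-Reiten translation. A module $M$ is $\tau$-rigid if $\mathrm{Hom}_A(M,\tau M)=0$. A module is basic if no two of its nonzero indecomposable summands in a decomposition are isomorphic. $|X|$ is the number of pairwise non-isomorphic indecomposable direct summands of $X$. A $\tau$-rigid pair is a pair $(M,P)$ of basic modules with $M$ $\tau$-rigid, $P$ projective and $\mathrm{Hom}_A(P,M)=0$. It is support $\tau$-tilting if $|M|+|P|=|A|$ and almost complete support $\tau$-tilting if $|M|+|P|=|A|-1$. A pair $(N,R)$ is a summand of $(M,P)$ if $N$ is a summand of $M$ and $R$ is a summand of $P$. Every almost complete support $\tau$-tilting pair is a summand of exactly two distinct (up to isomorphism) support $\tau$-tilting pairs; these two are called mutations of each other. $\mathrm{add}\,M$ is the category of modules all of whose indecomposable summands are summands of $M$, and $\mathrm{Fac}\,M$ is the category of quotients of modules in $\mathrm{add}\,M$. If $T_1=(M_1,P_1)$ and $T_2=(M_2,P_2)$ are mutations of each other, then one of $\mathrm{Fac}\,M_1$, $\mathrm{Fac}\,M_2$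 is strictly contained in the other; $T_2$ is a left mutation of $T_1$ if $\mathrm{Fac}\,M_2\subset \mathrm{Fac}\,M_1$. The mutation quiver $Q(s\tau\text{-tilt } A)$ has as vertices the isomorphism classes of support $\tau$-tilting pairs over $A$, and an arrow $T_1\to T_2$ exactly when $T_2$ is a left mutation of $T_1$. Connected components are those of the underlying undirected graph. *)

(* Defs.v *)
From HB Require Import structures.
From mathcomp Require Import all_boot all_order all_algebra all_field.
From Stdlib Require Import Relations.

Set Implicit Arguments.
Unset Strict Implicit.
Unset Printing Implicit Defensive.

Import GRing.Theory.
Local Open Scope ring_scope.

Record quiver := Quiver {
  vert : finType;
  arrow : finType;
  src : arrow -> vert;
  tgt : arrow -> vert;
  vert_gt0 : (0 < #|vert|)%N }.

Section Paths.
Variables (Q : quiver) (n : nat).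

(* Arrows are listed in the order in which they are traversed. *)
Fixpoint is_walk (v : vert Q) (s : seq (arrow Q)) : bool :=
  if s is a :: s' then (src a == v) && is_walk (tgt a) s' else true.

Definition walk_end (v : vert Q) (s : seq (arrow Q)) : vert Q :=
  last v (map (@tgt Q) s).

(* Paths of length at most n, including the trivial path at each vertex. *)
Definition qpath := {p : vert Q * n.-bseq (arrow Q) | is_walk p.1 p.2}.

Definition pstart (p : qpath) : vert Q := (val p).1.
Definition parrows (p : qpath) : seq (arrow Q) := (val p).2.
Definition pend (p : qpath) : vert Q := walk_end (pstart p) (parrows p).

(* r is the path "first p, then q". *)
Definition is_concat (p q r : qpath) : bool :=
  [&& pend p == pstart q, pstart r == pstart p
    & parrows r == parrows p ++ parrows q].

Lemma qpath_eq (p q : qpath) :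
  (p == q) = (pstart p == pstart q) && (parrows p == parrows q).
Proof. by []. Qed.

Lemma is_walk_cat v s t :
  is_walk v (s ++ t) = is_walk v s && is_walk (walk_end v s) t.
Proof. by elim: s v => //= a s IH v; rewrite IH andbA. Qed.

Lemma walk_end_cat v s t : walk_end v (s ++ t) = walk_end (walk_end v s) t.
Proof. by rewrite /walk_end map_cat last_cat. Qed.

Lemma pwalk (p : qpath) : is_walk (pstart p) (parrows p).
Proof. exact: valP p. Qed.

Lemma psize (p : qpath) : (size (parrows p) <= n)%N.
Proof. exact: size_bseq. Qed.

Lemma qpath_of v s : is_walk v s -> (size s <= n)%N ->
  {p : qpath | pstart p = v & parrows p = s}.
Proof.
move=> ws ss; pose b := Bseq ss.
have wb : is_walk (v, b).1 (v, b).2 by [].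
by exists (exist _ (v, b) wb).
Qed.

End Paths.

(* The algebra kQ / r^(n+1), where r is the ideal generated by the arrows:     *)
(* r^(n+1) is spanned by the paths of length > n, so the paths of length       *)
(* at most n form a basis.  An element is its family of coefficients.          *)
Definition trunc_alg (k : fieldType) (Q : quiver) (n : nat) : Type :=
  {ffun qpath Q n -> k}.

Section TruncAlg.
Variables (k : fieldType) (Q : quiver) (n : nat).
Notation T := (trunc_alg k Q n).
Notation path := (qpath Q n).

HB.instance Definition _ := Vector.copy T {ffun path -> k^o}.

Lemma trunc_scaleE (c : k) (f : T) p : (c *: f) p = c * f p.
Proof. by rewrite ffunE. Qed.

Definition trunc_one : T := [ffun p => ((parrows p == [::])%:R : k)].

(* Paths are composed like functions: q * p is "first p, then q", so that left *)
(* modules are the (covariant) representations of Q.                           *)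
Definition trunc_mul (f g : T) : T :=
  [ffun r => \sum_p \sum_(q | is_concat p q r) f q * g p].

Definition is_concat3 (p q r u : path) : bool :=
  [&& pend p == pstart q, pend q == pstart r, pstart u == pstart p
    & parrows u == parrows p ++ parrows q ++ parrows r].


Lemma concat3l (p q r u : path) (c : k) :
  \sum_(w | is_concat w r u && is_concat p q w) c =
  if is_concat3 p q r u then c else 0.
Proof.
case: ifP => [|N].
  case/and4P=> /eqP pq /eqP qr /eqP up /eqP ua.
  have ww : is_walk (pstart p) (parrows p ++ parrows q).
    by rewrite is_walk_cat pwalk -/(pend p) pq pwalk.
  have sw : (size (parrows p ++ parrows q) <= n)%N.
    by apply: leq_trans (psize u); rewrite ua catA (size_cat _ (parrows r)) leq_addr.
  have [w sw' aw] := qpath_of ww sw.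
  have ew : pend w = pstart r.
    by rewrite /pend sw' aw walk_end_cat -/(pend p) pq.
  rewrite (big_pred1 w) // => z /=; rewrite qpath_eq sw' aw.
  apply/idP/idP => [/andP[_ /and3P[_ -> ->]] //|].
  case/andP=> /eqP zs /eqP za; have <- : w = z.
    by apply/eqP; rewrite qpath_eq sw' aw zs za !eqxx.
  by rewrite /is_concat ew pq sw' aw up ua catA !eqxx.
rewrite big1 // => w /andP[/and3P[/eqP a /eqP b /eqP c']] /and3P[/eqP d /eqP e /eqP f].
case/negP: N; apply/and4P; rewrite d b e c' f catA !eqxx; split=> //.
by rewrite -a /pend e f walk_end_cat -/(pend p) d.
Qed.

Lemma concat3r (p q r u : path) (c : k) :
  \sum_(w | is_concat p w u && is_concat q r w) c =
  if is_concat3 p q r u then c else 0.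
Proof.
case: ifP => [|N].
  case/and4P=> /eqP pq /eqP qr /eqP up /eqP ua.
  have ww : is_walk (pstart q) (parrows q ++ parrows r).
    by rewrite is_walk_cat pwalk -/(pend q) qr pwalk.
  have sw : (size (parrows q ++ parrows r) <= n)%N.
    by apply: leq_trans (psize u); rewrite ua (size_cat (parrows p)) leq_addl.
  have [w sw' aw] := qpath_of ww sw.
  rewrite (big_pred1 w) // => z /=; rewrite qpath_eq sw' aw.
  apply/idP/idP => [/andP[_ /and3P[_ -> ->]] //|].
  case/andP=> /eqP zs /eqP za; have <- : w = z.
    by apply/eqP; rewrite qpath_eq sw' aw zs za !eqxx.
  by rewrite /is_concat qr pq sw' aw up ua !eqxx.
rewrite big1 // => w /andP[/and3P[/eqP a /eqP b /eqP c']] /and3P[/eqP d /eqP e /eqP f].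
by case/negP: N; apply/and4P; rewrite a e d b c' f !eqxx.
Qed.

Fact trunc_mulA : associative trunc_mul.
Proof.
move=> f g h; apply/ffunP=> u; rewrite !ffunE.
transitivity (\sum_p \sum_q \sum_r
   if is_concat3 p q r u then f r * g q * h p else 0).
  transitivity (\sum_w \sum_r \sum_p \sum_q \big[+%R/0]_(i : unit | is_concat w r u && is_concat p q w) (f r * g q * h p)).
    apply: eq_bigr => w _; rewrite big_mkcond; apply: eq_bigr => r _.
    case: ifP => E; last by rewrite big1 // => p _; rewrite big1 // => q _; rewrite big_pred0.
    rewrite ffunE big_distrr; apply: eq_bigr => p _; rewrite big_distrr big_mkcond.
    apply: eq_bigr => q _ /=; case: ifP => _; last by rewrite big_pred0.
    by rewrite (big_pred1 tt) ?mulrA; [|case].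
  rewrite exchange_big /=.
  under eq_bigr => r _ do rewrite exchange_big /=.
  rewrite exchange_big; apply: eq_bigr => p _.
  under eq_bigr => r _ do rewrite exchange_big /=.
  rewrite exchange_big; apply: eq_bigr => q _; apply: eq_bigr => r _.
  rewrite -concat3l [RHS]big_mkcond; apply: eq_bigr => w _.
  by case: ifP => _; [rewrite (big_pred1 tt) //; case | rewrite big_pred0].
symmetry; apply: eq_bigr => p _.
transitivity (\sum_w \sum_q \sum_r \big[+%R/0]_(i : unit | is_concat p w u && is_concat q r w) (f r * g q * h p)).
  rewrite big_mkcond; apply: eq_bigr => w _.
  case: ifP => E; last by rewrite big1 // => q _; rewrite big1 // => r _; rewrite big_pred0.
  rewrite ffunE big_distrl; apply: eq_bigr => q _; rewrite big_distrl big_mkcond.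
  apply: eq_bigr => r _ /=; case: ifP => _; last by rewrite big_pred0.
  by rewrite (big_pred1 tt) //; case.
rewrite exchange_big; apply: eq_bigr => q _.
rewrite exchange_big; apply: eq_bigr => r _.
rewrite -concat3r [RHS]big_mkcond; apply: eq_bigr => w _.
by case: ifP => _; [rewrite (big_pred1 tt) //; case | rewrite big_pred0].
Qed.

Fact trunc_mul1 : left_id trunc_one trunc_mul.
Proof.
move=> f; apply/ffunP=> u; rewrite ffunE.
have [e es ea] := @qpath_of Q n (pend u) [::] isT isT.
rewrite (bigD1 u) //= (bigD1 e) /=; last by rewrite /is_concat es ea cats0 !eqxx.
rewrite ffunE ea eqxx mul1r big1 => [|q /andP[uqu qe]].
  rewrite addr0 big1 ?addr0 // => p pu; rewrite big1 // => q.
  rewrite ffunE; case: eqP => [q0|_]; last by rewrite mul0r.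
  case/and3P=> _ s a; case/negP: pu.
  by rewrite eq_sym qpath_eq s (eqP a) q0 cats0 eqxx.
rewrite ffunE; case: eqP => [q0|_]; last by rewrite mul0r.
by case/negP: qe; case/and3P: uqu => a _ _; rewrite qpath_eq es -(eqP a) ea q0 !eqxx.
Qed.

Fact trunc_1mul : right_id trunc_one trunc_mul.
Proof.
move=> f; apply/ffunP=> u; rewrite ffunE.
have [e es ea] := @qpath_of Q n (pstart u) [::] isT isT.
have ee : pend e = pstart u by rewrite /pend ea es.
rewrite (bigD1 e) //= (bigD1 u) /=; last by rewrite /is_concat ee es ea !eqxx.
rewrite ffunE ea eqxx mulr1 big1 => [|q /andP[/and3P[a b c] qu]].
  rewrite addr0 big1 ?addr0 // => p pe; rewrite big1 // => q.
  rewrite ffunE; case: eqP => [p0|_]; last by rewrite mulr0.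
  case/and3P=> _ s a; case/negP: pe.
  by rewrite qpath_eq es ea p0 (eqP s) !eqxx.
by case/negP: qu; rewrite eq_sym qpath_eq -(eqP a) ee (eqP c) ea !eqxx.
Qed.

Fact trunc_mulDl : left_distributive trunc_mul +%R.
Proof.
move=> f g h; apply/ffunP=> u; rewrite !ffunE -big_split; apply: eq_bigr => p _.
by rewrite -big_split; apply: eq_bigr => q _; rewrite ffunE mulrDl.
Qed.

Fact trunc_mulDr : right_distributive trunc_mul +%R.
Proof.
move=> f g h; apply/ffunP=> u; rewrite !ffunE -big_split; apply: eq_bigr => p _.
by rewrite -big_split; apply: eq_bigr => q _; rewrite ffunE mulrDr.
Qed.

Fact trunc_one_neq0 : trunc_one != 0.
Proof.
have /card_gt0P[v _] := vert_gt0 Q.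
have [e es ea] := @qpath_of Q n v [::] isT isT.
by apply/eqP=> /ffunP/(_ e)/eqP; rewrite !ffunE ea eqxx oner_eq0.
Qed.

HB.instance Definition _ := GRing.Zmodule_isNzRing.Build T
  trunc_mulA trunc_mul1 trunc_1mul trunc_mulDl trunc_mulDr trunc_one_neq0.

Fact trunc_scaleAl (c : k) (f g : T) : c *: (f * g) = (c *: f) * g.
Proof.
apply/ffunP=> u; rewrite trunc_scaleE !ffunE big_distrr; apply: eq_bigr => p _.
by rewrite big_distrr; apply: eq_bigr => q _ /=; rewrite trunc_scaleE mulrA.
Qed.

HB.instance Definition _ := GRing.Lmodule_isLalgebra.Build k T trunc_scaleAl.

Fact trunc_scaleAr (c : k) (f g : T) : c *: (f * g) = f * (c *: g).
Proof.
apply/ffunP=> u; rewrite trunc_scaleE !ffunE big_distrr; apply: eq_bigr => p _.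
by rewrite big_distrr; apply: eq_bigr => q _ /=; rewrite trunc_scaleE mulrCA.
Qed.

HB.instance Definition _ := GRing.Lalgebra_isAlgebra.Build k T trunc_scaleAr.
HB.instance Definition _ := Algebra_isFalgebra.Build k T.

End TruncAlg.

(* Sanity check on the construction: trunc_alg k Q n has the universal         *)
(* property of kQ / r^(n+1), being generated by orthogonal idempotents e_v     *)
(* with sum 1 and elements x_a = e_(tgt a) x_a e_(src a), subject only to the  *)
(* vanishing of all products of n+1 of the x_a.                                *)
Section Presentation.
Variables (k : fieldType) (Q : quiver) (n : nat).
Notation T := (trunc_alg k Q n).
Notation path := (qpath Q n).

Record satisfies_presentation (B : algType k)
    (e : vert Q -> B) (x : arrow Q -> B) : Prop := {
  pres_idem : forall v w, e v * e w = if v == w then e v else 0;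
  pres_one : \sum_v e v = 1;
  pres_tgt : forall a, e (tgt a) * x a = x a;
  pres_src : forall a, x a * e (src a) = x a;
  pres_nil : forall s : seq (arrow Q), size s = n.+1 -> \prod_(a <- s) x a = 0 }.

Definition trunc_vert (v : vert Q) : T :=
  [ffun p => ((pstart p == v) && (parrows p == [::]))%:R : k].

Definition trunc_arrow (a : arrow Q) : T :=
  [ffun p => (parrows p == [:: a])%:R : k].

Lemma trunc_mulE (f g : T) u :
  (f * g) u = \sum_p \sum_(q | is_concat p q u) f q * g p.
Proof. by rewrite ffunE. Qed.

Lemma trunc_prodE v (s : seq (arrow Q)) :
  (\prod_(a <- rev s) trunc_arrow a) * trunc_vert v =
  [ffun p => ((pstart p == v) && (parrows p == s))%:R : k].
Proof.
elim/last_ind: s => [|s a IH]; first by rewrite big_nil mul1r.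
rewrite rev_rcons big_cons -mulrA IH; apply/ffunP=> u; rewrite trunc_mulE !ffunE.
case: (boolP (_ && _)) => [/andP[/eqP us /eqP ua]|N].
  have := pwalk u; rewrite us ua -cats1 is_walk_cat => /andP[ws /andP[/eqP sa _]].
  have := psize u; rewrite ua size_rcons => sn.
  have [p ps pa] := qpath_of ws (ltnW sn).
  have wa : is_walk (src a) [:: a] by rewrite /= eqxx.
  have [q qs qa] := @qpath_of Q n _ _ wa (leq_ltn_trans (leq0n _) sn).
  have pe : pend p = src a by rewrite /pend ps pa sa.
  rewrite (bigD1 p) //= (bigD1 q) /=; last first.
    by rewrite /is_concat pe qs us ps ua pa qa cats1 !eqxx.
  rewrite !ffunE qa ps pa !eqxx mulr1 !big1 ?addr0 //.
    move=> p' pp; rewrite big1 // => q' _; rewrite !ffunE.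
    by move: pp; rewrite qpath_eq ps pa => /negPf->; rewrite mulr0.
  move=> q' /andP[/and3P[/eqP a1 _ _]]; rewrite !ffunE qpath_eq qs -a1 pe qa eqxx /=.
  by move/negPf->; rewrite mul0r.
rewrite big1 // => p _; rewrite big1 // => q /and3P[_ /eqP us /eqP ua].
rewrite !ffunE; case: eqP => [qa|_]; last by rewrite mul0r.
case: (boolP (_ && _)) => [/andP[/eqP ps /eqP pa]|_]; last by rewrite mulr0.
by case/negP: N; rewrite us ua ps pa qa cats1 !eqxx.
Qed.

Definition triv_path (v : vert Q) : path :=
  let: exist2 p _ _ := @qpath_of Q n v [::] isT isT in p.

Lemma triv_pathE v :
  (pstart (triv_path v) = v) * (parrows (triv_path v) = [::]).
Proof. by rewrite /triv_path; case: qpath_of. Qed.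

Lemma sum_triv (B : nmodType) (F : path -> B) :
  \sum_(p | parrows p == [::]) F p = \sum_v F (triv_path v).
Proof.
rewrite (reindex_onto triv_path (@pstart Q n)) => [|p /eqP p0]; last first.
  by apply/eqP; rewrite qpath_eq !triv_pathE p0 !eqxx.
by apply: eq_bigl => v; rewrite !triv_pathE !eqxx.
Qed.

Lemma trunc_vert_sum : \sum_v trunc_vert v = 1.
Proof.
apply/ffunP=> p; rewrite sum_ffunE ffunE (bigD1 (pstart p)) //= ffunE eqxx /=.
rewrite big1 ?addr0 // => v; rewrite ffunE eq_sym; case: eqP => //.
Qed.

Lemma trunc_alg_presentation : satisfies_presentation trunc_vert trunc_arrow.
Proof.
split.
- move=> v w; apply/ffunP=> u; rewrite trunc_mulE.
  rewrite (eq_bigr (fun p => trunc_vert w p * (is_concat p (triv_path v) u)%:R)).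
    rewrite (bigD1 (triv_path w)) //= big1 => [|p pw]; last first.
      rewrite ffunE; case: andP => [[/eqP s /eqP a]|]; last by rewrite mul0r.
      by case/negP: pw; rewrite qpath_eq s a !triv_pathE !eqxx.
    rewrite addr0 ffunE !triv_pathE !eqxx /= mul1r.
    rewrite /is_concat /pend !triv_pathE /walk_end /= eq_sym.
    by case: eqP => [->|_]; rewrite !ffunE.
  move=> p _; case: (boolP (is_concat _ _ _)) => [c|N].
    rewrite (bigD1 (triv_path v)) //= big1 ?addr0.
      by rewrite ffunE !triv_pathE !eqxx mul1r mulr1.
    move=> q /andP[_ qv]; rewrite ffunE; case: andP => [[/eqP s /eqP a]|].
      by case/negP: qv; rewrite qpath_eq s a !triv_pathE !eqxx.
    by rewrite mul0r.
  rewrite mulr0 big1 // => q c; rewrite ffunE.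
  case: andP => [[/eqP s /eqP a]|]; last by rewrite mul0r.
  case/negP: N; have <- // : q = triv_path v.
  by apply/eqP; rewrite qpath_eq s a !triv_pathE !eqxx.
- exact: trunc_vert_sum.
- move=> a; apply/ffunP=> u; rewrite trunc_mulE.
  rewrite -[in RHS](mul1r (trunc_arrow a)) trunc_mulE.
  apply: eq_bigr => p _; apply: eq_bigr => q /and3P[/eqP c _ _]; rewrite !ffunE.
  case: (parrows p =P [:: a]) => [pa|_]; last by rewrite !mulr0.
  by rewrite -c /pend pa /= eqxx.
- move=> a; apply/ffunP=> u; rewrite trunc_mulE.
  rewrite -[in RHS](mulr1 (trunc_arrow a)) trunc_mulE.
  apply: eq_bigr => p _; apply: eq_bigr => q /and3P[/eqP c _ _]; rewrite !ffunE.
  case: (parrows q =P [:: a]) => [qa|_]; last by rewrite !mul0r.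
  case: (parrows p =P [::]) => [pa|_]; last by rewrite andbF.
  have := pwalk q; rewrite qa /= andbT => /eqP->.
  by rewrite -c /pend pa /walk_end /= eqxx.
- move=> s ss; rewrite -[s]revK.
  transitivity ((\prod_(a <- rev (rev s)) trunc_arrow a) * \sum_v trunc_vert v).
    by rewrite trunc_vert_sum mulr1.
  rewrite mulr_sumr big1 // => v _; rewrite trunc_prodE; apply/ffunP=> p; rewrite !ffunE.
  case: (parrows p =P _) => [pa|_]; last by rewrite andbF.
  by have := psize p; rewrite pa size_rev ss ltnn.
Qed.

Lemma trunc_alg_universal (B : algType k) (e : vert Q -> B) (x : arrow Q -> B) :
  satisfies_presentation e x ->
  (exists phi : {lrmorphism T -> B},
     (forall v, phi (trunc_vert v) = e v) /\ (forall a, phi (trunc_arrow a) = x a)) /\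
  (forall phi psi : {lrmorphism T -> B},
     (forall v, phi (trunc_vert v) = psi (trunc_vert v)) ->
     (forall a, phi (trunc_arrow a) = psi (trunc_arrow a)) -> phi =1 psi).
Proof.
move=> H.
have dec (f : T) : f = \sum_p f p *: ((\prod_(a <- rev (parrows p)) trunc_arrow a)
                                     * trunc_vert (pstart p)).
  apply/ffunP=> u; rewrite sum_ffunE (bigD1 u) //= trunc_scaleE trunc_prodE ffunE.
  rewrite !eqxx mulr1 big1 ?addr0 // => p pu; rewrite trunc_scaleE trunc_prodE ffunE.
  by move: pu; rewrite eq_sym qpath_eq => /negPf->; rewrite mulr0.
split; last first.
  move=> phi psi He Hx f; rewrite (dec f) !linear_sum; apply: eq_bigr => p _.
  rewrite !linearZ /= !rmorphM /= He !rmorph_prod; congr (_ *: (_ * _)).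
  by apply: eq_bigr => a _; exact: Hx.
pose X s := \prod_(a <- rev s) x a.
pose ev (p : path) := X (parrows p) * e (pstart p).
have X_cat s t : X (s ++ t) = X t * X s by rewrite /X rev_cat big_cat.
have X_nil s : (n < size s)%N -> X s = 0.
  move=> ns; rewrite -(cat_take_drop n.+1 s) X_cat.
  by rewrite {2}/X (pres_nil H) ?mulr0 // size_rev size_takel.
have X_end v s : is_walk v s -> e (walk_end v s) * (X s * e v) = X s * e v.
  elim/last_ind: s v => [|s a IH] v.
    by rewrite /X big_nil !mul1r (pres_idem H) eqxx.
  rewrite -cats1 is_walk_cat walk_end_cat X_cat => _.
  by rewrite /walk_end /= !mulrA {1 3}/X /= big_seq1 (pres_tgt H).
have evM p q : ev q * ev p = \sum_(r | is_concat p q r) ev r.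
  case: (pend p =P pstart q) => [pq|/eqP pq]; last first.
    rewrite big_pred0 => [|r]; last by rewrite /is_concat (negPf pq).
    rewrite /ev -(X_end _ _ (pwalk p)) -/(pend p) !mulrA.
    by rewrite -(mulrA _ (e _) (e _)) (pres_idem H) eq_sym (negPf pq) mulr0 !mul0r.
  have -> : ev q * ev p = X (parrows p ++ parrows q) * e (pstart p).
    by rewrite X_cat /ev -mulrA -pq (X_end _ _ (pwalk p)) mulrA.
  case: (leqP (size (parrows p ++ parrows q)) n) => [s|s]; last first.
    rewrite X_nil // mul0r big_pred0 // => r; apply/negP=> /and3P[_ _ /eqP ra].
    by move: s; rewrite -ra ltnNge psize.
  have w : is_walk (pstart p) (parrows p ++ parrows q).
    by rewrite is_walk_cat pwalk -/(pend p) pq pwalk.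
  have [r rs ra] := qpath_of w s.
  rewrite (big_pred1 r) => [|r']; first by rewrite /ev rs ra.
  by rewrite /= /is_concat qpath_eq rs ra pq eqxx.
pose phi (f : T) : B := \sum_p f p *: ev p.
have phiL : linear phi.
  move=> c f g; rewrite /phi scaler_sumr -big_split; apply: eq_bigr => p _ /=.
  by rewrite ffunE trunc_scaleE scalerDl scalerA.
have phiM : monoid_morphism phi.
  split.
    rewrite -(pres_one H) /phi.
    rewrite (eq_bigr (fun v => ev (triv_path v))) => [|v _]; last first.
      by rewrite /ev !triv_pathE /X big_nil mul1r.
    rewrite -sum_triv [RHS]big_mkcond; apply: eq_bigr => p _; rewrite ffunE.
    by case: eqP; rewrite ?scale1r ?scale0r.
  move=> f g; rewrite /phi.
  transitivity (\sum_p \sum_q \sum_(r | is_concat p q r) (f q * g p) *: ev r).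
    transitivity (\sum_r \sum_p \sum_q
        if is_concat p q r then (f q * g p) *: ev r else 0).
      apply: eq_bigr => r _; rewrite trunc_mulE scaler_suml; apply: eq_bigr => p _.
      by rewrite scaler_suml big_mkcond.
    rewrite exchange_big; apply: eq_bigr => p _; rewrite exchange_big.
    by apply: eq_bigr => q _; rewrite -big_mkcond.
  rewrite mulr_suml exchange_big; apply: eq_bigr => q _ /=; rewrite mulr_sumr.
  apply: eq_bigr => p _.
  by rewrite -scalerAl -scalerAr scalerA evM scaler_sumr.
pose phi1 := GRing.isLinear.Build k T B _ phi phiL.
pose phi2 := GRing.isMonoidMorphism.Build T B phi phiM.
pose phi' : {lrmorphism T -> B} := HB.pack phi phi1 phi2.
have phi_ev p : phi ((\prod_(a <- rev (parrows p)) trunc_arrow a)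
                      * trunc_vert (pstart p)) = ev p.
  rewrite trunc_prodE /phi (bigD1 p) //= ffunE !eqxx scale1r big1 ?addr0 // => q.
  by rewrite qpath_eq ffunE => /negPf->; rewrite scale0r.
exists phi'; split=> [v|a]; rewrite /phi' /=.
  have := phi_ev (triv_path v).
  by rewrite /ev !triv_pathE /X /= !big_nil !mul1r.
have phiA : phi (trunc_arrow a) = phi (trunc_arrow a * trunc_vert (src a)).
  by rewrite (pres_src trunc_alg_presentation).
case: (posnP n) => [n0|n_gt0].
  have -> : trunc_arrow a = 0.
    have := pres_nil trunc_alg_presentation (s := [:: a]).
    by rewrite big_seq1; apply; rewrite /= n0.
  have -> : x a = 0 by have := pres_nil H (s := [:: a]); rewrite big_seq1; apply; rewrite /= n0.
  exact: (linear0 phi').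
have wa : is_walk (src a) [:: a] by rewrite /= eqxx.
have [q qs qa] := qpath_of wa n_gt0.
rewrite phiA; have := phi_ev q; rewrite /ev qs qa /X /= big_seq1.
by rewrite big_seq1 => ->; rewrite (pres_src H).
Qed.

End Presentation.

Lemma linfun_linE (k : fieldType) (V W : vectType k) (F : V -> W) (v : V) :
  linear F -> linfun F v = F v.
Proof.
move=> FL; pose F' : {linear V -> W} :=
  HB.pack F (GRing.isLinear.Build k V W _ F FL).
exact: (lfunE F').
Qed.

Section Modules.
Variables (k : fieldType) (A : falgType k).

Record lmod := LMod {
  lcar :> vectType k;
  lact : A -> 'End(lcar);
  lact_linear : linear lact;
  lact1 : lact 1 = \1%VF;
  lactM : forall a b, lact (a * b) = (lact a \o lact b)%VF }.

(* Right modules; ract a is the map v |-> v a. *)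
Record rmod := RMod {
  rcar :> vectType k;
  ract : A -> 'End(rcar);
  ract_linear : linear ract;
  ract1 : ract 1 = \1%VF;
  ractM : forall a b, ract (a * b) = (ract b \o ract a)%VF }.

HB.instance Definition _ (M : lmod) :=
  GRing.isLinear.Build k A 'End(M) _ (@lact M) (@lact_linear M).
HB.instance Definition _ (M : rmod) :=
  GRing.isLinear.Build k A 'End(M) _ (@ract M) (@ract_linear M).

Definition lhom (M N : lmod) (f : 'Hom(M, N)) : Prop :=
  forall a, (f \o lact M a = lact N a \o f)%VF.

Definition rhom (M N : rmod) (f : 'Hom(M, N)) : Prop :=
  forall a, (f \o ract M a = ract N a \o f)%VF.

Definition hom_zero (M N : lmod) : Prop := forall f : 'Hom(M, N), lhom f -> f = 0.

Definition surjective (V W : vectType k) (f : 'Hom(V, W)) : Prop :=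
  limg f = fullv.

Definition iso (M N : lmod) : Prop :=
  exists (f : 'Hom(M, N)) (g : 'Hom(N, M)),
    [/\ lhom f, lhom g, (g \o f = \1)%VF & (f \o g = \1)%VF].

Definition zero_mod (M : lmod) : Prop := \dim {: M} = 0%N.

(* X is the direct sum of the modules N i (biproduct). *)
Definition is_dsum (I : finType) (N : I -> lmod) (X : lmod) : Prop :=
  exists (inj : forall i, 'Hom(N i, X)) (proj : forall i, 'Hom(X, N i)),
    [/\ forall i, lhom (inj i) /\ lhom (proj i),
        forall i, (proj i \o inj i = \1)%VF,
        forall i j, i != j -> (proj i \o inj j = 0)%VF
      & \sum_i (inj i \o proj i)%VF = \1%VF].

Definition is_dsum2 (N N' X : lmod) : Prop :=
  is_dsum (fun b : bool => if b then N else N') X.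

Definition summand (N X : lmod) : Prop := exists N', is_dsum2 N N' X.

Definition indecomposable (X : lmod) : Prop :=
  ~ zero_mod X /\ forall N N', is_dsum2 N N' X -> zero_mod N \/ zero_mod N'.

Definition basic (X : lmod) : Prop :=
  exists (m : nat) (N : 'I_m -> lmod),
    [/\ is_dsum N X, forall i, indecomposable (N i)
      & forall i j, iso (N i) (N j) -> i = j].

(* |X| = m *)
Definition num_summands (X : lmod) (m : nat) : Prop :=
  exists N : 'I_m -> lmod,
    [/\ forall i, indecomposable (N i) /\ summand (N i) X,
        forall i j, iso (N i) (N j) -> i = j
      & forall Y, indecomposable Y -> summand Y X -> exists i, iso Y (N i)].

Definition projective (P : lmod) : Prop :=
  forall (X Y : lmod) (g : 'Hom(X, Y)) (f : 'Hom(P, Y)),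
    lhom g -> surjective g -> lhom f ->
    exists2 h : 'Hom(P, X), lhom h & (g \o h = f)%VF.

Definition submodule (M : lmod) (U : {vspace M}) : Prop :=
  forall a, (lact M a @: U <= U)%VS.

Definition superfluous (M : lmod) (K : {vspace M}) : Prop :=
  forall U : {vspace M}, submodule U -> (K + U = fullv)%VS -> U = fullv.

(* P1 --f--> P0 --g--> M --> 0 exact, with g and P1 -> ker g projective covers. *)
Definition minimal_presentation (P1 P0 M : lmod)
    (f : 'Hom(P1, P0)) (g : 'Hom(P0, M)) : Prop :=
  [/\ projective P1 /\ projective P0, lhom f /\ lhom g,
      surjective g /\ limg f = lker g
    & superfluous (lker g) /\ superfluous (lker f)].

Fact amull_linear : linear (fun a : A => amull a).
Proof. exact: linearP. Qed.
Fact amull_one : amull (1 : A) = \1%VF.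
Proof. by apply/lfunP=> v; rewrite !lfunE /= mul1r. Qed.
Fact amull_mul (a b : A) : amull (a * b) = (amull a \o amull b)%VF.
Proof. by apply/lfunP=> v; rewrite comp_lfunE !lfunE /= mulrA. Qed.

(* The regular left module; amull a is x |-> a x and amulr a is x |-> x a. *)
Definition reg : lmod := LMod amull_linear amull_one amull_mul.

Section HomReg.
Variable P : lmod.

Definition lhom_defect (a : A) (h : 'Hom(P, reg)) : 'Hom(P, reg) :=
  ((h \o lact P a) - (lact reg a \o h))%VF.

Fact lhom_defect_linear a : linear (lhom_defect a).
Proof.
move=> c f g; rewrite /lhom_defect comp_lfunDl -comp_lfunZl comp_lfunDr -comp_lfunZr.
by rewrite scalerBr opprD addrACA.
Qed.

(* Hom_A(P, A), as a subspace of Hom_k(P, A). *)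
Definition hom_reg : {vspace 'Hom(P, reg)} :=
  (\bigcap_(i < \dim {: A}) lker (linfun (lhom_defect (vbasis {: A})`_i)))%VS.

Lemma hom_regP (h : 'Hom(P, reg)) : h \in hom_reg <-> lhom h.
Proof.
split=> [/subv_bigcapP H a|H]; last first.
  apply/subv_bigcapP=> i _; rewrite -memvE memv_ker linfun_linE ?/lhom_defect; last exact: lhom_defect_linear.
  by rewrite (H _) subrr.
pose D x := lhom_defect x h.
have DL : linear D.
  move=> c x y; rewrite /D /lhom_defect !linearP /=.
  rewrite comp_lfunDr -comp_lfunZr comp_lfunDl -comp_lfunZl.
  by rewrite scalerBr opprD addrACA.
pose D' : {linear A -> 'Hom(P, reg)} := HB.pack D (GRing.isLinear.Build k A _ _ D DL).
apply/eqP; rewrite -subr_eq0; apply/eqP; change (D' a = 0).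
rewrite (coord_vbasis (memvf a)) linear_sum big1 // => i _; rewrite linearZ /=.
have := H i isT; rewrite -memvE memv_ker linfun_linE => [/eqP Di|]; last exact: lhom_defect_linear.
by rewrite /D Di scaler0.
Qed.

(* The right module Hom_A(P, A), with (h a)(p) = h(p) a. *)
Definition hom_reg_act (a : A) : 'End(subvs_of hom_reg) :=
  linfun (fun h => vsproj hom_reg (amulr a \o vsval h)%VF).

Lemma hom_reg_actE a (h : subvs_of hom_reg) :
  vsval (hom_reg_act a h) = (amulr a \o vsval h)%VF.
Proof.
rewrite linfun_linE; last first.
  by move=> c f g; rewrite linearP /= comp_lfunDr -comp_lfunZr linearP.
rewrite vsprojK //; apply/hom_regP=> b.
have /hom_regP/(_ b) hb := subvsP h.
rewrite -comp_lfunA hb !comp_lfunA; congr (_ \o _)%VF.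
by apply/lfunP=> x; rewrite !comp_lfunE !lfunE /= mulrA.
Qed.

Fact hom_reg_act_linear : linear hom_reg_act.
Proof.
move=> c a b; apply/lfunP=> h; apply: val_inj.
rewrite add_lfunE scale_lfunE linearP /= !hom_reg_actE linearP /=.
by rewrite comp_lfunDl -comp_lfunZl.
Qed.
Fact hom_reg_act1 : hom_reg_act 1 = \1%VF.
Proof.
apply/lfunP=> h; apply: val_inj; rewrite /= hom_reg_actE lfunE /=.
by apply/lfunP=> x; rewrite comp_lfunE lfunE /= mulr1.
Qed.
Fact hom_reg_actM a b : hom_reg_act (a * b) = (hom_reg_act b \o hom_reg_act a)%VF.
Proof.
apply/lfunP=> h; apply: val_inj; rewrite comp_lfunE /= !hom_reg_actE.
by apply/lfunP=> x; rewrite !comp_lfunE !lfunE /= mulrA.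
Qed.

Definition hom_reg_rmod : rmod := RMod hom_reg_act_linear hom_reg_act1 hom_reg_actM.

End HomReg.

(* X is isomorphic to the transpose Tr M: for a minimal projective presentation *)
(* P1 -> P0 -> M -> 0 there is an exact sequence of right modules               *)
(* Hom_A(P0, A) -> Hom_A(P1, A) -> X -> 0.                                      *)
Definition is_transpose (M : lmod) (X : rmod) : Prop :=
  exists (P1 P0 : lmod) (f : 'Hom(P1, P0)) (g : 'Hom(P0, M))
         (pi : 'Hom(hom_reg_rmod P1, X)),
    [/\ minimal_presentation f g, rhom pi, surjective pi
      & forall h : subvs_of (hom_reg P1),
          pi h = 0 <->
          exists h0 : subvs_of (hom_reg P0), vsval h = (vsval h0 \o f)%VF].

(* The k-dual of a right module is a left module: (a phi)(x) = phi(x a). *)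
Section Dual.
Variable X : rmod.

Definition dual_act (a : A) : 'End('Hom(X, k^o)) :=
  linfun (fun phi : 'Hom(X, k^o) => (phi \o ract X a)%VF).

Lemma dual_actE a phi : dual_act a phi = (phi \o ract X a)%VF.
Proof. by rewrite linfun_linE // => c f g; rewrite comp_lfunDl -comp_lfunZl. Qed.

Fact dual_act_linear : linear dual_act.
Proof.
move=> c a b; apply/lfunP=> phi; rewrite add_lfunE scale_lfunE !dual_actE.
by rewrite linearP /= comp_lfunDr comp_lfunZr.
Qed.
Fact dual_act1 : dual_act 1 = \1%VF.
Proof. by apply/lfunP=> phi; rewrite dual_actE ract1 comp_lfun1r lfunE. Qed.
Fact dual_actM a b : dual_act (a * b) = (dual_act a \o dual_act b)%VF.
Proof.
by apply/lfunP=> phi; rewrite comp_lfunE !dual_actE ractM comp_lfunA.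
Qed.

Definition dual : lmod := LMod dual_act_linear dual_act1 dual_actM.

End Dual.

(* N is isomorphic to the Auslander-Reiten translate tau M = D Tr M. *)
Definition is_ar_translate (M N : lmod) : Prop :=
  exists2 X, is_transpose M X & iso N (dual X).

Definition tau_rigid (M : lmod) : Prop :=
  exists2 N, is_ar_translate M N & hom_zero M N.

Record mpair := MPair { pmod : lmod; pproj : lmod }.

Definition pair_iso (T U : mpair) : Prop :=
  iso (pmod T) (pmod U) /\ iso (pproj T) (pproj U).

Definition pair_summand (U T : mpair) : Prop :=
  summand (pmod U) (pmod T) /\ summand (pproj U) (pproj T).

Definition tau_rigid_pair (T : mpair) : Prop :=
  [/\ basic (pmod T) /\ basic (pproj T), tau_rigid (pmod T),
      projective (pproj T) & hom_zero (pproj T) (pmod T)].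

(* |M| + |P| + d = |A| *)
Definition pair_corank (T : mpair) (d : nat) : Prop :=
  exists m p n, [/\ num_summands (pmod T) m, num_summands (pproj T) p,
                    num_summands reg n & (m + p + d = n)%N].

Definition support_tau_tilting (T : mpair) : Prop :=
  tau_rigid_pair T /\ pair_corank T 0.

Definition almost_complete (T : mpair) : Prop :=
  tau_rigid_pair T /\ pair_corank T 1.

Definition mutation (T U : mpair) : Prop :=
  [/\ support_tau_tilting T, support_tau_tilting U, ~ pair_iso T U
    & exists V, [/\ almost_complete V, pair_summand V T & pair_summand V U]].

Definition in_add (M X : lmod) : Prop :=
  forall Y, indecomposable Y -> summand Y X -> summand Y M.

Definition in_Fac (M Y : lmod) : Prop :=
  exists (X : lmod) (f : 'Hom(X, Y)), [/\ in_add M X, lhom f & surjective f].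

Definition left_mutation (T U : mpair) : Prop :=
  [/\ mutation T U, forall Y, in_Fac (pmod U) Y -> in_Fac (pmod T) Y
    & exists2 Y, in_Fac (pmod T) Y & ~ in_Fac (pmod U) Y].

(* Vertices of the mutation quiver: isomorphism classes of support tau-tilting *)
(* pairs, as sets of pairs.                                                    *)
Definition stt_class : Type :=
  {C : mpair -> Prop | exists2 T, support_tau_tilting T & C = pair_iso T}.

Definition mutation_arrow (C D : stt_class) : Prop :=
  exists T U, [/\ sval C T, sval D U & left_mutation T U].

End Modules.

(* The number of connected components of the underlying undirected graph of a  *)
(* quiver with vertex set V is n.                                              *)
Definition num_components (V : Type) (arr : V -> V -> Prop) (n : nat) : Prop :=
  exists c : 'I_n -> V,
    (forall i j, clos_refl_sym_trans V arr (c i) (c j) -> i = j) /\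
    (forall v, exists i, clos_refl_sym_trans V arr (c i) v).

Fact card_I2_gt0 : (0 < #|'I_2|)%N.
Proof. by rewrite card_ord. Qed.

(* Vertices 0, 1 stand for 1, 2; arrows 0, 1 (alpha, beta) go from 1 to 2 and  *)
(* arrows 2, 3 (gamma, delta) from 2 to 1.                                     *)
Definition double_kronecker : quiver :=
  @Quiver 'I_2 'I_4
    (fun a => if (a < 2)%N then ord0 else ord_max)
    (fun a => if (a < 2)%N then ord_max else ord0)
    card_I2_gt0.

(* Main.v *)
From HB Require Import structures.
From mathcomp Require Import all_boot all_order all_algebra all_field.
From mathcomp Require Import zify.
From Stdlib Require Import Relations Classical FunctionalExtensionality.
From Stdlib Require Import PropExtensionality ProofIrrelevance.
Require Import Defs.

Set Implicit Arguments.
Unset Strict Implicit.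
Unset Printing Implicit Defensive.

Import GRing.Theory.
Local Open Scope ring_scope.

(** The support tau-tilting pairs can all be listed, because the minimal
    presentation [P1 -> P0 -> M] of a tau-rigid module [M] is a matrix pencil.

    First, [M] is tau-rigid exactly when every homomorphism [P1 -> M] factors
    through [P1 -> P0] ([tau_rigid_lift], [lift_tau_rigid]).  It follows that no
    vertex occurs both in [P0] and in [P1] ([lift_img_rad], [vtx_rad_notin]).  So
    either [P0] involves both vertices and [M] is projective, or [P0] is a power of
    the projective of a vertex [v] and [P1] a power of that of the other vertex.  In
    the second case the entries of [P1 -> P0] are combinations of paths from [v] to
    the other vertex; such paths have odd length, and as paths of length 3 are zero
    they are the two arrows.  So [M] is presented by two matrices [G] and [D] of the
    same size, a representation [C] of the Kronecker quiver, and the criterion becomes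
    the vanishing of the self-extensions of [C] ([pres_tau_rigid],
    [presentation_pencil]): [C] is rigid.

    The Euler form of a pencil with [a] rows and [d] columns is [(d - a)^2], so a
    nonzero rigid pencil has [a <> d] ([rigid_not_square]).  Reflection reduces [a < d]
    to the case of few rows and shows that a rigid pencil is determined by its
    size ([rigid_unique]); it is a sum of copies of [kron n] and [kron n.+1] for
    some [n] ([rigid_kron]).  The case [a > d] is its transpose ([rigid_cokron]).
    Write [prepro v n] and [preinj v n] for the modules presented at [v] by [kron n]
    and by the transpose of [kron n.+1].  The support tau-tilting pairs are then
    ([stt_listed])
    - [(A, 0)] and [(prepro v n + prepro v n.+1, 0)];
    - [(0, A)], the pairs [(preinj v 0, P)] of the simple module at [v] and the
      projective of the other vertex, and [(preinj v n + preinj v n.+1, 0)].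

    Within each of the two families all pairs are linked: there are left mutations
    from [(A, 0)] to the pair with [n = 0] and from the [n]-th to the [n.+1]-st one,
    and in the second family from the [n.+1]-st pair to the [n]-th one, then to
    [(preinj v 0, P)] and to [(0, A)].  There is no mutation between the families.
    The two pairs of a mutation share an almost complete pair, which is not zero: an
    indecomposable module summand of it is of the form [prepro v n] or [preinj v n],
    not both, and a projective summand occurs in the second family only
    ([mutation_positive]). *)


(** * Homomorphisms, submodules and quotients *)

(** Locking keeps unification from unfolding the matrix behind [linfun]. *)
Definition lin_hom (k : fieldType) (V W : vectType k) (F : V -> W) of linear F :
  'Hom(V, W) := locked (linfun F).

Lemma lin_homE (k : fieldType) (V W : vectType k) (F : V -> W) (FL : linear F) v :
  lin_hom FL v = F v.
Proof. by rewrite /lin_hom -lock linfun_linE. Qed.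

Section Homomorphisms.
Variables (k : fieldType) (A : falgType k).
Implicit Types M N P Q X Y : lmod A.

Lemma act1 M m : lact M 1 m = m.
Proof. by rewrite lact1 id_lfunE. Qed.

Lemma actM M a b m : lact M (a * b) m = lact M a (lact M b m).
Proof. by rewrite lactM comp_lfunE. Qed.

Lemma actD M a b m : lact M (a + b) m = lact M a m + lact M b m.
Proof. by rewrite linearD add_lfunE. Qed.

Lemma actZ M (c : k) a m : lact M (c *: a) m = c *: lact M a m.
Proof. by rewrite linearZ scale_lfunE. Qed.

Lemma act0 M m : lact M 0 m = 0.
Proof. by rewrite linear0 zero_lfunE. Qed.

Lemma act_sum M (I : finType) (F : I -> A) m :
  lact M (\sum_i F i) m = \sum_i lact M (F i) m.
Proof. by rewrite linear_sum sum_lfunE. Qed.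

Lemma lhomP M N (f : 'Hom(M, N)) :
  lhom f <-> forall a m, f (lact M a m) = lact N a (f m).
Proof.
split=> [H a m|H a]; first by rewrite -!comp_lfunE H.
by apply/lfunP=> m; rewrite !comp_lfunE H.
Qed.

Lemma lhomE M N (f : 'Hom(M, N)) a m : lhom f -> f (lact M a m) = lact N a (f m).
Proof. by move/lhomP. Qed.

Lemma lhom1 M : lhom (\1%VF : 'End(M)).
Proof. by move=> a; rewrite comp_lfun1l comp_lfun1r. Qed.

Lemma lhom0 M N : lhom (0 : 'Hom(M, N)).
Proof. by move=> a; rewrite comp_lfun0l comp_lfun0r. Qed.

Lemma lhom_comp M N X (g : 'Hom(N, X)) (f : 'Hom(M, N)) :
  lhom g -> lhom f -> lhom (g \o f)%VF.
Proof. by move=> Hg Hf a; rewrite -comp_lfunA Hf !comp_lfunA Hg. Qed.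

Lemma lhomD M N (f g : 'Hom(M, N)) : lhom f -> lhom g -> lhom (f + g).
Proof. by move=> Hf Hg a; rewrite comp_lfunDl comp_lfunDr Hf Hg. Qed.

Lemma lhomN M N (f : 'Hom(M, N)) : lhom f -> lhom (- f).
Proof. by move=> Hf a; rewrite comp_lfunNl comp_lfunNr Hf. Qed.

Lemma lhom_sum M N (I : finType) (F : I -> 'Hom(M, N)) :
  (forall i, lhom (F i)) -> lhom (\sum_i F i).
Proof. by move=> H; elim/big_ind: _ => *; [apply: lhom0|apply: lhomD|]. Qed.

Lemma lhom_inv M N (f : 'Hom(M, N)) :
  lhom f -> lker f == 0%VS -> limg f = fullv -> lhom f^-1%VF.
Proof.
move=> Hf kf sf; apply/lhomP=> a n.
have [m ->] : exists m, n = f m.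
  by have := memvf n; rewrite -sf => /memv_imgP[m _ ->]; exists m.
by rewrite -lhomE // !lker0_lfunK.
Qed.

Lemma isoP M N : iso M N <->
  exists f : 'Hom(M, N), [/\ lhom f, lker f == 0%VS & limg f = fullv].
Proof.
split=> [[f [g [Hf Hg gf fg]]]|[f [Hf kf sf]]].
  exists f; split=> //.
    by apply/lker0P => x y E; rewrite -[x]id_lfunE -[y]id_lfunE -gf !comp_lfunE E.
  apply/eqP; rewrite eqEsubv subvf; apply/subvP=> n _.
  by rewrite -[n]id_lfunE -fg comp_lfunE memv_img ?memvf.
exists f, f^-1%VF; split; rewrite ?lker0_compVf //; first exact: lhom_inv.
by apply/lfunP=> n; rewrite comp_lfunE id_lfunE limg_lfunVK // sf memvf.
Qed.

Lemma iso_refl M : iso M M.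
Proof. by exists \1%VF, \1%VF; split; rewrite ?comp_lfun1l //; apply: lhom1. Qed.

Lemma iso_sym M N : iso M N -> iso N M.
Proof. by case=> f [g [Hf Hg gf fg]]; exists g, f. Qed.

Lemma iso_trans N M X : iso M N -> iso N X -> iso M X.
Proof.
case=> f [g [Hf Hg gf fg]] [f' [g' [Hf' Hg' gf' fg']]].
exists (f' \o f)%VF, (g \o g')%VF; split; try exact: lhom_comp.
  by rewrite -comp_lfunA (comp_lfunA g') gf' comp_lfun1l.
by rewrite -comp_lfunA (comp_lfunA f) fg comp_lfun1l.
Qed.

Lemma limgT (V W : vectType k) (f : 'Hom(V, W)) :
  limg f = fullv <-> forall w, exists v, f v = w.
Proof.
split=> [H w|H].
  by have := memvf w; rewrite -H => /memv_imgP[v _ ->]; exists v.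
apply/eqP; rewrite eqEsubv subvf; apply/subvP=> w _.
by have [v <-] := H w; rewrite memv_img ?memvf.
Qed.

Lemma zero_modP M : zero_mod M <-> forall m : M, m = 0.
Proof.
rewrite /zero_mod; split=> [/eqP|H].
  by rewrite dimv_eq0 => /eqP E m; apply/eqP; rewrite -memv0 -E memvf.
by apply/eqP; rewrite dimv_eq0 -subv0; apply/subvP=> m _; rewrite memv0; apply/eqP.
Qed.

Lemma iso_zero M N : iso M N -> zero_mod M -> zero_mod N.
Proof.
case=> f [g [Hf Hg gf fg]] /zero_modP H; apply/zero_modP=> n.
by rewrite -[n]id_lfunE -fg comp_lfunE [g n]H linear0.
Qed.

Lemma zero_iso M N : zero_mod M -> zero_mod N -> iso M N.
Proof.
move=> /zero_modP HM /zero_modP HN; exists 0, 0; split; try exact: lhom0.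
  by apply/lfunP=> m; rewrite [LHS]HM [RHS]HM.
by apply/lfunP=> m; rewrite [LHS]HN [RHS]HN.
Qed.

(** ** Submodules *)

Section Submodules.
Variables (M : lmod A) (U : {vspace M}) (HU : submodule U).

Lemma submodP a m : m \in U -> lact M a m \in U.
Proof. by move=> Um; apply/(subvP (HU a))/memv_img. Qed.

Definition sub_act a : 'End(subvs_of U) :=
  linfun (fun u => vsproj U (lact M a (vsval u))).

Lemma sub_actE a u : vsval (sub_act a u) = lact M a (vsval u).
Proof.
rewrite linfun_linE; last by move=> c v w; rewrite !linearP.
by rewrite vsprojK // submodP // subvsP.
Qed.

Fact sub_act_linear : linear sub_act.
Proof.
move=> c a b; apply/lfunP=> u; apply: subvs_inj.
by rewrite add_lfunE scale_lfunE linearP /= !sub_actE actD actZ.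
Qed.
Fact sub_act1 : sub_act 1 = \1%VF.
Proof. by apply/lfunP=> u; apply: subvs_inj; rewrite sub_actE id_lfunE act1. Qed.
Fact sub_actM a b : sub_act (a * b) = (sub_act a \o sub_act b)%VF.
Proof. by apply/lfunP=> u; apply: subvs_inj; rewrite comp_lfunE !sub_actE actM. Qed.

Definition sub_mod : lmod A := LMod sub_act_linear sub_act1 sub_actM.

Definition sub_inj : 'Hom(sub_mod, M) := linfun (vsval : subvs_of U -> M).

Lemma sub_injE u : sub_inj u = vsval u.
Proof. exact: (lfunE (vsval : {linear subvs_of U -> M})). Qed.

Lemma sub_inj_lhom : lhom sub_inj.
Proof. by apply/lhomP=> a m; rewrite !sub_injE /= sub_actE. Qed.

End Submodules.

Lemma submodule_limg M N (f : 'Hom(M, N)) : lhom f -> submodule (limg f).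
Proof.
move=> Hf a; apply/subvP=> _ /memv_imgP[_ /memv_imgP[m _ ->] ->].
by rewrite -lhomE // memv_img ?memvf.
Qed.

Lemma submodule_lker M N (f : 'Hom(M, N)) : lhom f -> submodule (lker f).
Proof.
move=> Hf a; apply/subvP=> _ /memv_imgP[m km ->]; move: km; rewrite !memv_ker => /eqP fm.
by rewrite lhomE // fm linear0.
Qed.

End Homomorphisms.

(** ** Quotients *)

(** The quotient space is carried by a complement, so that it is again a
    subspace type; the projection then has an explicit linear section. *)
Section QuotientSpace.
Variables (k : fieldType) (V : vectType k) (U : {vspace V}).

Definition quo_proj : 'Hom(V, subvs_of U^C) :=
  linfun (fun v => vsproj (U^C)%VS (v - projv U v)).

Lemma val_quo_proj v : vsval (quo_proj v) = v - projv U v.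
Proof.
rewrite linfun_linE ?vsprojK ?memv_projC // => c u w.
by rewrite -linearP /= linearP scalerBr opprD addrACA.
Qed.

Lemma quo_proj_section u : quo_proj (vsval u) = u.
Proof.
apply: subvs_inj; rewrite val_quo_proj.
have /eqP-> : projv U (vsval u) == 0 by rewrite -memv_ker lker_proj subvsP.
by rewrite subr0.
Qed.

Lemma lker_quo_proj : lker quo_proj = U.
Proof.
apply/vspaceP=> v; rewrite memv_ker; apply/eqP/idP=> [H|Uv].
  have := val_quo_proj v; rewrite H linear0 => /esym/eqP; rewrite subr_eq0 => /eqP->.
  exact: memv_proj.
by apply: subvs_inj; rewrite val_quo_proj projv_id // subrr.
Qed.

Definition quo_map (f : 'End(V)) : 'End(subvs_of U^C) :=
  (quo_proj \o f \o linfun vsval)%VF.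

Lemma quo_mapE (f : 'End(V)) v : (f @: U <= U)%VS ->
  quo_map f (quo_proj v) = quo_proj (f v).
Proof.
move=> fU; rewrite !comp_lfunE (lfunE (vsval : {linear subvs_of U^C -> V})).
rewrite /= val_quo_proj linearB /= linearB /=.
have /eqP-> : quo_proj (f (projv U v)) == 0; last by rewrite subr0.
by rewrite -memv_ker lker_quo_proj; apply/(subvP fU)/memv_img/memv_proj.
Qed.

Lemma quo_map_ext (f g : 'End(subvs_of U^C)) :
  (forall v, f (quo_proj v) = g (quo_proj v)) -> f = g.
Proof. by move=> H; apply/lfunP=> u; rewrite -[u]quo_proj_section. Qed.

Lemma quo_map_linear : linear quo_map.
Proof.
move=> c f g; apply/lfunP=> u.
by rewrite add_lfunE scale_lfunE !comp_lfunE add_lfunE scale_lfunE linearP.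
Qed.

End QuotientSpace.

Section Quotients.
Variables (k : fieldType) (A : falgType k).

Section LeftQuotient.
Variables (M : lmod A) (U : {vspace M}) (HU : submodule U).

Definition quo_act a := quo_map U (lact M a).

Fact quo_act_linear : linear quo_act.
Proof. by move=> c a b; rewrite /quo_act linearP quo_map_linear. Qed.
Fact quo_act1 : quo_act 1 = \1%VF.
Proof. by apply: quo_map_ext => v; rewrite /quo_act quo_mapE // act1 id_lfunE. Qed.
Fact quo_actM a b : quo_act (a * b) = (quo_act a \o quo_act b)%VF.
Proof.
by apply: quo_map_ext => v; rewrite [RHS]comp_lfunE /quo_act !quo_mapE // actM.
Qed.

Definition quo_mod : lmod A := LMod quo_act_linear quo_act1 quo_actM.
Definition quo_pi : 'Hom(M, quo_mod) := quo_proj U.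

Lemma quo_pi_lhom : lhom quo_pi.
Proof. by apply/lhomP=> a m; rewrite /= /quo_act quo_mapE. Qed.
Lemma quo_pi_surj : limg quo_pi = fullv.
Proof. by apply/limgT=> u; exists (vsval u); apply: quo_proj_section. Qed.
Lemma quo_pi_ker : lker quo_pi = U.
Proof. exact: lker_quo_proj. Qed.

End LeftQuotient.

Section RightQuotient.
Variables (M : rmod A) (U : {vspace M}) (HU : forall a, (ract M a @: U <= U)%VS).

Definition rquo_act a := quo_map U (ract M a).

Fact rquo_act_linear : linear rquo_act.
Proof. by move=> c a b; rewrite /rquo_act linearP quo_map_linear. Qed.
Fact rquo_act1 : rquo_act 1 = \1%VF.
Proof.
by apply: quo_map_ext => v; rewrite /rquo_act quo_mapE // id_lfunE ract1 id_lfunE.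
Qed.
Fact rquo_actM a b : rquo_act (a * b) = (rquo_act b \o rquo_act a)%VF.
Proof.
apply: quo_map_ext => v; rewrite [RHS]comp_lfunE /rquo_act !quo_mapE // ractM.
by rewrite comp_lfunE.
Qed.

Definition rquo_mod : rmod A := RMod rquo_act_linear rquo_act1 rquo_actM.
Definition rquo_pi : 'Hom(M, rquo_mod) := quo_proj U.

Lemma rquo_pi_rhom : rhom rquo_pi.
Proof.
move=> a; apply/lfunP=> m; rewrite comp_lfunE [RHS]comp_lfunE.
by rewrite [RHS]/= /rquo_act quo_mapE.
Qed.
Lemma rquo_pi_surj : limg rquo_pi = fullv.
Proof. by apply/limgT=> u; exists (vsval u); apply: quo_proj_section. Qed.
Lemma rquo_pi_ker : lker rquo_pi = U.
Proof. exact: lker_quo_proj. Qed.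

End RightQuotient.

Implicit Types M N P Q X Y : lmod A.

(** Any linear section of [p] composed with [f] works, since two preimages of a
    point under [p] differ by an element that [f] kills. *)
Lemma surj_factor M Q N (p : 'Hom(M, Q)) (f : 'Hom(M, N)) :
  lhom p -> limg p = fullv -> lhom f -> (lker p <= lker f)%VS ->
  exists2 g : 'Hom(Q, N), lhom g & forall m, g (p m) = f m.
Proof.
move=> Hp sp Hf kpf; exists (f \o p^-1)%VF.
  have E m : (f \o p^-1)%VF (p m) = f m.
    rewrite comp_lfunE; apply/eqP; rewrite -subr_eq0 -linearB -memv_ker.
    by apply/(subvP kpf); rewrite memv_ker linearB /= limg_lfunVK ?subrr // memv_img ?memvf.
  apply/lhomP=> a q; have /limgT/(_ q)[m <-] := sp.
  by rewrite -lhomE // !E lhomE.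
move=> m; rewrite comp_lfunE; apply/eqP; rewrite -subr_eq0 -linearB -memv_ker.
by apply/(subvP kpf); rewrite memv_ker linearB /= limg_lfunVK ?subrr // memv_img ?memvf.
Qed.

Lemma surj_iso M N N' (p : 'Hom(M, N)) (p' : 'Hom(M, N')) :
  lhom p -> limg p = fullv -> lhom p' -> limg p' = fullv ->
  lker p = lker p' -> iso N N'.
Proof.
move=> Hp sp Hp' sp' kk.
have [f Hf fE] := surj_factor Hp sp Hp' (eq_ind _ (fun K => lker p <= K)%VS (subvv _) _ kk).
have [g Hg gE] := surj_factor Hp' sp' Hp (eq_ind _ (fun K => K <= lker p)%VS (subvv _) _ kk).
exists f, g; split=> //; apply/lfunP=> n; rewrite comp_lfunE id_lfunE.
  by have /limgT/(_ n)[m <-] := sp; rewrite fE gE.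
by have /limgT/(_ n)[m <-] := sp'; rewrite gE fE.
Qed.

End Quotients.


(** * Direct sums and indecomposable modules *)

Section Decompositions.
Variables (k : fieldType) (A : falgType k).
Implicit Types M N P Q X Y : lmod A.

(** The same notion as [summand], without naming the complement. *)
Definition retract N X := exists (i : 'Hom(N, X)) (p : 'Hom(X, N)),
  [/\ lhom i, lhom p & (p \o i = \1)%VF].

Lemma iso_retract N X : iso N X -> retract N X.
Proof. by case=> f [g [Hf Hg gf _]]; exists f, g. Qed.

Lemma retract_refl X : retract X X.
Proof. exact/iso_retract/iso_refl. Qed.

Lemma retract_trans N X Y : retract N X -> retract X Y -> retract N Y.
Proof.
case=> i [p [Hi Hp pi]] [j [q [Hj Hq qj]]].
exists (j \o i)%VF, (p \o q)%VF; split; try exact: lhom_comp.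
by rewrite -comp_lfunA (comp_lfunA q) qj comp_lfun1l.
Qed.

Lemma retract_zero N X : zero_mod X -> retract N X -> zero_mod N.
Proof.
move=> /zero_modP X0 [i [p [_ _ pi]]]; apply/zero_modP=> n.
by rewrite -[n]id_lfunE -pi comp_lfunE [i n]X0 linear0.
Qed.

Lemma dsum2P N N' X : is_dsum2 N N' X <->
  exists (i1 : 'Hom(N, X)) (p1 : 'Hom(X, N)) (i2 : 'Hom(N', X)) (p2 : 'Hom(X, N')),
  [/\ [/\ lhom i1, lhom p1, lhom i2 & lhom p2],
      (p1 \o i1 = \1)%VF /\ (p2 \o i2 = \1)%VF,
      (p1 \o i2 = 0)%VF /\ (p2 \o i1 = 0)%VF
    & ((i1 \o p1) + (i2 \o p2) = \1)%VF].
Proof.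
split=> [[i [p [H pi pij ip]]]|[i1 [p1 [i2 [p2 [[H1 H1' H2 H2'] [e1 e2] [z1 z2] s]]]]]].
  exists (i true), (p true), (i false), (p false); split.
  - by have [] := H true; have [] := H false.
  - by split; [have := pi true | have := pi false].
  - by split; [have := @pij true false isT | have := @pij false true isT].
  - by rewrite -ip big_bool.
exists (fun b => match b return 'Hom(if b then N else N', X) with
                 | true => i1 | false => i2 end).
exists (fun b => match b return 'Hom(X, if b then N else N') with
                 | true => p1 | false => p2 end).
by split=> [[]|[]|[] []|] //; rewrite big_bool.
Qed.

Lemma dsum2_sym N N' X : is_dsum2 N N' X -> is_dsum2 N' N X.
Proof.
move=> /dsum2P[i1 [p1 [i2 [p2 [[? ? ? ?] [? ?] [? ?] s]]]]]; apply/dsum2P.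
by exists i2, p2, i1, p1; split=> //; rewrite addrC.
Qed.

Lemma dsum2_iso N N' X M M' Y : iso N M -> iso N' M' -> iso X Y ->
  is_dsum2 N N' X -> is_dsum2 M M' Y.
Proof.
case=> f [g [Hf Hg gf fg]] [f' [g' [Hf' Hg' gf' fg']]] [h [l [Hh Hl lh hl]]].
move=> /dsum2P[i1 [p1 [i2 [p2 [[H1 H1' H2 H2'] [e1 e2] [z1 z2] s]]]]]; apply/dsum2P.
exists (h \o (i1 \o g))%VF, ((f \o p1) \o l)%VF.
exists (h \o (i2 \o g'))%VF, ((f' \o p2) \o l)%VF.
have C (U V W Z : lmod A) (a : 'Hom(X, U)) (b : 'Hom(V, X)) (c : 'Hom(U, Z)) (d : 'Hom(W, V)) :
    (((c \o a) \o l) \o (h \o (b \o d)) = c \o (a \o b) \o d)%VF.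
  by rewrite -!comp_lfunA (comp_lfunA l) lh comp_lfun1l.
split; first by split; do 2?exact: lhom_comp; do 2!apply: lhom_comp => //.
- by rewrite !C e1 e2 !comp_lfun1r fg fg'.
- by rewrite !C z1 z2 !comp_lfun0r !comp_lfun0l.
- have D (U V : lmod A) (b : 'Hom(U, X)) (a : 'Hom(X, U)) (c : 'Hom(U, V)) (d : 'Hom(V, U)) :
      (d \o c = \1)%VF -> ((h \o (b \o d)) \o ((c \o a) \o l) = h \o (b \o a) \o l)%VF.
    by move=> dc; rewrite -!comp_lfunA (comp_lfunA d) dc comp_lfun1l.
  by rewrite !D // -comp_lfunDl -comp_lfunDr s comp_lfun1r hl.
Qed.

Lemma dsum2_uniq N N' X Y : is_dsum2 N N' X -> is_dsum2 N N' Y -> iso X Y.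
Proof.
move=> /dsum2P[i1 [p1 [i2 [p2 [[H1 H1' H2 H2'] [e1 e2] [z1 z2] s]]]]].
move=> /dsum2P[j1 [q1 [j2 [q2 [[J1 J1' J2 J2'] [f1 f2] [y1 y2] t]]]]].
exists ((j1 \o p1) + (j2 \o p2))%VF, ((i1 \o q1) + (i2 \o q2))%VF.
split; try by apply: lhomD; apply: lhom_comp.
  rewrite comp_lfunDl !comp_lfunDr -!comp_lfunA !(comp_lfunA q1) !(comp_lfunA q2).
  by rewrite f1 f2 y1 y2 !comp_lfun1l !comp_lfun0l !comp_lfun0r addr0 add0r s.
rewrite comp_lfunDl !comp_lfunDr -!comp_lfunA !(comp_lfunA p1) !(comp_lfunA p2).
by rewrite e1 e2 z1 z2 !comp_lfun1l !comp_lfun0l !comp_lfun0r addr0 add0r t.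
Qed.

Lemma dsum_retract (I : finType) (N : I -> lmod A) X i :
  is_dsum N X -> retract (N i) X.
Proof. by case=> f [p [H pi _ _]]; exists (f i), (p i); have [? ?] := H i. Qed.

Lemma dsum2_retractl N N' X : is_dsum2 N N' X -> retract N X.
Proof. by move/(dsum_retract true). Qed.

Lemma dsum2_retractr N N' X : is_dsum2 N N' X -> retract N' X.
Proof. by move/(dsum_retract false). Qed.

(** The complement of a retract is the kernel of its retraction. *)
Lemma summandP N X : summand N X <-> retract N X.
Proof.
split=> [[N' /dsum2_retractl//]|[i [p [Hi Hp pi]]]].
have pE n : p (i n) = n by rewrite -comp_lfunE pi id_lfunE.
pose K := lker p; pose HK := submodule_lker Hp.
have inK x : x - i (p x) \in K by rewrite memv_ker linearB /= pE subrr.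
have qL : linear (fun x : X => vsproj K (x - i (p x))).
  by move=> c x y; rewrite -linearP /= [p _]linearP [i _]linearP scalerBr opprD addrACA.
pose q : 'Hom(X, sub_mod HK) := lin_hom qL.
have qE x : sub_inj HK (q x) = x - i (p x) by rewrite sub_injE lin_homE vsprojK.
have injK u v : sub_inj HK u = sub_inj HK v -> u = v.
  by rewrite !sub_injE => /subvs_inj.
have pK u : p (sub_inj HK u) = 0.
  by apply/eqP; rewrite -memv_ker sub_injE subvsP.
exists (sub_mod HK); apply/dsum2P; exists i, p, (sub_inj HK), q.
have HI := sub_inj_lhom HK.
split; [split=> // | split=> // | split | ].
- apply/lhomP=> a x; apply: injK; rewrite (lhomE _ _ HI) !qE linearB /=.
  by rewrite (lhomE _ _ Hp) (lhomE _ _ Hi).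
- apply/lfunP=> u; apply: injK.
  by rewrite comp_lfunE id_lfunE qE pK linear0 subr0.
- by apply/lfunP=> u; rewrite comp_lfunE zero_lfunE pK.
- by apply/lfunP=> n; apply: injK; rewrite comp_lfunE zero_lfunE qE pE subrr linear0.
- by apply/lfunP=> x; rewrite add_lfunE !comp_lfunE qE id_lfunE addrC subrK.
Qed.

(** The two projections commute with the action because [U] and [W] are both
    submodules. *)
Lemma split_dsum2 X (U W : {vspace X}) (HU : submodule U) (HW : submodule W) :
  (U + W = fullv)%VS -> (U :&: W = 0)%VS -> is_dsum2 (sub_mod HU) (sub_mod HW) X.
Proof.
move=> UW UW0; have WU0 : (W :&: U = 0)%VS by rewrite capvC.
pose pU := daddv_pi U W; pose pW := daddv_pi W U.
have addE x : pU x + pW x = x by apply: daddv_pi_add; rewrite ?UW ?memvf.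
have pUW w : w \in W -> pU w = 0.
  by move=> Ww; have := addE w; rewrite [pW w]daddv_pi_id // => /(canRL (addrK _)) ->; rewrite subrr.
have pWU u : u \in U -> pW u = 0.
  by move=> Uu; have := addE u; rewrite [pU u]daddv_pi_id // addrC => /(canRL (addrK _)) ->; rewrite subrr.
have pUa a x : pU (lact X a x) = lact X a (pU x).
  rewrite -{1}[x]addE !linearD /= (pUW (lact X a (pW x))) ?addr0.
    by rewrite [LHS]daddv_pi_id // submodP ?memv_pi.
  by rewrite submodP ?memv_pi.
have pWa a x : pW (lact X a x) = lact X a (pW x).
  rewrite -{1}[x]addE !linearD /= (pWU (lact X a (pU x))) ?add0r.
    by rewrite [LHS]daddv_pi_id // submodP ?memv_pi.
  by rewrite submodP ?memv_pi.
have qL : linear (fun x : X => vsproj U (pU x)) by move=> c x y; rewrite !linearP.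
have rL : linear (fun x : X => vsproj W (pW x)) by move=> c x y; rewrite !linearP.
pose q : 'Hom(X, sub_mod HU) := lin_hom qL; pose r : 'Hom(X, sub_mod HW) := lin_hom rL.
have qE x : vsval (q x) = pU x by rewrite lin_homE vsprojK ?memv_pi.
have rE x : vsval (r x) = pW x by rewrite lin_homE vsprojK ?memv_pi.
apply/dsum2P; exists (sub_inj HU), q, (sub_inj HW), r.
split; [split=> // | split | split | ]; try exact: sub_inj_lhom.
- by apply/lhomP=> a x; apply: subvs_inj; rewrite qE /= sub_actE // qE pUa.
- by apply/lhomP=> a x; apply: subvs_inj; rewrite rE /= sub_actE // rE pWa.
- apply/lfunP=> u; apply: subvs_inj.
  by rewrite comp_lfunE qE sub_injE id_lfunE [LHS]daddv_pi_id // subvsP.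
- apply/lfunP=> u; apply: subvs_inj.
  by rewrite comp_lfunE rE sub_injE id_lfunE [LHS]daddv_pi_id // subvsP.
- apply/lfunP=> u; apply: subvs_inj.
  by rewrite comp_lfunE qE sub_injE zero_lfunE pUW ?subvsP.
- apply/lfunP=> u; apply: subvs_inj.
  by rewrite comp_lfunE rE sub_injE zero_lfunE pWU ?subvsP.
- by apply/lfunP=> x; rewrite add_lfunE !comp_lfunE !sub_injE qE rE addE id_lfunE.
Qed.

Lemma sub_mod_zero X (U : {vspace X}) (HU : submodule U) :
  zero_mod (sub_mod HU) -> U = 0%VS.
Proof.
move=> /zero_modP U0; apply/eqP; rewrite -subv0; apply/subvP=> u Uu.
by rewrite memv0 -[u](vsprojK Uu) [vsproj U u]U0 linear0.
Qed.

Lemma indec_split X (U W : {vspace X}) : indecomposable X -> submodule U -> submodule W ->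
  (U + W = fullv)%VS -> (U :&: W = 0)%VS -> U = 0%VS \/ W = 0%VS.
Proof.
case=> _ H HU HW s c; have [/sub_mod_zero|/sub_mod_zero] := H _ _ (split_dsum2 HU HW s c).
  by left.
by right.
Qed.

Lemma indec_iso X Y : iso X Y -> indecomposable X -> indecomposable Y.
Proof.
move=> XY [X0 H]; split=> [/(iso_zero (iso_sym XY))//|N N' s]; apply: H.
by apply: dsum2_iso s; [apply: iso_refl | apply: iso_refl | apply: iso_sym].
Qed.

Lemma indec_retract_iso Y N : ~ zero_mod Y -> indecomposable N -> retract Y N -> iso Y N.
Proof.
move=> Y0 [_ H] /summandP[N' s]; have [//|N0] := H _ _ s.
move/dsum2P: s => [i1 [p1 [i2 [p2 [[H1 H1' H2 H2'] [e1 _] _ s]]]]].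
exists i1, p1; split=> //; rewrite -s.
suff -> : (i2 \o p2 = 0)%VF by rewrite addr0.
apply/lfunP=> n; rewrite comp_lfunE zero_lfunE; move/zero_modP: N0 => N0.
by rewrite [p2 n]N0 linear0.
Qed.

(** ** Endomorphisms of indecomposable modules *)

Fixpoint lpow X (f : 'End(X)) n : 'End(X) :=
  if n is n'.+1 then (lpow f n' \o f)%VF else \1%VF.

Lemma lpow_lhom X (f : 'End(X)) n : lhom f -> lhom (lpow f n).
Proof. by move=> Hf; elim: n => [|n IH]; [apply: lhom1 | apply: lhom_comp]. Qed.

Lemma lpowD X (f : 'End(X)) m n : lpow f (m + n) = (lpow f m \o lpow f n)%VF.
Proof.
by elim: n => [|n IH]; rewrite ?addn0 ?comp_lfun1r // addnS /= IH comp_lfunA.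
Qed.

(** Once the images of the powers of [f] have stabilised, image and kernel are
    complementary submodules. *)
Lemma fitting X (f : 'End(X)) : indecomposable X -> lhom f ->
  lker f == 0%VS \/ exists n, lpow f n = 0.
Proof.
move=> IX Hf; pose D n := \dim (limg (lpow f n)).
have DS n : (D n.+1 <= D n)%N by rewrite /D /= limg_comp dimvS // limgS ?subvf.
(* At a power whose image has minimal dimension the images have stabilised. *)
have [n nmin] : exists n, forall m, (D n <= D m)%N.
  have: exists n, (D n < (D 0).+1)%N by exists 0%N.
  elim: (D 0).+1 => [[n //]|d IH [n Dn]].
  have [|] := classic (exists m, (D m < d)%N); first exact: IH.
  move=> N; exists n => m; rewrite leqNgt; apply/negP=> L; apply: N.
  by exists m; apply: leq_trans L _.
pose g := lpow f n.+1; have Hg : lhom g by apply: lpow_lhom.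
have dgg : \dim (g @: limg g) = \dim (limg g).
  apply/eqP; rewrite eqn_leq -limg_comp; apply/andP; split.
    by rewrite limg_comp dimvS // limgS ?subvf.
  have -> : (g \o g)%VF = lpow f (n.+1 + n.+1) by rewrite lpowD.
  exact: leq_trans (DS n) (nmin _).
have cap0 : (limg g :&: lker g = 0)%VS.
  apply/eqP; rewrite -dimv_eq0; have := limg_ker_dim g (limg g); rewrite dgg.
  rewrite -{2}[\dim (limg g)]add0n => /addIn E; apply/eqP; exact: E.
have sum1 : (limg g + lker g = fullv)%VS.
  apply/eqP; rewrite eqEdim subvf dimv_disjoint_sum //.
  have := limg_ker_dim g fullv; rewrite capfv => <-.
  by rewrite [leqRHS]addnC leqnn.
have [I0|K0] := indec_split IX (submodule_limg Hg) (submodule_lker Hg) sum1 cap0.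
  right; exists n.+1; apply/lfunP=> x; apply/eqP; rewrite zero_lfunE -memv0 -I0.
  by rewrite memv_img ?memvf.
left; rewrite -subv0 -K0; apply/subvP=> x; rewrite !memv_ker => /eqP fx.
by rewrite /g /= comp_lfunE fx linear0.
Qed.

(** If [f] is nilpotent, then [g = 1 - f] is injective: a vector killed by [g] is
    fixed by every power of [f]. *)
Lemma indec_local1 X (f g : 'End(X)) : indecomposable X -> lhom f -> lhom g ->
  f + g = \1%VF -> lker f == 0%VS \/ lker g == 0%VS.
Proof.
move=> IX Hf Hg fg; have [|[n fn]] := fitting IX Hf; first by left.
right; rewrite -subv0; apply/subvP=> x; rewrite memv_ker memv0 => /eqP gx.
have fx : f x = x by rewrite -[RHS]id_lfunE -fg add_lfunE gx addr0.
suff <- : lpow f n x = x by rewrite fn zero_lfunE.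
by elim: n {fn} => [|n IH] /=; rewrite ?id_lfunE // comp_lfunE fx.
Qed.

(** Composing with the inverse of [f + g] reduces to the case [f + g = 1]. *)
Lemma indec_local X (f g : 'End(X)) : indecomposable X -> lhom f -> lhom g ->
  lker (f + g) == 0%VS -> lker f == 0%VS \/ lker g == 0%VS.
Proof.
move=> IX Hf Hg K; pose u := (f + g)^-1%VF.
have Hu : lhom u by apply: lhom_inv => //; [apply: lhomD | apply: lker0_limgf].
have E : ((u \o f) + (u \o g) = \1)%VF by rewrite -comp_lfunDr lker0_compVf.
have S (h : 'End(X)) : lker (u \o h)%VF == 0%VS -> lker h == 0%VS.
  rewrite -!subv0 => H; apply: subv_trans H; apply/subvP=> x.
  by rewrite !memv_ker comp_lfunE => /eqP->; rewrite linear0.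
by have [/S|/S] := indec_local1 IX (lhom_comp Hu Hf) (lhom_comp Hu Hg) E; [left|right].
Qed.

(** Krull-Schmidt, in the form used below: by locality, one of the summands of
    [1 = \sum_j p (inj_j proj_j) i] is invertible. *)
Lemma indec_retract_dsum (J : finType) (N : J -> lmod A) X Y :
  indecomposable Y -> is_dsum N X -> retract Y X -> exists j, retract Y (N j).
Proof.
move=> IY [inj [proj [H _ _ sum1]]] [i [p [Hi Hp pi]]].
pose h j : 'End(Y) := (p \o ((inj j \o proj j) \o i))%VF.
have Hh j : lhom (h j).
  by have [Hinj Hproj] := H j; do !apply: lhom_comp.
have hsum : \sum_j h j = \1%VF.
  apply/lfunP=> y; rewrite sum_lfunE id_lfunE -{2}[y]id_lfunE -pi comp_lfunE.
  rewrite -[i y]id_lfunE -sum1 sum_lfunE linear_sum; apply: eq_bigr => j _.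
  by rewrite !comp_lfunE.
have [j hj] : exists j, lker (h j) == 0%VS.
  apply: NNPP => N'; have: lhom (\sum_j h j) /\ lker (\sum_j h j) != 0%VS.
    elim/big_ind: _ => [|f g [Hf Kf] [Hg Kg]|j _].
    - split; first exact: lhom0.
      apply/negP=> /lker0P inj0; case: IY => [nz _]; apply: nz; apply/zero_modP=> y.
      by apply: inj0; rewrite !zero_lfunE.
    - split; first exact: lhomD.
      apply/negP=> K; have [K'|K'] := indec_local IY Hf Hg K.
        by rewrite K' in Kf.
      by rewrite K' in Kg.
    - by split=> //; apply/negP=> K; apply: N'; exists j.
  by rewrite hsum => -[_]; case/negP; apply/lker0P => x y; rewrite !id_lfunE.
have [Hinj Hproj] := H j.
exists j, (proj j \o i)%VF, ((h j)^-1 \o (p \o inj j))%VF; split.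
- exact: lhom_comp.
- by do !apply: lhom_comp => //; apply: lhom_inv => //; apply: lker0_limgf.
- by rewrite -(lker0_compVf hj) /h -!comp_lfunA.
Qed.

Lemma indec_retract_dsum2 N N' X Y : indecomposable Y -> is_dsum2 N N' X ->
  retract Y X -> retract Y N \/ retract Y N'.
Proof. by move=> IY s r; have [[] ?] := indec_retract_dsum IY s r; [left|right]. Qed.

(** ** Decomposition into indecomposables *)

Lemma dsum2_dim N N' X : is_dsum2 N N' X -> ~ zero_mod N' ->
  (\dim {: N} < \dim {: X})%N.
Proof.
move=> /dsum2P[i1 [p1 [i2 [p2 [[_ _ _ _] [e1 e2] [z1 _] _]]]]] nz.
have k0 : (fullv :&: lker i1 = 0)%VS.
  rewrite capfv; apply/eqP; rewrite -subv0; apply/subvP=> x.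
  rewrite memv_ker memv0 => /eqP E.
  by rewrite -[x]id_lfunE -e1 comp_lfunE E linear0.
rewrite -(limg_dim_eq k0) ltnNge; apply/negP=> L.
have /limgT full : limg i1 = fullv by apply/eqP; rewrite eqEdim subvf.
apply: nz; apply/zero_modP=> n; rewrite -[n]id_lfunE -e2 comp_lfunE.
have [m Em] := full (i2 n); suff m0 : m = 0 by rewrite -Em m0 !linear0.
by rewrite -[m]id_lfunE -e1 comp_lfunE Em -comp_lfunE z1 zero_lfunE.
Qed.

(** By induction on the dimension, as a decomposable module splits into two
    smaller ones. *)
Lemma indec_ind (S : lmod A -> Prop) :
  (forall X, zero_mod X -> S X) -> (forall X, indecomposable X -> S X) ->
  (forall N N' X, is_dsum2 N N' X -> S N -> S N' -> S X) -> forall X, S X.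
Proof.
move=> S0 SI S2 X; have [n] := ubnP (\dim {: X}); elim: n X => // n IH X dX.
have [z|nz] := classic (zero_mod X); first exact: S0.
have [I|nI] := classic (indecomposable X); first exact: SI.
have [[N N'] /= [s nN nN']] : exists NN : lmod A * lmod A,
    [/\ is_dsum2 NN.1 NN.2 X, ~ zero_mod NN.1 & ~ zero_mod NN.2].
  apply: NNPP => H; apply: nI; split=> // N N' s.
  apply: NNPP => H'; apply: H; exists (N, N'); split=> // z; apply: H'.
    by left.
  by right.
rewrite ltnS in dX; apply: (S2 _ _ _ s); apply: IH.
  exact: leq_trans (dsum2_dim s nN') dX.
exact: leq_trans (dsum2_dim (dsum2_sym s) nN) dX.
Qed.

Lemma exists_indec X : ~ zero_mod X -> exists2 Y, indecomposable Y & retract Y X.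
Proof.
elim/indec_ind: X => [X //|X IX _|N N' X s IN IN' nz].
  by exists X => //; apply: retract_refl.
have [z|nzN] := classic (zero_mod N).
  have [z'|nzN'] := classic (zero_mod N').
    case: nz; move: s z z' => /dsum2P[i1 [p1 [i2 [p2 [_ _ _ s]]]]] /zero_modP z /zero_modP z'.
    apply/zero_modP=> x; rewrite -[x]id_lfunE -s add_lfunE !comp_lfunE.
    by rewrite [p1 x]z [p2 x]z' !linear0 addr0.
  by have [Y IY r] := IN' nzN'; exists Y => //; apply: retract_trans r (dsum2_retractr s).
by have [Y IY r] := IN nzN; exists Y => //; apply: retract_trans r (dsum2_retractl s).
Qed.

(** ** Counting summands *)

Lemma num_of_dsum m (N : 'I_m -> lmod A) X : is_dsum N X ->
  (forall i, indecomposable (N i)) -> (forall i j, iso (N i) (N j) -> i = j) ->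
  num_summands X m.
Proof.
move=> s IN inj; exists N; split=> // [i|Y IY /summandP r].
  by split=> //; apply/summandP; apply: dsum_retract s.
have [j rj] := indec_retract_dsum IY s r; exists j.
exact: indec_retract_iso (proj1 IY) (IN j) rj.
Qed.

(** Two complete lists of pairwise non-isomorphic summands inject into each other. *)
Lemma num_summands_uniq X m m' : num_summands X m -> num_summands X m' -> m = m'.
Proof.
suff le n n' : num_summands X n -> num_summands X n' -> (n <= n')%N.
  by move=> H H'; apply/eqP; rewrite eqn_leq !le.
move=> [N [IN inj _]] [N' [_ _ ex]].
have [f Hf] : exists f : 'I_n -> 'I_n', forall i, iso (N i) (N' (f i)).
  by apply: (fin_all_exists (P := fun i j => iso (N i) (N' j))) => i; apply: ex; have [] := IN i.
have finj : injective f.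
  move=> i j E; apply: inj; apply: iso_trans (Hf i) _; rewrite E.
  exact/iso_sym.
by have := leq_card f finj; rewrite !card_ord.
Qed.

Lemma basic_num X m : basic X -> num_summands X m ->
  exists N : 'I_m -> lmod A, [/\ is_dsum N X, forall i, indecomposable (N i)
      & forall i j, iso (N i) (N j) -> i = j].
Proof.
move=> [n [N [s IN inj]]] H.
by have <- := num_summands_uniq (num_of_dsum s IN inj) H; exists N.
Qed.

Lemma dsum_I0 (N : 'I_0 -> lmod A) X : is_dsum N X <-> zero_mod X.
Proof.
split=> [[i [p [_ _ _ s]]]|/zero_modP X0].
  by apply/zero_modP=> x; rewrite -[x]id_lfunE -s big_ord0 zero_lfunE.
exists (fun _ => 0), (fun _ => 0); split=> [[] //|[] //|[] //|].
by apply/lfunP=> x; rewrite [LHS]X0 [RHS]X0.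
Qed.

Lemma dsum_I1 X : is_dsum (fun _ : 'I_1 => X) X.
Proof.
exists (fun _ => \1%VF), (fun _ => \1%VF); split=> [i|i|i j|].
- by split; apply: lhom1.
- by rewrite comp_lfun1l.
- by rewrite !ord1.
- by rewrite big_ord1 comp_lfun1l.
Qed.

Lemma dsum_I1_iso (N : 'I_1 -> lmod A) X : is_dsum N X -> iso (N ord0) X.
Proof.
case=> i [p [H pi _ s]]; exists (i ord0), (p ord0); have [? ?] := H ord0.
by split=> //; rewrite -s big_ord1.
Qed.

Lemma dsum_I2 N N' X : is_dsum2 N N' X ->
  is_dsum (fun i : 'I_2 => if i == ord0 then N else N') X.
Proof.
case=> i [p [H pi pij s]].
exists (fun j : 'I_2 => i (j == ord0)), (fun j : 'I_2 => p (j == ord0)).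
split=> [j|j|j l jl|]; [exact: H | exact: pi | | by rewrite -s big_bool big_ord_recl big_ord1].
apply: pij; apply: contra jl => /eqP.
by case: j l => [[|[|[]]] ? //] [[|[|[]]] ? //].
Qed.

Lemma dsum_I2_dsum2 (N : 'I_2 -> lmod A) X :
  is_dsum N X -> is_dsum2 (N ord0) (N ord_max) X.
Proof.
case=> i [p [H pi pij s]]; apply/dsum2P.
exists (i ord0), (p ord0), (i ord_max), (p ord_max).
have [? ?] := H ord0; have [? ?] := H ord_max.
split=> //; first by split; apply: pij.
rewrite -s big_ord_recl big_ord1.
by have -> : lift ord0 ord0 = ord_max :> 'I_2 by apply: val_inj.
Qed.

End Decompositions.


(** * Matrix pencils *)

(** A pencil is a representation of the Kronecker quiver, written as a pair of
    matrices; it encodes the relations of a module generated in one vertex. *)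
Record pencil (k : fieldType) := Pencil {
  pa : nat;
  pd : nat;
  pG : 'M[k]_(pa, pd);
  pD : 'M[k]_(pa, pd) }.

Section Pencils.
Variable k : fieldType.
Notation pencil := (pencil k).
Implicit Types C : pencil.

Definition phom C C' (S : 'M_(pa C, pa C')) (T : 'M_(pd C, pd C')) : Prop :=
  S *m pG C' = pG C *m T /\ S *m pD C' = pD C *m T.

Definition piso C C' : Prop :=
  exists (S : 'M_(pa C, pa C')) (T : 'M_(pd C, pd C'))
         (S' : 'M_(pa C', pa C)) (T' : 'M_(pd C', pd C)),
  [/\ phom S T, phom S' T', S *m S' = 1%:M /\ S' *m S = 1%:M
    & T *m T' = 1%:M /\ T' *m T = 1%:M].

(** This is the vanishing of the first extension group of [C] by [C']. *)
Definition ext_free C C' : Prop := forall X Y : 'M_(pa C, pd C'),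
  exists (S : 'M_(pa C, pa C')) (T : 'M_(pd C, pd C')),
    X = S *m pG C' + pG C *m T /\ Y = S *m pD C' + pD C *m T.

Definition rigid C : Prop := ext_free C C.

(** Ensures that the projective presentation given by the pencil is minimal. *)
Definition row_indep C : Prop :=
  forall c : 'rV_(pa C), c *m pG C = 0 -> c *m pD C = 0 -> c = 0.

(** ** Transposition *)

Definition ptr C : pencil := Pencil (pG C)^T (pD C)^T.

Lemma ptrK C : ptr (ptr C) = C.
Proof. by case: C => a d G D; rewrite /ptr /= !trmxK. Qed.

Lemma phom_tr C C' (S : 'M_(pa C, pa C')) (T : 'M_(pd C, pd C')) :
  phom S T -> @phom (ptr C') (ptr C) T^T S^T.
Proof. by case=> HG HD; split; rewrite /= -!trmx_mul ?HG ?HD. Qed.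

Lemma piso_tr C C' : piso C C' -> piso (ptr C) (ptr C').
Proof.
case=> S [T [S' [T' [H H' [SS' S'S] [TT' T'T]]]]].
exists T'^T, S'^T, T^T, S^T; split; try exact: phom_tr.
  by split; rewrite -trmx_mul ?T'T ?TT' trmx1.
by split; rewrite -trmx_mul ?S'S ?SS' trmx1.
Qed.

Lemma ext_free_tr C C' : ext_free C C' -> ext_free (ptr C') (ptr C).
Proof.
move=> H X Y; have [S [T [EX EY]]] := H X^T Y^T.
exists T^T, S^T; split; apply: trmx_inj.
  by rewrite EX linearD /= !trmx_mul !trmxK addrC.
by rewrite EY linearD /= !trmx_mul !trmxK addrC.
Qed.

(** ** Direct sums *)

Definition psum C C' : pencil :=
  Pencil (block_mx (pG C) 0 0 (pG C')) (block_mx (pD C) 0 0 (pD C')).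

Definition pzero : pencil := Pencil (0 : 'M[k]_(0, 0)) 0.

Definition pmul C n : pencil := iter n (psum C) pzero.

Lemma ptr_sum C C' : ptr (psum C C') = psum (ptr C) (ptr C').
Proof. by rewrite /ptr /psum /= !tr_block_mx !trmx0. Qed.

Lemma ptr_mul C n : ptr (pmul C n) = pmul (ptr C) n.
Proof.
elim: n => [|n IH]; first by rewrite /ptr /pmul /= /pzero !trmx0.
by rewrite /pmul !iterS ptr_sum -/(pmul _ _) IH.
Qed.

Lemma pa_mul C n : pa (pmul C n) = (n * pa C)%N.
Proof. by elim: n => [|n IH] //=; rewrite mulSn -IH. Qed.

Lemma pd_mul C n : pd (pmul C n) = (n * pd C)%N.
Proof. by elim: n => [|n IH] //=; rewrite mulSn -IH. Qed.

Lemma ext_free_suml C1 C2 C : ext_free C1 C -> ext_free C2 C -> ext_free (psum C1 C2) C.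
Proof.
move=> H1 H2 /= X Y.
have [S1 [T1 [EX1 EY1]]] := H1 (usubmx X) (usubmx Y).
have [S2 [T2 [EX2 EY2]]] := H2 (dsubmx X) (dsubmx Y).
exists (col_mx S1 S2), (col_mx T1 T2).
rewrite /= !mul_col_mx !mul_row_col !mul0mx !addr0 !add0r !add_col_mx.
by rewrite -EX1 -EX2 -EY1 -EY2 !vsubmxK.
Qed.

Lemma ext_free_sumr C C1 C2 : ext_free C C1 -> ext_free C C2 -> ext_free C (psum C1 C2).
Proof.
move=> /ext_free_tr H1 /ext_free_tr H2.
by rewrite -[C]ptrK -[psum _ _]ptrK ptr_sum; apply/ext_free_tr/ext_free_suml.
Qed.

Lemma ext_free_0l C C' : pa C = 0%N -> ext_free C C'.
Proof.
case: C => a d G D /= a0 X Y; rewrite /= in X Y *; subst a.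
by exists 0, 0; rewrite !flatmx0.
Qed.

Lemma ext_free_0r C C' : pd C' = 0%N -> ext_free C C'.
Proof. by move=> H; rewrite -[C]ptrK -[C']ptrK; apply/ext_free_tr/ext_free_0l. Qed.

Lemma ext_free_mull C C' n : ext_free C C' -> ext_free (pmul C n) C'.
Proof.
by move=> H; elim: n => [|n IH]; [apply: ext_free_0l | apply: ext_free_suml].
Qed.

Lemma ext_free_mulr C C' n : ext_free C C' -> ext_free C (pmul C' n).
Proof.
by move=> H; elim: n => [|n IH]; [apply: ext_free_0r | apply: ext_free_sumr].
Qed.

Lemma phom_inl C1 C2 : @phom C1 (psum C1 C2) (row_mx 1%:M 0) (row_mx 1%:M 0).
Proof.
by split; rewrite /= mul_row_block mul_mx_row !mul1mx !mul0mx !mulmx0 mulmx1 !addr0.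
Qed.

Lemma phom_inr C1 C2 : @phom C2 (psum C1 C2) (row_mx 0 1%:M) (row_mx 0 1%:M).
Proof.
by split; rewrite /= mul_row_block mul_mx_row !mul1mx !mul0mx !mulmx0 mulmx1 !add0r.
Qed.

Lemma phom_prl C1 C2 : @phom (psum C1 C2) C1 (col_mx 1%:M 0) (col_mx 1%:M 0).
Proof.
by split; rewrite /= mul_block_col mul_col_mx !mul1mx !mul0mx !mulmx0 mulmx1 !addr0.
Qed.

Lemma phom_prr C1 C2 : @phom (psum C1 C2) C2 (col_mx 0 1%:M) (col_mx 0 1%:M).
Proof.
by split; rewrite /= mul_block_col mul_col_mx !mul1mx !mul0mx !mulmx0 mulmx1 !add0r.
Qed.

Lemma row_indep_sum C1 C2 : row_indep C1 -> row_indep C2 -> row_indep (psum C1 C2).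
Proof.
move=> H1 H2 /= c; rewrite -[c]hsubmxK !mul_row_block !mulmx0 !addr0 !add0r -[0]hsubmxK.
move=> /eq_row_mx[g1 g2] /eq_row_mx[d1 d2].
rewrite !linear0 in g1 g2 d1 d2.
by rewrite [lsubmx c]H1 // [rsubmx c]H2 // row_mx0.
Qed.

(** ** Counting dimensions *)

(** When the extensions vanish, the linear map
    [(S, T) |-> (S G' - G T, S D' - D T)] is onto, so that the dimension of its
    kernel, the space of pencil homomorphisms, is given by the Euler form. *)
Section Euler.
Variables C C' : pencil.

Definition hom_defect (ST : 'M[k]_(pa C, pa C') * 'M[k]_(pd C, pd C')) :
    'M[k]_(pa C, pd C') * 'M[k]_(pa C, pd C') :=
  (ST.1 *m pG C' - pG C *m ST.2, ST.1 *m pD C' - pD C *m ST.2).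

Lemma hom_defect_linear : linear hom_defect.
Proof.
move=> c [S T] [S' T']; rewrite /hom_defect /=; congr (_, _) => /=.
  by rewrite !mulmxDl !mulmxDr -scalemxAl -scalemxAr scalerBr opprD addrACA.
by rewrite !mulmxDl !mulmxDr -scalemxAl -scalemxAr scalerBr opprD addrACA.
Qed.

Definition phom_space := lker (linfun hom_defect).

Lemma mem_phom_space S T : ((S, T) \in phom_space) <-> phom S T.
Proof.
rewrite memv_ker linfun_linE; last exact: hom_defect_linear.
split=> [/eqP[/eqP + /eqP]|[HG HD]]; last by rewrite /hom_defect /= HG HD !subrr.
by rewrite !subr_eq0 => /eqP HG /eqP HD.
Qed.

Lemma euler_form : ext_free C C' ->
  (\dim phom_space + (pa C * pd C' + pa C * pd C') = pa C * pa C' + pd C * pd C')%N.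
Proof.
move=> H; have := limg_ker_dim (linfun hom_defect) fullv; rewrite capfv.
have -> : limg (linfun hom_defect) = fullv.
  apply/eqP; rewrite eqEsubv subvf; apply/subvP=> -[X Y] _.
  have [S [T [EX EY]]] := H X Y.
  have <- : linfun hom_defect (S, - T) = (X, Y).
    rewrite linfun_linE; last exact: hom_defect_linear.
    by rewrite /hom_defect /= !mulmxN !opprK -EX -EY.
  by rewrite memv_img ?memvf.
by rewrite !dimvf /dim /= !dim_matrix.
Qed.

End Euler.

Lemma phom_one C : @phom C C 1%:M 1%:M.
Proof. by split; rewrite mulmx1 mul1mx. Qed.

Lemma phom_space_one_neq0 C : (0 < pd C)%N -> ((1%:M, 1%:M) : 'M[k]_(pa C) * 'M[k]_(pd C)) != 0.
Proof.
move=> d0; apply/eqP=> -[_ /matrixP/(_ (Ordinal d0) (Ordinal d0))/eqP].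
by rewrite !mxE eqxx oner_eq0.
Qed.

(** For a pencil with [a] rows and [d] columns the Euler form is [(d - a)^2]. If it
    vanishes there is no nonzero endomorphism, not even the identity. *)
Lemma rigid_not_square C : rigid C -> pa C = pd C -> pd C = 0%N.
Proof.
move=> H E; apply/eqP; case: posnP => // d0.
have /eqP : \dim (phom_space C C) = 0%N.
  move: (euler_form H); move: (\dim _) => n; rewrite E => /eqP.
  by rewrite -[X in _ == X]add0n eqn_add2r => /eqP.
rewrite dimv_eq0 => /eqP z.
have /mem_phom_space := phom_one C; rewrite z memv0.
by rewrite (negPf (phom_space_one_neq0 d0)).
Qed.

Lemma addrKAC (V : zmodType) (x y z : V) : x + z - (y + z) = x - y.
Proof. by rewrite opprD addrACA subrr addr0. Qed.

(** ** The reflection functor *)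

(** [shift] relates [(G, D)] to the cokernel [(G', D')] of its rows, up to a sign. *)
Definition shift a d d' (G D : 'M[k]_(a, d)) (G' D' : 'M[k]_(d, d')) : Prop :=
  [/\ G *m D' = D *m G', row_free (row_mx (- D) G), row_full (col_mx G' D')
    & (a + d' = d + d)%N].

(** The equality [a + b = m] makes the sequence given by [N] and [B] exact in the
    middle, by comparing dimensions. *)
Lemma exact_left a m b c (N : 'M[k]_(a, m)) (B : 'M_(m, b)) (Y : 'M_(c, m)) :
  N *m B = 0 -> row_free N -> row_full B -> (a + b = m)%N ->
  Y *m B = 0 -> exists S, Y = S *m N.
Proof.
move=> NB fN fB E YB; apply/submxP.
apply: submx_trans (_ : (Y <= kermx B)%MS) _; first exact/sub_kermxP.
have NK : (N <= kermx B)%MS by apply/sub_kermxP.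
rewrite -(geq_leqif (mxrank_leqif_sup NK)) mxrank_ker.
by move/eqP: fN => ->; move/eqP: fB => ->; rewrite -E addnK.
Qed.

Lemma exact_right a m b c (N : 'M[k]_(a, m)) (B : 'M_(m, b)) (X : 'M_(m, c)) :
  N *m B = 0 -> row_free N -> row_full B -> (a + b = m)%N ->
  N *m X = 0 -> exists U, X = B *m U.
Proof.
move=> NB fN fB E NX.
have NB' : B^T *m N^T = 0 by rewrite -trmx_mul NB trmx0.
have fB' : row_free B^T by rewrite /row_free mxrank_tr.
have fN' : row_full N^T by rewrite /row_full mxrank_tr.
have NX' : X^T *m N^T = 0 by rewrite -trmx_mul NX trmx0.
have [S ES] := exact_left NB' fB' fN' (etrans (addnC b a) E) NX'.
by exists S^T; apply: trmx_inj; rewrite ES trmx_mul trmxK.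
Qed.

Lemma shift_mul a d d' (G D : 'M[k]_(a, d)) (G' D' : 'M[k]_(d, d')) :
  shift G D G' D' -> row_mx (- D) G *m col_mx G' D' = 0.
Proof. by case=> E _ _ _; rewrite mul_row_col mulNmx E addrC subrr. Qed.

(** A solution [(T, U)] of the equations for the reflected pencils, with a right-hand
    side [Z] computed from [(X, Y)] by a right inverse of [row_mx (- D1) G1], makes
    the error [row_mx (- (Y - D1 T)) (X - G1 T)] vanish on [col_mx G2' D2']; by
    exactness the error comes from some [S]. *)
Lemma ext_free_unshift a1 d1 e1 (G1 D1 : 'M[k]_(a1, d1)) (G1' D1' : 'M_(d1, e1))
    a2 d2 e2 (G2 D2 : 'M[k]_(a2, d2)) (G2' D2' : 'M_(d2, e2)) :
  shift G1 D1 G1' D1' -> shift G2 D2 G2' D2' ->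
  ext_free (Pencil G1' D1') (Pencil G2' D2') -> ext_free (Pencil G1 D1) (Pencil G2 D2).
Proof.
move=> s1 s2 H /= X Y.
have [E1 fN1 fB1 n1] := s1; have [E2 fN2 fB2 n2] := s2.
have [B NB] := row_freeP fN1.
pose Z := B *m (X *m D2' - Y *m G2').
have EZ : G1 *m dsubmx Z - D1 *m usubmx Z = X *m D2' - Y *m G2'.
  rewrite -[RHS]mul1mx -NB -mulmxA -/Z -{3}[Z]vsubmxK mul_row_col mulNmx.
  by rewrite addrC.
have /= [T [U [EX EY]]] := H (usubmx Z) (dsubmx Z).
have [|/= S ES] := exact_left (Y := row_mx (- (Y - D1 *m T)) (X - G1 *m T)) (shift_mul s2) fN2 fB2 n2.
  rewrite mul_row_col mulNmx !mulmxBl opprB addrACA -opprD.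
  move: EZ; rewrite EX EY !mulmxDr !mulmxA E1 addrKAC => /eqP.
  rewrite subr_eq => /eqP->; apply/eqP; rewrite subr_eq0.
  by rewrite [X in _ == X]addrA [Y *m _ + _]addrC subrK [X in _ == X]addrC.
move: ES; rewrite mul_mx_row mulmxN => /eq_row_mx[/oppr_inj ED EG].
exists S, T; rewrite -EG -ED; split; by rewrite subrK.
Qed.

(** The same diagram chase in the other direction, with a left inverse of
    [col_mx G2' D2']. *)
Lemma ext_free_shift a1 d1 e1 (G1 D1 : 'M[k]_(a1, d1)) (G1' D1' : 'M_(d1, e1))
    a2 d2 e2 (G2 D2 : 'M[k]_(a2, d2)) (G2' D2' : 'M_(d2, e2)) :
  shift G1 D1 G1' D1' -> shift G2 D2 G2' D2' ->
  ext_free (Pencil G1 D1) (Pencil G2 D2) -> ext_free (Pencil G1' D1') (Pencil G2' D2').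
Proof.
move=> s1 s2 H /= X' Y'.
have [E1 fN1 fB1 n1] := s1; have [E2 fN2 fB2 n2] := s2.
have [B BB] := row_fullP fB2.
pose Z := (G1 *m Y' - D1 *m X') *m B.
have EZ : rsubmx Z *m D2' + lsubmx Z *m G2' = G1 *m Y' - D1 *m X'.
  by rewrite -[RHS]mulmx1 -BB mulmxA -/Z -{3}[Z]hsubmxK mul_row_col addrC.
have /= [S [T [EX EY]]] := H (rsubmx Z) (- lsubmx Z).
have [|/= U EU] := exact_right (X := col_mx (X' - T *m G2') (Y' - T *m D2')) (shift_mul s1) fN1 fB1 n1.
  move: EZ; rewrite -[lsubmx Z]opprK EX EY mulNmx !mulmxDl -!mulmxA E2.
  rewrite ![S *m _ + _]addrC addrKAC => /esym/eqP; rewrite subr_eq => /eqP EZ.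
  rewrite mul_row_col mulNmx !mulmxBr opprB EZ; apply/eqP.
  by rewrite addr_eq0 opprB opprD addrA opprB addrCA subrr addr0.
move: EU; rewrite mul_col_mx => /eq_col_mx[EG ED].
by exists T, U; rewrite -EG -ED; split; rewrite addrC subrK.
Qed.

(** Functoriality of cokernels. *)
Lemma phom_shift a1 d1 e1 (G1 D1 : 'M[k]_(a1, d1)) (G1' D1' : 'M_(d1, e1))
    a2 d2 e2 (G2 D2 : 'M[k]_(a2, d2)) (G2' D2' : 'M_(d2, e2)) S T :
  shift G1 D1 G1' D1' -> shift G2 D2 G2' D2' ->
  @phom (Pencil G1 D1) (Pencil G2 D2) S T ->
  exists U, @phom (Pencil G1' D1') (Pencil G2' D2') T U.
Proof.
move=> s1 s2 [/= HG HD].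
have [E1 fN1 fB1 n1] := s1; have [E2 fN2 fB2 n2] := s2.
have [|/= U EU] := exact_right (X := col_mx (T *m G2') (T *m D2')) (shift_mul s1) fN1 fB1 n1.
  by rewrite mul_row_col mulNmx !mulmxA -HG -HD -!mulmxA E2 addNr.
by exists U; move: EU; rewrite mul_col_mx => /eq_col_mx[].
Qed.

(** The induced maps on the cokernels are mutually inverse because the projections
    onto the cokernels have full column rank. *)
Lemma piso_shift a1 d1 e1 (G1 D1 : 'M[k]_(a1, d1)) (G1' D1' : 'M_(d1, e1))
    a2 d2 e2 (G2 D2 : 'M[k]_(a2, d2)) (G2' D2' : 'M_(d2, e2)) :
  shift G1 D1 G1' D1' -> shift G2 D2 G2' D2' ->
  piso (Pencil G1 D1) (Pencil G2 D2) -> piso (Pencil G1' D1') (Pencil G2' D2').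
Proof.
move=> s1 s2 [/= S [T [S' [T' [H H' _ [TT' T'T]]]]]].
have [U HU] := phom_shift s1 s2 H; have [U' HU'] := phom_shift s2 s1 H'.
exists T, U, T', U'; split=> //=.
have K d e (G D : 'M[k]_(d, e)) (V : 'M_e) :
    row_full (col_mx G D) -> G *m V = G -> D *m V = D -> V = 1%:M.
  by move=> f EG ED; apply: (row_full_inj f); rewrite mulmx1 mul_col_mx EG ED.
case: HU HU' => /= g d [/= g' d']; have [_ _ f1 _] := s1; have [_ _ f2 _] := s2.
split; apply: K; try eassumption; rewrite mulmxA -?g -?d -?g' -?d' -mulmxA.
- by rewrite -g' mulmxA TT' mul1mx.
- by rewrite -d' mulmxA TT' mul1mx.
- by rewrite -g mulmxA T'T mul1mx.
- by rewrite -d mulmxA T'T mul1mx.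
Qed.

(** ** Uniqueness of rigid pencils *)

Lemma row_freeI m n (A : 'M[k]_(m, n)) : (forall c : 'rV_m, c *m A = 0 -> c = 0) -> row_free A.
Proof.
move=> H; rewrite -kermx_eq0; apply/eqP/row_matrixP=> i; rewrite row0; apply: H.
by rewrite -row_mul mulmx_ker row0.
Qed.

Lemma row_fullI m n (A : 'M[k]_(m, n)) : (forall c : 'cV_n, A *m c = 0 -> c = 0) -> row_full A.
Proof.
move=> H; rewrite /row_full -mxrank_tr; apply: row_freeI => c Hc.
by apply: trmx_inj; rewrite trmx0; apply: H; apply: trmx_inj; rewrite trmx_mul trmxK Hc trmx0.
Qed.

(** A common kernel vector [c] of [G] and [D] turns the rigidity equations,
    multiplied by [c], into the surjectivity of the stacked matrix. *)
Lemma rigid_max_rank a d (G D : 'M[k]_(a, d)) : rigid (Pencil G D) ->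
  row_full (col_mx G D) \/ row_free (col_mx G D).
Proof.
move=> H; have [|nf] := boolP (row_full (col_mx G D)); first by left.
right; have [c [Gc Dc c0]] : exists c : 'cV_d, [/\ G *m c = 0, D *m c = 0 & c != 0].
  apply: NNPP => N; case/negP: nf; apply: row_fullI => c.
  rewrite mul_col_mx -[0]vsubmxK !linear0 => /eq_col_mx[Gc Dc].
  by apply/eqP; apply: contra_notT N => c0; exists c.
have [l lc] : exists l : 'rV_d, l *m c = 1%:M.
  by apply/row_fullP; rewrite /row_full eqn_leq rank_leq_col lt0n mxrank_eq0.
apply: row_freeI => u; rewrite -[u]hsubmxK mul_row_col => E.
have key X Y : lsubmx u *m (X *m c) + rsubmx u *m (Y *m c) = 0.
  have /= [S [T [-> ->]]] := H X Y.
  by rewrite !mulmxDl -!mulmxA Gc Dc !mulmx0 !add0r !mulmxA -!mulmxDl E !mul0mx.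
have zero (v : 'rV_a) : (forall X : 'M_(a, d), v *m (X *m c) = 0) -> v = 0.
  move=> Hv; apply/rowP=> i; have := Hv (delta_mx i 0 *m l).
  by rewrite -mulmxA lc mulmx1 -colE => /matrixP/(_ 0 0); rewrite !mxE.
have u1 : lsubmx u = 0.
  by apply: zero => X; have := key X 0; rewrite mul0mx mulmx0 addr0.
have u2 : rsubmx u = 0.
  by apply: zero => X; have := key 0 X; rewrite mul0mx mulmx0 add0r.
by rewrite u1 u2 row_mx0.
Qed.

(** Both matrices are brought to the form [pid_mx m] by a row and a column operation,
    and the row operation on [pid_mx m] is the column operation [N]. *)
Lemma row_free_equiv m n (B B' : 'M[k]_(m, n)) : row_free B -> row_free B' ->
  exists T T' : 'M_n, [/\ B *m T = B', T *m T' = 1%:M & T' *m T = 1%:M].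
Proof.
move=> fB fB'; have mn : (m <= n)%N by rewrite -(eqP fB) rank_leq_col.
pose P : 'M[k]_(m, n) := pid_mx m; pose P' : 'M[k]_(n, m) := pid_mx m.
have PP' : P *m P' = 1%:M by rewrite pid_mx_id // pid_mx_1.
have [Q [PC CP CC CCC]] : exists Q : 'M[k]_n,
    [/\ P *m Q = 0, Q *m P' = 0, Q + P' *m P = 1%:M & Q *m Q = Q].
  exists (copid_mx m); split; first by rewrite mul_pid_mx_copid.
  - by rewrite mul_copid_mx_pid.
  - by rewrite pid_mx_id // subrK.
  - by rewrite copid_mx_id.
have norm (A : 'M[k]_(m, n)) : row_free A ->
    exists U V : 'M_n, [/\ A = P *m U, U *m V = 1%:M & V *m U = 1%:M].
  move=> fA; have := mulmx_ebase A; rewrite (eqP fA) -/P.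
  set L := col_ebase A; set R := row_ebase A => EA.
  have uL : L \in unitmx := col_ebase_unit A; have uR : R \in unitmx := row_ebase_unit A.
  pose N (M : 'M[k]_m) := P' *m M *m P + Q.
  have NM M M' : N M *m N M' = N (M *m M').
    rewrite /N mulmxDl !mulmxDr -!mulmxA PC !mulmx0 addr0 (mulmxA Q) CP.
    by rewrite mul0mx add0r CCC (mulmxA P) PP' mul1mx !mulmxA.
  have N1 : N 1%:M = 1%:M by rewrite /N mulmx1 addrC.
  exists (N L *m R), (invmx R *m N (invmx L)); split.
  - by rewrite mulmxA /N mulmxDr PC addr0 !mulmxA PP' mul1mx.
  - by rewrite mulmxA mulmxK // NM mulmxV.
  - by rewrite -mulmxA (mulmxA _ (N L)) NM mulVmx // N1 mul1mx mulVmx.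
have [U [V [-> UV VU]]] := norm B fB; have [U' [V' [-> UV' VU']]] := norm B' fB'.
exists (V *m U'), (V' *m U); split.
- by rewrite mulmxA -(mulmxA P) UV mulmx1.
- by rewrite -mulmxA (mulmxA U') UV' mul1mx.
- by rewrite -mulmxA (mulmxA U) UV mul1mx.
Qed.

(** The rows of [row_mx (- D) G] form a basis of the relations between the rows of
    the stacked matrix. *)
Lemma exists_unshift d e (G' D' : 'M[k]_(d, e)) : row_full (col_mx G' D') -> (e <= d + d)%N ->
  exists (a : nat) (G D : 'M_(a, d)), shift G D G' D'.
Proof.
move=> f ed; pose N := row_base (kermx (col_mx G' D')).
have NB : N *m col_mx G' D' = 0 by apply/sub_kermxP; rewrite eq_row_base.
have fN : row_free N by apply: row_base_free.
exists _, (rsubmx N), (- lsubmx N); split=> //.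
- move: NB; rewrite -[N]hsubmxK mul_row_col row_mxKl row_mxKr mulNmx => /eqP.
  by rewrite addrC addr_eq0 => /eqP.
- by rewrite opprK hsubmxK.
- by rewrite mxrank_ker (eqP f) subnK.
Qed.

(** Reflecting shrinks a rigid pencil until its stacked matrix has independent
    rows; there the pencil is determined by its size, and the reflections are
    undone by [piso_shift]. *)
Theorem rigid_unique C C' : pa C = pa C' -> pd C = pd C' -> (pa C < pd C)%N ->
  rigid C -> rigid C' -> piso C C'.
Proof.
have [n] := ubnP (pa C); elim: n C C' => // n IH [a d G1 D1] [a' d' G2 D2] /= an ea ed.
subst a' d' => ad R1 R2.
have base : (d >= a + a)%N -> row_free (col_mx G1 D1).
  move=> dl; have [f|//] := rigid_max_rank R1.
  by rewrite /row_free eqn_leq rank_leq_row (eqP f).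
have base' : (d >= a + a)%N -> row_free (col_mx G2 D2).
  move=> dl; have [f|//] := rigid_max_rank R2.
  by rewrite /row_free eqn_leq rank_leq_row (eqP f).
(* With at least twice as many columns as rows, there is no reflection left to do. *)
have [dl|dl] := leqP (a + a)%N d.
  have [T [T' [E TT' T'T]]] := row_free_equiv (base dl) (base' dl).
  move: (E); rewrite mul_col_mx => /eq_col_mx[EG ED].
  exists 1%:M, T, 1%:M, T'; split=> //; try by rewrite mulmx1.
    by split; rewrite /= mul1mx.
  by split; rewrite /= mul1mx -?EG -?ED -mulmxA TT' mulmx1.
have full (G D : 'M[k]_(a, d)) : rigid (Pencil G D) -> row_full (col_mx G D).
  move=> R; have [//|f] := rigid_max_rank R.
  by have := rank_leq_col (col_mx G D); rewrite (eqP f) leqNgt dl.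
have [b1 [H1 [F1 s1]]] := exists_unshift (full _ _ R1) (ltnW dl).
have [b2 [H2 [F2 s2]]] := exists_unshift (full _ _ R2) (ltnW dl).
apply: (piso_shift s1 s2).
have [_ _ _ e1] := s1; have [_ _ _ e2] := s2.
have b1a : (b1 < a)%N by rewrite -(ltn_add2r d) e1 ltn_add2l.
apply: IH => //=.
- exact: leq_trans b1a an.
- by apply: (@addIn d); rewrite e1 e2.
- exact: (ext_free_unshift s1 s1 R1).
- exact: (ext_free_unshift s2 s2 R2).
Qed.

(** ** Preprojective and preinjective pencils *)

Section Kronecker.
Variable n : nat.
Definition ord_lo : 'I_n -> 'I_n.+1 := widen_ord (leqnSn n).
Definition ord_hi : 'I_n -> 'I_n.+1 := lift ord0.
Definition lo_mx : 'M[k]_(n, n.+1) := rowsub ord_lo 1%:M.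
Definition hi_mx : 'M[k]_(n, n.+1) := rowsub ord_hi 1%:M.

Lemma lo_mul m (X : 'M_(n.+1, m)) : lo_mx *m X = rowsub ord_lo X.
Proof. by rewrite mul_rowsub_mx mul1mx. Qed.

Lemma hi_mul m (X : 'M_(n.+1, m)) : hi_mx *m X = rowsub ord_hi X.
Proof. by rewrite mul_rowsub_mx mul1mx. Qed.

Lemma lo_tr : lo_mx *m lo_mx^T = 1%:M.
Proof. by apply/matrixP=> i j; rewrite lo_mul !mxE -!val_eqE /= eq_sym. Qed.

(** The vector-space dimension of this pencil, read as a Kronecker module, is
    [(n, n + 1)]: these are the preprojective modules, and their transposes are
    the preinjective ones. *)
Definition kron : pencil := Pencil lo_mx hi_mx.

End Kronecker.

Definition cokron n : pencil := ptr (kron n).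

Lemma lo_hi n : lo_mx n *m hi_mx n.+1 = hi_mx n *m lo_mx n.+1.
Proof.
by rewrite lo_mul hi_mul; apply/matrixP=> i j; rewrite !mxE -!val_eqE /= /bump leq0n.
Qed.

Lemma kron_shift n : shift (lo_mx n) (hi_mx n) (lo_mx n.+1) (hi_mx n.+1).
Proof.
split; [exact: lo_hi | | | by rewrite !addSn !addnS].
  apply/row_freeP; exists (col_mx 0 (lo_mx n)^T).
  by rewrite mul_row_col mulmx0 add0r lo_tr.
apply: row_fullI => c; rewrite mul_col_mx -[0]vsubmxK !linear0 => /eq_col_mx[L H].
apply/colP=> i; rewrite mxE; case: (unliftP ord0 i) => [j ->|->].
  by move: H; rewrite hi_mul => /colP/(_ j); rewrite !mxE.
move: L; rewrite lo_mul => /colP/(_ ord0); rewrite !mxE => <-; congr (c _ _).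
exact: val_inj.
Qed.

Lemma ext_free_kron_shift m n : ext_free (kron m) (kron n) -> ext_free (kron m.+1) (kron n.+1).
Proof. exact: ext_free_shift (kron_shift m) (kron_shift n). Qed.

Lemma ext_free_kron n : ext_free (kron n) (kron n).
Proof. by elim: n => [|n]; [apply: ext_free_0l | apply: ext_free_kron_shift]. Qed.

Lemma ext_free_kronSr n : ext_free (kron n) (kron n.+1).
Proof. by elim: n => [|n]; [apply: ext_free_0l | apply: ext_free_kron_shift]. Qed.

Lemma ext_free_kronSl n : ext_free (kron n.+1) (kron n).
Proof.
elim: n => [|n]; last exact: ext_free_kron_shift.
move=> /= X Y; exists 0, (\matrix_(i, j) if i == ord0 then X 0 j else Y 0 j).
rewrite !mul0mx !add0r lo_mul hi_mul.
by split; apply/matrixP=> i j; rewrite !mxE !ord1.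
Qed.

(** By the Euler form this space of homomorphisms has dimension
    [(n + 1) n + (n + 2) (n + 1) - 2 (n + 1)^2 = 0]. *)
Lemma kron_hom0 n (S : 'M_(pa (kron n.+1), pa (kron n))) T :
  @phom (kron n.+1) (kron n) S T -> S = 0 /\ T = 0.
Proof.
move=> /mem_phom_space H; have := euler_form (@ext_free_kronSl n) => /= E.
suff z : phom_space (kron n.+1) (kron n) = 0%VS by move: H; rewrite z memv0 => /eqP[-> ->].
apply/eqP; rewrite -dimv_eq0; move: E; move: (\dim _) => m E.
by apply/eqP; lia.
Qed.

(** The Euler form takes the value 1 on these pencils. *)
Lemma kron_brick n (S : 'M_(pa (kron n), pa (kron n))) T :
  @phom (kron n) (kron n) S T -> exists c : k, S = c%:M /\ T = c%:M.
Proof.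
move=> /mem_phom_space H; have := euler_form (@ext_free_kron n) => /= E.
have dim1 : \dim (phom_space (kron n) (kron n)) = 1%N.
  by move: E; move: (\dim _) => m E; lia.
pose u : 'M[k]_n * 'M[k]_(n.+1) := (1%:M, 1%:M).
have Hu : u \in phom_space (kron n) (kron n) by apply/mem_phom_space/phom_one.
have u0 : u != 0 by apply: (@phom_space_one_neq0 (kron n)).
have line : (<[u]> = phom_space (kron n) (kron n))%VS.
  by apply/eqP; rewrite eqEdim -memvE Hu dim_vline u0 dim1.
move: H; rewrite -line => /vlineP[c [-> ->]]; exists c.
by rewrite !scalemx1.
Qed.

Lemma cokron_hom0 n (S : 'M_(pa (cokron n), pa (cokron n.+1))) T :
  @phom (cokron n) (cokron n.+1) S T -> T = 0.
Proof.
case=> /= L H; have [|TT _] := @kron_hom0 n T^T S^T.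
  by split=> /=; apply: trmx_inj; rewrite !trmx_mul !trmxK.
by apply: trmx_inj; rewrite TT trmx0.
Qed.

Lemma cokron_brick n (S : 'M_(pa (cokron n), pa (cokron n))) T :
  @phom (cokron n) (cokron n) S T -> exists c : k, T = c%:M.
Proof.
case=> /= L H; have [|c [TT _]] := @kron_brick n T^T S^T.
  by split=> /=; apply: trmx_inj; rewrite !trmx_mul !trmxK.
by exists c; apply: trmx_inj; rewrite TT tr_scalar_mx.
Qed.

Lemma row_indep_kron n : row_indep (kron n).
Proof. by move=> c /= H _; rewrite -[c]mulmx1 -lo_tr mulmxA H mul0mx. Qed.

Lemma row_indep_cokron n : row_indep (cokron n.+1).
Proof.
move=> /= c L H; apply: trmx_inj; rewrite trmx0; apply/colP=> i.
case: (unliftP ord0 i) => [j ->|->].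
  have := congr1 trmx H; rewrite trmx_mul trmxK hi_mul trmx0 => /colP/(_ j).
  by rewrite !mxE.
have := congr1 trmx L; rewrite trmx_mul trmxK lo_mul trmx0 => /colP/(_ ord0).
by rewrite !mxE => <-; congr (c _ _); apply: val_inj.
Qed.

(** The modules presented by [C] and [C'] are generated by as many elements as the
    pencils have columns; the condition says that homomorphisms from the first one
    reach every generator of the second. *)
Definition covers C C' : Prop := forall j : 'I_(pd C'),
  exists (S : 'M_(pa C, pa C')) (T : 'M_(pd C, pd C')) (i : 'I_(pd C)),
    phom S T /\ row i T = delta_mx 0 j.

Lemma phom_lo n : @phom (kron n) (kron n.+1) (lo_mx n) (lo_mx n.+1).
Proof. by split=> //=; apply: lo_hi. Qed.

Lemma phom_hi n : @phom (kron n) (kron n.+1) (hi_mx n) (hi_mx n.+1).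
Proof. by split=> //=; rewrite lo_hi. Qed.

Lemma covers_kron n : covers (kron n) (kron n.+1).
Proof.
move=> /= j; case: (unliftP ord0 j) => [i ->|->].
  exists (hi_mx n), (hi_mx n.+1), i; split; first exact: phom_hi.
  by apply/rowP=> l; rewrite !mxE eq_sym.
exists (lo_mx n), (lo_mx n.+1), ord0; split; first exact: phom_lo.
by apply/rowP=> l; rewrite !mxE -!val_eqE /= eq_sym.
Qed.

Lemma covers_cokron n : covers (cokron n.+1) (cokron n).
Proof.
move=> /= j; exists (lo_mx n.+1)^T, (lo_mx n)^T, (ord_lo j); split.
  exact: (phom_tr (phom_lo n)).
by apply/rowP=> l; rewrite !mxE -!val_eqE /= eq_sym.
Qed.

(** ** Classification *)

Lemma rigid_sum C C' x y : ext_free C C -> ext_free C' C' -> ext_free C C' -> ext_free C' C ->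
  rigid (psum (pmul C x) (pmul C' y)).
Proof.
move=> H11 H22 H12 H21.
by apply: ext_free_suml; apply: ext_free_sumr; apply: ext_free_mull; apply: ext_free_mulr.
Qed.

(** Let [d] be the number of columns minus the number of rows, and divide the number
    of rows by [d], with remainder [r]. Then [d - r] copies of [kron n] and [r] copies of
    [kron n.+1] form a rigid pencil of the size of [C], hence isomorphic to [C]. *)
Theorem rigid_kron C (n := (pa C %/ (pd C - pa C))%N) : rigid C -> (pa C < pd C)%N ->
  exists x y, piso C (psum (pmul (kron n) x) (pmul (kron n.+1) y)).
Proof.
move=> R ad; rewrite /n; set d := (pd C - pa C)%N.
have d0 : (0 < d)%N by rewrite subn_gt0.
exists (d - pa C %% d)%N, (pa C %% d)%N.
have := divn_eq (pa C) d; have := ltn_pmod (pa C) d0.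
set q := (pa C %/ d)%N; set r := (pa C %% d)%N => rd E.
have Ed : (pa C + d = pd C)%N by rewrite subnKC // ltnW.
apply: rigid_unique => //; rewrite /= ?pa_mul ?pd_mul /=; last first.
  by apply: rigid_sum; [apply: ext_free_kron | apply: ext_free_kron
                      | apply: ext_free_kronSr | apply: ext_free_kronSl].
all: by clearbody d q r; nia.
Qed.

(** By transposition; the bound on the number of rows excludes the summand
    [cokron 0], which has a row and no column. *)
Theorem rigid_cokron C : rigid C -> (pd C < pa C)%N -> (pa C <= pd C + pd C)%N ->
  exists n x y, piso C (psum (pmul (cokron n.+1) x) (pmul (cokron n.+2) y)).
Proof.
move=> R ad le; have [x [y]] := @rigid_kron (ptr C) (ext_free_tr R) ad.
case En : (_ %/ _)%N => [|n] H.
  have E : (pd C < pa C - pd C)%N.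
    by rewrite ltnNge; apply/negP => /(leq_div2r (pa C - pd C)); rewrite En divnn subn_gt0 ad.
  by exfalso; lia.
by have := piso_tr H; rewrite ptrK ptr_sum !ptr_mul; exists n, x, y.
Qed.

Lemma row_indep_le C : row_indep C -> (pa C <= pd C + pd C)%N.
Proof.
move=> H; have f : row_free (row_mx (pG C) (pD C)).
  apply: row_freeI => c; rewrite mul_mx_row -[0]hsubmxK !linear0 => /eq_row_mx[].
  exact: H.
by rewrite -(eqP f) rank_leq_col.
Qed.

End Pencils.


(** * A criterion for tau-rigidity *)

(** ** Linear algebra *)

Section LinearAlgebra.
Variables (k : fieldType) (V : vectType k).

(** Take a subspace of largest dimension among those contained in [S]. *)
Lemma exists_vspace (S : V -> Prop) : S 0 ->
  (forall c u v, S u -> S v -> S (c *: u + v)) ->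
  exists U : {vspace V}, forall v, v \in U <-> S v.
Proof.
move=> S0 SL; pose good (U : {vspace V}) := forall v, v \in U -> S v.
have [U gU maxU] : exists2 U, good U & forall W, good W -> (\dim W <= \dim U)%N.
  have: exists2 U, good U & (\dim {: V} - \dim U < (\dim {: V}).+1)%N.
    exists 0%VS; last by rewrite ltnS leq_subr.
    by move=> v /[!memv0]/eqP->.
  elim: (\dim {: V}).+1 => [[U //]|d IH [U gU dU]].
  have [|N] := classic (exists2 U, good U & (\dim {: V} - \dim U < d)%N); first exact: IH.
  exists U => // W gW; rewrite leqNgt; apply/negP=> L; apply: N; exists W => //.
  by have := dimvS (subvf W); have := dimvS (subvf U); lia.
exists U => v; split=> [/gU//|Sv].
have gW : good (<[v]> + U)%VS.
  by move=> w /memv_addP[_ /vlineP[c ->] [u Uu ->]]; apply: SL => //; apply: gU.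
have /eqP-> : (U == <[v]> + U)%VS by rewrite eqEdim addvSr maxU.
by apply: (subvP (addvSl _ _)); apply: memv_line.
Qed.

Lemma exists_functional (U : {vspace V}) v : v \notin U ->
  exists2 l : 'Hom(V, k^o), forall u, u \in U -> l u = 0 & l v != 0.
Proof.
move=> nUv; pose q := quo_proj U.
have nz : q v != 0 by rewrite -memv_ker lker_quo_proj.
pose b := vbasis {: subvs_of U^C}.
have [i bi] : exists i, coord b i (q v) != 0.
  apply: NNPP => N; case/eqP: nz; rewrite (coord_vbasis (memvf (q v))).
  rewrite big1 // => i _; have [->|nz] := eqVneq (coord b i (q v)) 0; first by rewrite scale0r.
  by case: N; exists i.
have cL : linear (fun w : subvs_of U^C => coord b i w : k^o).
  by move=> c x y; rewrite linearP.
exists (lin_hom cL \o q)%VF => [u|]; last by rewrite comp_lfunE lin_homE.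
rewrite -[in u \in U](lker_quo_proj U) memv_ker => /eqP E.
by rewrite comp_lfunE E linear0.
Qed.

End LinearAlgebra.

Lemma comp_lfun_suml (k : fieldType) (U V W : vectType k) (I : finType)
    (F : I -> 'Hom(V, W)) (f : 'Hom(U, V)) :
  ((\sum_i F i) \o f = \sum_i (F i \o f))%VF.
Proof.
apply/lfunP=> u; rewrite comp_lfunE !sum_lfunE.
by apply: eq_bigr => i _; rewrite comp_lfunE.
Qed.

(** ** Powers of a module *)

Section Powers.
Variables (k : fieldType) (A : falgType k) (M : lmod A) (n : nat).

Definition pow_act a : 'End({ffun 'I_n -> M}) :=
  linfun (fun f : {ffun 'I_n -> M} => [ffun i => lact M a (f i)]).

Lemma pow_actE a f i : pow_act a f i = lact M a (f i).
Proof.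
rewrite linfun_linE ?ffunE // => c u v; apply/ffunP=> j.
by rewrite !ffunE linearP.
Qed.

Fact pow_act_linear : linear pow_act.
Proof.
move=> c a b; apply/lfunP=> f; apply/ffunP=> i.
by rewrite add_lfunE scale_lfunE !ffunE !pow_actE actD actZ.
Qed.
Fact pow_act1 : pow_act 1 = \1%VF.
Proof. by apply/lfunP=> f; apply/ffunP=> i; rewrite pow_actE id_lfunE act1. Qed.
Fact pow_actM a b : pow_act (a * b) = (pow_act a \o pow_act b)%VF.
Proof. by apply/lfunP=> f; apply/ffunP=> i; rewrite comp_lfunE !pow_actE actM. Qed.

Definition pow_mod : lmod A := LMod pow_act_linear pow_act1 pow_actM.

Lemma pow_modE a (f : pow_mod) i : (lact pow_mod a f : {ffun 'I_n -> M}) i = lact M a (f i).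
Proof. exact: pow_actE. Qed.

Fact pow_pr_linear i : linear (fun f : pow_mod => (f : {ffun 'I_n -> M}) i).
Proof. by move=> c u v; rewrite !ffunE. Qed.
Definition pow_pr i : 'Hom(pow_mod, M) := lin_hom (@pow_pr_linear i).

Lemma pow_prE i (f : pow_mod) : pow_pr i f = (f : {ffun 'I_n -> M}) i.
Proof. exact: lin_homE. Qed.

Fact pow_in_linear i :
  linear (fun m : M => [ffun j => if j == i then m else 0] : pow_mod).
Proof.
move=> c u v; apply/ffunP=> j; rewrite !ffunE; case: eqP => // _.
by rewrite scaler0 addr0.
Qed.
Definition pow_in i : 'Hom(M, pow_mod) := lin_hom (@pow_in_linear i).

Lemma pow_inE i m j : (pow_in i m : {ffun 'I_n -> M}) j = if j == i then m else 0.
Proof. by rewrite lin_homE ffunE. Qed.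

Lemma pow_pr_lhom i : lhom (pow_pr i).
Proof. by apply/lhomP=> a f; rewrite !pow_prE pow_modE. Qed.

Lemma pow_in_lhom i : lhom (pow_in i).
Proof.
apply/lhomP=> a m; apply/ffunP=> j; rewrite pow_modE !pow_inE.
by case: eqP => // _; rewrite linear0.
Qed.

Lemma pow_dsum : is_dsum (fun _ : 'I_n => M) pow_mod.
Proof.
exists pow_in, pow_pr; split=> [i|i|i j ij|].
- by split; [apply: pow_in_lhom | apply: pow_pr_lhom].
- by apply/lfunP=> m; rewrite comp_lfunE pow_prE pow_inE eqxx id_lfunE.
- by apply/lfunP=> m; rewrite comp_lfunE pow_prE pow_inE (negPf ij) zero_lfunE.
- apply/lfunP=> f; rewrite sum_lfunE id_lfunE; apply/ffunP=> j.
  rewrite sum_ffunE (bigD1 j) //= big1 => [|i ij].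
    by rewrite addr0 comp_lfunE pow_inE eqxx pow_prE.
  by rewrite comp_lfunE pow_inE eq_sym (negPf ij).
Qed.

Definition pow_map (N : lmod A) (h : 'I_n -> 'Hom(M, N)) : 'Hom(pow_mod, N) :=
  \sum_i (h i \o pow_pr i)%VF.

Lemma pow_mapE (N : lmod A) (h : 'I_n -> 'Hom(M, N)) (f : pow_mod) :
  pow_map h f = \sum_i h i ((f : {ffun 'I_n -> M}) i).
Proof.
by rewrite sum_lfunE; apply: eq_bigr => i _; rewrite comp_lfunE pow_prE.
Qed.

Lemma pow_map_lhom (N : lmod A) (h : 'I_n -> 'Hom(M, N)) :
  (forall i, lhom (h i)) -> lhom (pow_map h).
Proof. by move=> H; apply: lhom_sum => i; apply: lhom_comp => //; apply: pow_pr_lhom. Qed.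

End Powers.

Section TauCriterion.
Variables (k : fieldType) (A : falgType k).
Implicit Types M N P Q X Y : lmod A.

Fact orbit_linear M (m : M) : linear (fun a : reg A => lact M a m).
Proof. by move=> c a b; rewrite actD actZ. Qed.
Definition orbit_map M (m : M) : 'Hom(reg A, M) := lin_hom (@orbit_linear M m).

Lemma orbit_mapE M (m : M) a : orbit_map m a = lact M a m.
Proof. exact: lin_homE. Qed.

Lemma reg_actE (a : A) (b : reg A) : lact (reg A) a b = a * (b : A).
Proof. by rewrite /= lfunE. Qed.

Lemma orbit_map_lhom M (m : M) : lhom (orbit_map m).
Proof. by apply/lhomP=> a b; rewrite reg_actE !orbit_mapE actM. Qed.

(** A split surjection from a power of [A] onto [P] gives the dual basis: the [h j]
    are the coordinates of the splitting. *)
Lemma dual_basis P : projective P ->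
  exists (n : nat) (h : 'I_n -> 'Hom(P, reg A)) (p : 'I_n -> P),
    (forall j, lhom (h j)) /\ forall x, x = \sum_j lact P (h j x) (p j).
Proof.
move=> PP; pose b := vbasis {: P}; pose n := \dim {: P}.
pose phi := pow_map (fun i : 'I_n => orbit_map b`_i).
have Hphi : lhom phi by apply: pow_map_lhom => i; apply: orbit_map_lhom.
have sphi : surjective phi.
  apply/limgT=> x; exists [ffun i => coord b i x *: (1 : A)].
  rewrite [RHS](coord_vbasis (memvf x)) pow_mapE; apply: eq_bigr => i _.
  by rewrite ffunE orbit_mapE actZ act1.
have [s Hs phis] := PP _ _ _ _ Hphi sphi (lhom1 P).
exists n, (fun j => pow_pr _ j \o s)%VF, (fun i => b`_i); split=> [j|x].
  by apply: lhom_comp => //; apply: pow_pr_lhom.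
rewrite -[LHS]id_lfunE -phis comp_lfunE pow_mapE.
by apply: eq_bigr => i _; rewrite orbit_mapE comp_lfunE pow_prE.
Qed.

(** [orbit_map m \o h] is the homomorphism [p |-> h(p) m]; by the dual basis
    lemma these span [Hom(P, M)]. *)
Lemma dual_basis_hom P n (h : 'I_n -> 'Hom(P, reg A)) (p : 'I_n -> P) M (u : 'Hom(P, M)) :
  (forall x, x = \sum_j lact P (h j x) (p j)) -> lhom u ->
  u = \sum_j (orbit_map (u (p j)) \o h j)%VF.
Proof.
move=> Hp Hu; apply/lfunP=> x; rewrite {1}(Hp x) linear_sum sum_lfunE.
by apply: eq_bigr => j _; rewrite /= comp_lfunE orbit_mapE lhomE.
Qed.

(** Both directions rest on the isomorphism between [Hom(M, D Tr M)] and the dual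
    of the cokernel of [Hom(P0, M) -> Hom(P1, M)]: a functional [l] on
    [Hom(P1, M)] that kills this image corresponds to
    [m |-> (pi h |-> l (p |-> h(p) m))]. *)
Lemma tau_rigid_lift M : tau_rigid M ->
  exists (P1 P0 : lmod A) (f : 'Hom(P1, P0)) (g : 'Hom(P0, M)),
    minimal_presentation f g /\
    forall u : 'Hom(P1, M), lhom u -> exists2 v : 'Hom(P0, M), lhom v & u = (v \o f)%VF.
Proof.
case=> N [X [P1 [P0 [f [g [pi [mp Hpi spi kpi]]]]]] NX] hz.
exists P1, P0, f, g; split=> // u Hu; apply: NNPP => Nu.
have [[PP1 PP0] [Hf Hg] _ _] := mp.
have [||W HW] := @exists_vspace k 'Hom(P1, M) (fun u => exists2 v : 'Hom(P0, M), lhom v & u = (v \o f)%VF).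
- by exists 0; [apply: lhom0 | rewrite comp_lfun0l].
- move=> c _ _ [v Hv ->] [w Hw ->]; exists (c *: v + w).
    apply/lhomP=> a m; rewrite !add_lfunE !scale_lfunE !lhomE //.
    by rewrite linearP.
  by rewrite comp_lfunDl comp_lfunZl.
have /exists_functional[l lW lu] : u \notin W by apply/negP=> /HW.
(* [X] is the transpose of [M], a quotient of [Hom(P1, A)] by [pi]. *)
pose phi m : 'Hom(X, k^o) :=
  linfun (fun x => l (orbit_map m \o vsval ((pi^-1)%VF x))%VF).
have phiE m h : phi m (pi h) = l (orbit_map m \o vsval h)%VF.
  rewrite linfun_linE; last first.
    by move=> c x y; rewrite !linearP /= comp_lfunDr -comp_lfunZr linearP.
  apply/eqP; rewrite -subr_eq0 -linearB -comp_lfunNr -comp_lfunDr.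
  have /kpi[h0 E] : pi (((pi^-1)%VF (pi h)) - h) = 0.
    by rewrite linearB /= limg_lfunVK ?subrr // memv_img ?memvf.
  apply/eqP/lW/HW; exists (orbit_map m \o vsval h0)%VF.
    by apply: lhom_comp; [apply: orbit_map_lhom | apply/hom_regP/subvsP].
  by rewrite -comp_lfunA -E linearB.
have piP x : exists h, pi h = x by move/limgT: spi; apply.
have phiL : linear phi.
  move=> c m m'; apply/lfunP=> x; have [h <-] := piP x.
  rewrite add_lfunE scale_lfunE !phiE -linearP; congr (l _).
  apply/lfunP=> p; rewrite add_lfunE scale_lfunE !comp_lfunE !orbit_mapE.
  by rewrite linearP.
have Hphi : lhom (lin_hom phiL : 'Hom(M, dual X)).
  apply/lhomP=> a m; rewrite !lin_homE [RHS]dual_actE; apply/lfunP=> x.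
  have [h <-] := piP x; rewrite comp_lfunE.
  have -> : ract X a (pi h) = pi (hom_reg_act P1 a h).
    by rewrite -!comp_lfunE; have <- := Hpi a.
  rewrite !phiE hom_reg_actE comp_lfunA; congr (l (_ \o _)%VF).
  by apply/lfunP=> b; rewrite comp_lfunE !orbit_mapE lfunE /= actM.
have phi0 m : phi m = 0.
  have [F [F' [HF HF' F'F FF']]] := NX.
  have := hz (F' \o lin_hom phiL)%VF (lhom_comp HF' Hphi) => E.
  rewrite -[phi m](lin_homE phiL) -[lin_hom phiL m]id_lfunE -FF' comp_lfunE.
  by rewrite -[F' _]comp_lfunE E zero_lfunE linear0.
have [n [h [p [Hh Hp]]]] := dual_basis PP1.
case/eqP: lu; rewrite (dual_basis_hom Hp Hu) linear_sum big1 // => j _.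
have hj : h j \in hom_reg P1 by apply/hom_regP.
by rewrite /= -(vsprojK hj) -phiE phi0 zero_lfunE.
Qed.

(** Here the functional is recovered from a homomorphism [phi : M -> D X] by the dual
    basis [(h1 j, p1 j)] of [P1], as [l u = \sum_j phi (u (p1 j)) (pi (h1 j))]. *)
Lemma lift_tau_rigid M (P1 P0 : lmod A) (f : 'Hom(P1, P0)) (g : 'Hom(P0, M)) :
  minimal_presentation f g ->
  (forall u : 'Hom(P1, M), lhom u -> exists2 v : 'Hom(P0, M), lhom v & u = (v \o f)%VF) ->
  tau_rigid M.
Proof.
move=> mp lift; have [[PP1 PP0] [Hf Hg] _ _] := mp.
have [||R HR] := @exists_vspace k (hom_reg_rmod P1)
    (fun h => exists h0 : subvs_of (hom_reg P0), vsval h = (vsval h0 \o f)%VF).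
- by exists 0; rewrite !linear0 comp_lfun0l.
- move=> c h h' [h0 E] [h0' E']; exists (c *: h0 + h0').
  by rewrite !linearP /= E E' comp_lfunDl comp_lfunZl.
have RR a : (ract (hom_reg_rmod P1) a @: R <= R)%VS.
  apply/subvP=> _ /memv_imgP[h /HR[h0 E] ->]; apply/HR.
  by exists (hom_reg_act P0 a h0); rewrite /= !hom_reg_actE E comp_lfunA.
pose X := rquo_mod RR; pose pi : 'Hom(hom_reg_rmod P1, X) := rquo_pi RR.
have piK h : pi h = 0 <->
    exists h0 : subvs_of (hom_reg P0), vsval h = (vsval h0 \o f)%VF.
  have kpi := rquo_pi_ker RR.
  split=> [E|H]; first by apply/HR; rewrite -kpi memv_ker; apply/eqP.
  by apply/eqP; rewrite -memv_ker kpi; apply/HR.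
exists (dual X).
  exists X; last exact: iso_refl.
  exists P1, P0, f, g, pi; split=> //; first exact: rquo_pi_rhom.
  exact: rquo_pi_surj.
move=> phi Hphi.
have bal m a h : phi (lact M a m) (pi h) = phi m (pi (hom_reg_act P1 a h)).
  rewrite (lhomE _ _ Hphi) dual_actE comp_lfunE; congr (phi m _).
  by rewrite -!comp_lfunE; have <- := rquo_pi_rhom RR a.
have [n1 [h1 [p1 [Hh1 Hp1]]]] := dual_basis PP1.
have [n0 [h0 [p0 [Hh0 Hp0]]]] := dual_basis PP0.
have mem1 j : h1 j \in hom_reg P1 by apply/hom_regP.
pose l (u : 'Hom(P1, M)) := \sum_j phi (u (p1 j)) (pi (vsproj (hom_reg P1) (h1 j))).
have lE m h : l (orbit_map m \o vsval h)%VF = phi m (pi h).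
  rewrite /l (eq_bigr (fun j => phi m (pi (hom_reg_act P1 (vsval h (p1 j)) (vsproj _ (h1 j)))))).
    rewrite -!linear_sum; congr (phi m (pi _)); apply: subvs_inj; rewrite linear_sum /=.
    have Hh : lhom (vsval h) by apply/hom_regP/subvsP.
    apply/lfunP=> x; rewrite sum_lfunE {2}(Hp1 x) linear_sum; apply: eq_bigr => j _.
    rewrite hom_reg_actE comp_lfunE vsprojK // lfunE /= (lhomE _ _ Hh).
    by rewrite reg_actE.
  by move=> j _; rewrite comp_lfunE orbit_mapE bal.
apply/lfunP=> m; rewrite zero_lfunE; apply/lfunP=> x; rewrite zero_lfunE.
have [h <-] : exists h, pi h = x by have /limgT := rquo_pi_surj RR; apply.
have Hu : lhom (orbit_map m \o vsval h)%VF.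
  by apply: lhom_comp; [apply: orbit_map_lhom | apply/hom_regP/subvsP].
have [v Hv E] := lift _ Hu; rewrite -lE E (dual_basis_hom Hp0 Hv).
have hf i : (h0 i \o f)%VF \in hom_reg P1 by apply/hom_regP/lhom_comp.
have lD u u' : l (u + u') = l u + l u'.
  by rewrite /l -big_split; apply: eq_bigr => j _; rewrite add_lfunE !linearD add_lfunE.
have l0 : l 0 = 0.
  by rewrite /l big1 // => j _; rewrite zero_lfunE linear0 zero_lfunE.
rewrite comp_lfun_suml.
elim/big_rec: _ => // i y _ IH; rewrite lD IH addr0 -comp_lfunA.
rewrite -(vsprojK (hf i)) lE; suff -> : pi (vsproj (hom_reg P1) (h0 i \o f)%VF) = 0 by rewrite linear0.
apply/piK; exists (vsproj (hom_reg P0) (h0 i)); rewrite !vsprojK //.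
exact/hom_regP.
Qed.

End TauCriterion.


(** * Modules over the truncated path algebra *)

(** The vertices are indexed by booleans, and [arw v b] is the [b]-th arrow from
    [v] to [~~ v].  The functionals [cf0] and [cf1] read off the coefficients of
    the paths of length 0 and 1; the last field says that the paths of length at
    most 2 span. *)
Record dk_data (k : fieldType) (A : falgType k) := DKData {
  vtx : bool -> A;
  arw : bool -> bool -> A;
  cf0 : bool -> A -> k;
  cf1 : bool -> bool -> A -> k;
  vtxM : forall v w, vtx v * vtx w = if v == w then vtx v else 0;
  vtx_sum : vtx true + vtx false = 1;
  vtx_arw : forall v b, vtx (~~ v) * arw v b = arw v b;
  arw_vtx : forall v b, arw v b * vtx v = arw v b;
  arw3 : forall u v w b c d, arw u b * (arw v c * arw w d) = 0;
  cf0_linear : forall v, linear (cf0 v : A -> k^o);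
  cf1_linear : forall v b, linear (cf1 v b : A -> k^o);
  cf0M : forall v f g, cf0 v (f * g) = cf0 v f * cf0 v g;
  cf1M : forall v b f g,
    cf1 v b (f * g) = cf0 (~~ v) f * cf1 v b g + cf1 v b f * cf0 v g;
  cf0_vtx : forall v w, cf0 v (vtx w) = (v == w)%:R;
  cf0_arw : forall v w b, cf0 v (arw w b) = 0;
  cf1_arw : forall v b w c, cf1 v b (arw w c) = ((v == w) && (b == c))%:R;
  path_span : forall f, exists c2 : bool -> bool -> bool -> k,
    f = \sum_v cf0 v f *: vtx v + \sum_v \sum_b cf1 v b f *: arw v b
        + \sum_v \sum_b \sum_c c2 v b c *: (arw (~~ v) c * arw v b) }.

Section TruncatedModules.
Variables (k : fieldType) (A : falgType k) (H : dk_data A).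
Implicit Types M N P Q X Y : lmod A.
Notation vtx := (vtx H).
Notation arw := (arw H).
Notation cf0 := (cf0 H).
Notation cf1 := (cf1 H).

Fact cf0_lin v : linear (cf0 v : A -> k^o). Proof. exact: cf0_linear. Qed.
HB.instance Definition _ v := GRing.isLinear.Build k A k^o _ (cf0 v) (cf0_lin v).
Fact cf1_lin v b : linear (cf1 v b : A -> k^o). Proof. exact: cf1_linear. Qed.
HB.instance Definition _ v b := GRing.isLinear.Build k A k^o _ (cf1 v b) (cf1_lin v b).

Lemma cf0D v f g : cf0 v (f + g) = cf0 v f + cf0 v g.
Proof. exact: (linearD (cf0 v : {linear A -> k^o})). Qed.
Lemma cf0Z v c f : cf0 v (c *: f) = c * cf0 v f.
Proof.
have := cf0_linear H v c f 0; rewrite addr0 => ->.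
by rewrite [cf0 v 0](linear0 (cf0 v : {linear A -> k^o})) addr0.
Qed.
Lemma cf1D v b f g : cf1 v b (f + g) = cf1 v b f + cf1 v b g.
Proof. exact: (linearD (cf1 v b : {linear A -> k^o})). Qed.
Lemma cf1Z v b c f : cf1 v b (c *: f) = c * cf1 v b f.
Proof.
have := cf1_linear H v b c f 0; rewrite addr0 => ->.
by rewrite [cf1 v b 0](linear0 (cf1 v b : {linear A -> k^o})) addr0.
Qed.
Lemma cf1_sum v b (I : finType) (F : I -> A) : cf1 v b (\sum_i F i) = \sum_i cf1 v b (F i).
Proof. exact: (linear_sum (cf1 v b : {linear A -> k^o})). Qed.

Lemma vtx_idem v : vtx v * vtx v = vtx v.
Proof. by rewrite vtxM eqxx. Qed.

Lemma vtx_orth v : vtx (~~ v) * vtx v = 0.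
Proof. by rewrite vtxM; case: v. Qed.

Lemma act_vtx_sum M v (m : M) : lact M (vtx v) m + lact M (vtx (~~ v)) m = m.
Proof. by rewrite -actD; case: v; rewrite ?[_ false + _]addrC vtx_sum act1. Qed.

Lemma act_vtx_arw M v b (m : M) :
  lact M (vtx (~~ v)) (lact M (arw v b) m) = lact M (arw v b) m.
Proof. by rewrite -actM vtx_arw. Qed.

Lemma act_arw_vtx M v b (m : M) :
  lact M (arw v b) (lact M (vtx v) m) = lact M (arw v b) m.
Proof. by rewrite -actM arw_vtx. Qed.

Lemma act_arw0 M v b (m : M) : lact M (vtx v) m = 0 -> lact M (arw v b) m = 0.
Proof. by rewrite -act_arw_vtx => ->; rewrite linear0. Qed.

Lemma act_span M (m : M) f : exists c2 : bool -> bool -> bool -> k,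
  lact M f m = \sum_v cf0 v f *: lact M (vtx v) m
    + \sum_v \sum_b cf1 v b f *: lact M (arw v b) m
    + \sum_v \sum_b \sum_c c2 v b c *: lact M (arw (~~ v) c) (lact M (arw v b) m).
Proof.
have [c2 E] := path_span H f; exists c2; rewrite {1}E !actD !act_sum.
congr (_ + _ + _).
- by apply: eq_bigr => v _; rewrite actZ.
- by apply: eq_bigr => v _; rewrite act_sum; apply: eq_bigr => b _; rewrite actZ.
- apply: eq_bigr => v _; rewrite act_sum; apply: eq_bigr => b _; rewrite act_sum.
  by apply: eq_bigr => c _; rewrite actZ actM.
Qed.

Lemma submodule_gen M (U : {vspace M}) :
  (forall v m, m \in U -> lact M (vtx v) m \in U) ->
  (forall v b m, m \in U -> lact M (arw v b) m \in U) -> submodule U.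
Proof.
move=> Hv Ha f; apply/subvP=> _ /memv_imgP[m Um ->]; have [c2 ->] := act_span m f.
apply: memvD; first apply: memvD.
- by apply: memv_suml => v _; apply: memvZ; apply: Hv.
- by apply: memv_suml => v _; apply: memv_suml => b _; apply: memvZ; apply: Ha.
- do 3![apply: memv_suml => ? _]; apply: memvZ; exact: Ha (Ha _ _ _ Um).
Qed.

(** ** The radical *)

Definition rad M : {vspace M} :=
  (\sum_(p : bool * bool) limg (lact M (arw p.1 p.2)))%VS.

Lemma mem_rad M v b (m : M) : lact M (arw v b) m \in rad M.
Proof.
by apply: (subvP (sumv_sup (v, b) _ (subvv _))) => //; rewrite memv_img ?memvf.
Qed.

Lemma rad_sub M (U : {vspace M}) :
  (forall v b m, lact M (arw v b) m \in U) -> (rad M <= U)%VS.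
Proof.
move=> HU; apply/subv_sumP=> -[v b] _; apply/subvP=> _ /memv_imgP[m _ ->].
exact: HU.
Qed.

Lemma rad_img M (V : vectType k) (f : 'Hom(M, V)) (W : {vspace V}) m :
  (forall v b m, f (lact M (arw v b) m) \in W) -> m \in rad M -> f m \in W.
Proof.
move=> HW Rm; rewrite memv_preim; apply: (subvP _ m Rm); apply: rad_sub => v b n.
by rewrite -memv_preim.
Qed.

Lemma rad_submodule M : submodule (rad M).
Proof.
apply: submodule_gen => [v|v b] m Um; last exact: mem_rad.
apply: rad_img Um => w b {}m; rewrite -actM.
have [->|/negPf vw] := eqVneq v (~~ w); first by rewrite vtx_arw mem_rad.
have -> : v = w by move: vw; case: v; case: w.
by rewrite -vtx_arw mulrA vtxM; case: w {vw}; rewrite /= mul0r act0 mem0v.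
Qed.

Lemma lhom_rad M N (f : 'Hom(M, N)) m : lhom f -> m \in rad M -> f m \in rad N.
Proof.
by move=> Hf Rm; apply: rad_img Rm => v b {}m; rewrite lhomE // mem_rad.
Qed.

Lemma rad_surj M N (f : 'Hom(M, N)) n : lhom f -> limg f = fullv -> n \in rad N ->
  exists2 m, m \in rad M & f m = n.
Proof.
move=> Hf /limgT sf Rn; have : n \in (f @: rad M)%VS.
  apply: (subvP _ n Rn); apply: rad_sub => v b {Rn}n; have [m <-] := sf n.
  by rewrite -lhomE // memv_img ?mem_rad.
by case/memv_imgP=> m Rm ->; exists m.
Qed.

(** The radical has cube zero, so [U] contains successively the products of two
    arrows, the single arrows, and everything. *)
Lemma nakayama M (U : {vspace M}) : submodule U -> (U + rad M = fullv)%VS -> U = fullv.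
Proof.
move=> HU s; have dec m : exists2 u, u \in U & m - u \in rad M.
  have := memvf m; rewrite -s => /memv_addP[u Uu [r Rr ->]]; exists u => //.
  by rewrite addrC addKr.
have step (W : {vspace M}) : submodule W -> (U <= W)%VS ->
    (forall v b m, lact M (arw v b) m \in W) -> W = fullv.
  move=> HW UW HA; apply/eqP; rewrite eqEsubv subvf; apply/subvP=> m _.
  have [u Uu Rm] := dec m; rewrite -[m](subrK u); apply: memvD; last exact: (subvP UW).
  by apply: (subvP (rad_sub HA)).
have H2 v b w c m : lact M (arw v b) (lact M (arw w c) m) \in U.
  have [u Uu Rm] := dec m; rewrite -[m](subrK u) [lact M (arw w c) _]linearD linearD /=.
  apply: memvD; last by do 2!apply: submodP => //.
  rewrite -!actM; apply: rad_img Rm => x d m'.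
  by rewrite -actM -mulrA arw3 act0 mem0v.
have H1 v b m : lact M (arw v b) m \in U.
  have [u Uu Rm] := dec m; rewrite -[m](subrK u) linearD /=.
  apply: memvD; last exact: submodP.
  exact: rad_img Rm.
exact: step (subvv U) H1.
Qed.

Lemma rad_full M : rad M = fullv -> zero_mod M.
Proof.
move=> R; have Z : submodule (0%VS : {vspace M}).
  by move=> a; rewrite limg0.
by rewrite /zero_mod -(nakayama Z) ?dimv0 // add0v.
Qed.

Lemma superfluous_rad M (K : {vspace M}) : (K <= rad M)%VS -> superfluous K.
Proof.
move=> KR U HU s; apply: nakayama => //; apply/eqP.
by rewrite eqEsubv subvf -s addvC addvS.
Qed.

(** An element [m] is the sum of [m - e m], which [e] kills, and of the radical
    element [e m]; by Nakayama the kernel of [e] is everything. *)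
Lemma idem_rad M (e : 'End(M)) : lhom e -> (forall m, e (e m) = e m) ->
  (forall m, e m \in rad M) -> e = 0.
Proof.
move=> He ee er; have full : lker e = fullv.
  apply: nakayama; first exact: submodule_lker.
  apply/eqP; rewrite eqEsubv subvf; apply/subvP=> m _.
  rewrite -[m](subrK (e m)); apply: memv_add => //.
  by rewrite memv_ker linearB /= ee subrr.
by apply/lfunP=> m; apply/eqP; rewrite zero_lfunE -memv_ker full memvf.
Qed.

(** ** Sums of the projectives [A vtx v] *)

Section FreeModules.
Variables (n : nat) (nu : 'I_n -> bool).

Fact pfree_defect_linear : linear (fun f : pow_mod (reg A) n =>
  [ffun i => f i * vtx (nu i) - f i] : {ffun 'I_n -> A}).
Proof.
move=> c f g; apply/ffunP=> i; rewrite !ffunE mulrDl -scalerAl.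
by rewrite opprD addrACA -scalerBr.
Qed.

Definition pfree_space : {vspace pow_mod (reg A) n} := lker (lin_hom pfree_defect_linear).

Lemma pfree_spaceP (f : pow_mod (reg A) n) :
  f \in pfree_space <-> forall i, f i * vtx (nu i) = f i.
Proof.
rewrite memv_ker lin_homE; split=> [/eqP/ffunP E i|E].
  by have := E i; rewrite !ffunE => /eqP; rewrite subr_eq0 => /eqP.
by apply/eqP/ffunP=> i; rewrite !ffunE E subrr.
Qed.

Fact pfree_submodule : submodule pfree_space.
Proof.
move=> a; apply/subvP=> _ /memv_imgP[f /pfree_spaceP E ->]; apply/pfree_spaceP=> i.
have -> : (lact (pow_mod (reg A) n) a f : {ffun 'I_n -> A}) i = a * f i.
  exact: etrans (pow_modE _ _ _) (reg_actE _ _).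
by rewrite -mulrA E.
Qed.

(** The direct sum of the projectives [A vtx (nu i)]. *)
Definition pfree : lmod A := sub_mod pfree_submodule.

Definition pco i (u : pfree) : A := (vsval u : {ffun 'I_n -> A}) i.

Lemma pco_vtx u i : pco i u * vtx (nu i) = pco i u.
Proof. by move: i; apply/pfree_spaceP; apply: subvsP. Qed.

Lemma pco_act a u i : pco i (lact pfree a u) = a * pco i u.
Proof.
rewrite /pco; have -> : vsval (lact pfree a u) = lact (pow_mod (reg A) n) a (vsval u).
  exact: (sub_actE pfree_submodule).
exact: etrans (pow_modE _ _ _) (reg_actE _ _).
Qed.

Lemma pco_inj u w : (forall i, pco i u = pco i w) -> u = w.
Proof. by move=> E; apply/subvs_inj/ffunP. Qed.

Fact pco_linear i : linear (pco i).
Proof. by move=> c u w; rewrite /pco linearP !ffunE. Qed.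
HB.instance Definition _ i := GRing.isLinear.Build k pfree A _ (pco i) (pco_linear i).

Fact pgen_subproof i : ([ffun j => if j == i then vtx (nu i) else 0] : pow_mod (reg A) n)
  \in pfree_space.
Proof.
apply/pfree_spaceP=> j; rewrite ffunE; case: eqP => [->|_]; last by rewrite mul0r.
exact: vtx_idem.
Qed.
Definition pgen i : pfree := vsproj pfree_space
  ([ffun j => if j == i then vtx (nu i) else 0] : {ffun 'I_n -> A}).

Lemma pco_gen i j : pco j (pgen i) = if j == i then vtx (nu i) else 0.
Proof. by rewrite /pco vsprojK ?ffunE // pgen_subproof. Qed.

Lemma pgen_vtx i : lact pfree (vtx (nu i)) (pgen i) = pgen i.
Proof.
apply: pco_inj => j; rewrite pco_act !pco_gen; case: eqP => _; last by rewrite mulr0.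
exact: vtx_idem.
Qed.

Lemma pgen_span u : u = \sum_i lact pfree (pco i u) (pgen i).
Proof.
apply: pco_inj => j; rewrite linear_sum (bigD1 j) //= big1 => [|i ij].
  by rewrite addr0 pco_act pco_gen eqxx pco_vtx.
by rewrite pco_act pco_gen eq_sym (negPf ij) mulr0.
Qed.

Fact pmap_linear N (y : 'I_n -> N) : linear (fun u : pfree => \sum_i lact N (pco i u) (y i)).
Proof.
move=> c u w; rewrite scaler_sumr -big_split; apply: eq_bigr => i _ /=.
by rewrite linearP /= actD actZ.
Qed.
Definition pmap N (y : 'I_n -> N) : 'Hom(pfree, N) := lin_hom (pmap_linear y).

Lemma pmapE N (y : 'I_n -> N) u : pmap y u = \sum_i lact N (pco i u) (y i).
Proof. exact: lin_homE. Qed.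

Lemma pmap_lhom N (y : 'I_n -> N) : lhom (pmap y).
Proof.
apply/lhomP=> a u; rewrite !pmapE linear_sum; apply: eq_bigr => i _.
by rewrite pco_act actM.
Qed.

Lemma pmap_gen N (y : 'I_n -> N) i : pmap y (pgen i) = lact N (vtx (nu i)) (y i).
Proof.
rewrite pmapE (bigD1 i) //= big1 => [|j ji].
  by rewrite addr0 pco_gen eqxx.
by rewrite pco_gen (negPf ji) act0.
Qed.

Lemma phom_span N (f : 'Hom(pfree, N)) u : lhom f ->
  f u = \sum_i lact N (pco i u) (f (pgen i)).
Proof.
by move=> Hf; rewrite {1}[u]pgen_span linear_sum; apply: eq_bigr => i _; apply: lhomE.
Qed.

Lemma pfree_ext N (f g : 'Hom(pfree, N)) : lhom f -> lhom g ->
  (forall i, f (pgen i) = g (pgen i)) -> f = g.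
Proof.
move=> Hf Hg E; apply/lfunP=> u; rewrite !phom_span //.
by apply: eq_bigr => i _; rewrite E.
Qed.

Lemma pfree_projective : projective pfree.
Proof.
move=> X Y g f Hg /limgT sg Hf.
have [y Ey] : exists y : 'I_n -> X, forall i, g (y i) = f (pgen i).
  by apply: (fin_all_exists (P := fun i y => g y = f (pgen i))) => i; apply: sg.
exists (pmap y); first exact: pmap_lhom.
apply/lfunP=> u; rewrite comp_lfunE pmapE linear_sum phom_span //.
by apply: eq_bigr => i _; rewrite /= lhomE // Ey.
Qed.

(** Every element of the radical is a combination of paths of positive length. *)
Lemma pco_rad u i : u \in rad pfree -> cf0 (nu i) (pco i u) = 0.
Proof.
have FL : linear (fun u => cf0 (nu i) (pco i u) : k^o) by move=> c w w'; rewrite !linearP.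
move=> Ru; pose F : 'Hom(pfree, k^o) := lin_hom FL.
have FE w : F w = cf0 (nu i) (pco i w) by rewrite lin_homE.
suff: F u \in (0%VS : {vspace k^o}) by rewrite memv0 FE => /eqP.
by apply: rad_img Ru => v b w; rewrite FE pco_act cf0M cf0_arw mul0r mem0v.
Qed.

Lemma rad_pco u : (forall i, cf0 (nu i) (pco i u) = 0) -> u \in rad pfree.
Proof.
move=> E; rewrite [u]pgen_span; apply: memv_suml => i _.
have [c2 ->] := act_span (pgen i) (pco i u).
rewrite [X in X + _ + _]big1 ?add0r => [|v _].
  apply: memvD; do 2![apply: memv_suml => ? _].
    by apply: memvZ; apply: mem_rad.
  by apply: memv_suml => ? _; apply: memvZ; apply: mem_rad.
rewrite -(pco_vtx u i) cf0M cf0_vtx; case: eqP => [->|_].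
  by rewrite E mul0r scale0r.
by rewrite mulr0 scale0r.
Qed.

End FreeModules.

End TruncatedModules.


(** ** Every projective module is such a sum *)

Lemma nat_min (S : nat -> Prop) : (exists n, S n) ->
  exists2 n, S n & forall m, S m -> (n <= m)%N.
Proof.
case=> n Sn; have [d] := ubnP n; elim: d n Sn => // d IH n Sn nd.
have [[m Sm mn]|N] := classic (exists2 m, S m & (m < n)%N).
  by apply: (IH m) => //; apply: leq_trans mn _.
by exists n => // m Sm; rewrite leqNgt; apply/negP=> L; apply: N; exists m.
Qed.

Section Projectives.
Variables (k : fieldType) (A : falgType k) (H : dk_data A).
Implicit Types M N P Q X Y : lmod A.
Notation vtx := (vtx H).
Notation arw := (arw H).
Notation cf0 := (cf0 H).
Notation cf1 := (cf1 H).
Notation rad := (rad H).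

Lemma act_top M f v (m : M) : lact M (vtx v) m = m ->
  exists2 r, r \in rad M & lact M f m = cf0 v f *: m + r.
Proof.
move=> vm; have [c2 E] := act_span H m f.
have z w : w != v -> lact M (vtx w) m = 0.
  by move=> wv; rewrite -vm -actM vtxM (negPf wv) act0.
exists (\sum_v0 \sum_b cf1 v0 b f *: lact M (arw v0 b) m +
  \sum_v0 \sum_b \sum_c c2 v0 b c *: lact M (arw (~~ v0) c) (lact M (arw v0 b) m)).
  apply: memvD; do 2![apply: memv_suml => ? _].
    by apply: memvZ; apply: mem_rad.
  by apply: memv_suml => ? _; apply: memvZ; apply: mem_rad.
by rewrite E -addrA (bigD1 v) //= vm big1 ?addr0 // => w /z->; rewrite scaler0.
Qed.

Lemma exists_generators M :
  exists (n : nat) (nu : 'I_n -> bool) (y : 'I_n -> M), surjective (pmap H nu y).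
Proof.
pose b := vbasis {: M}; pose d := \dim {: M}.
(* Each basis vector is taken twice, once for each vertex. *)
pose nu (i : 'I_(d + d)) := if split i is inl _ then true else false.
pose y (i : 'I_(d + d)) : M := match split i with inl j => b`_j | inr j => b`_j end.
exists _, nu, y; apply/limgT=> x.
exists (\sum_(j < d) coord b j x *: (pgen H nu (lshift d j) + pgen H nu (rshift d j))).
rewrite [RHS](coord_vbasis (memvf x)) linear_sum; apply: eq_bigr => j _.
rewrite linearZ linearD /= !pmap_gen /nu /y.
by rewrite !(unsplitK (inl j : 'I_d + 'I_d)) !(unsplitK (inr j : 'I_d + 'I_d)) (act_vtx_sum H true).
Qed.

(** The relation [u] has an invertible coefficient at the [j]-th generator, which is
    therefore a combination of the other ones modulo the radical. *)
Lemma drop_generator M n (nu : 'I_n.+1 -> bool) (y : 'I_n.+1 -> M) (u : pfree H nu) j :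
  surjective (pmap H nu y) -> pmap H nu y u = 0 -> cf0 (nu j) (pco j u) != 0 ->
  surjective (pmap H (nu \o lift j) (y \o lift j)).
Proof.
move=> /limgT sy yu cj; pose m i := lact M (vtx (nu i)) (y i).
pose U := limg (pmap H (nu \o lift j) (y \o lift j)); have HU : submodule U by apply/submodule_limg/pmap_lhom.
have ym (w : pfree H nu) : pmap H nu y w = \sum_i lact M (pco i w) (m i).
  by rewrite pmapE; apply: eq_bigr => i _; rewrite -actM pco_vtx.
have HUR : submodule (U + rad M)%VS.
  by move=> a; rewrite limgD addvS ?HU // (rad_submodule H).
have mU i : i != j -> m i \in U.
  rewrite eq_sym => /unlift_some[l El _].
  have -> : m i = pmap H (nu \o lift j) (y \o lift j) (pgen H (nu \o lift j) l).
    by rewrite pmap_gen /= -El.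
  by rewrite memv_img ?memvf.
have mj : m j \in (U + rad M)%VS.
  have top i : exists2 r, r \in rad M & lact M (pco i u) (m i) = cf0 (nu i) (pco i u) *: m i + r.
    by apply: act_top; rewrite /m -actM vtx_idem.
  have Rm i : lact M (pco i u) (m i) - cf0 (nu i) (pco i u) *: m i \in rad M.
    by have [r Rr ->] := top i; rewrite addrC addKr.
  move: yu; rewrite ym (bigD1 j) //= => /eqP; rewrite addr_eq0 => /eqP E.
  rewrite -[m j](scalerK cj); apply: memvZ.
  rewrite -[X in X \in _](subKr (lact M (pco j u) (m j))); apply: memvB; last first.
    by apply: (subvP (addvSr U (rad M))).
  rewrite E memvN; apply: memv_suml => i ij; rewrite -[lact _ _ _](subrK (cf0 (nu i) (pco i u) *: m i)).
  rewrite addrC; apply: memv_add => //; apply: memvZ; exact: mU.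
apply: (nakayama (H := H)) => //; apply/eqP; rewrite eqEsubv subvf; apply/subvP=> x _.
have [w <-] := sy x; rewrite ym; apply: memv_suml => i _; apply: submodP => //.
by have [->//|/mU] := eqVneq i j; apply: (subvP (addvSl _ _)).
Qed.

(** A minimal family of generators gives a cover with kernel in the radical;
    when it splits, the kernel is a direct summand inside the radical, hence 0. *)
Lemma projective_pfree P : projective P ->
  exists (n : nat) (nu : 'I_n -> bool), iso (pfree H nu) P.
Proof.
move=> PP; have [n [nu [y sy]] nmin] := nat_min (exists_generators P).
exists n, nu; have Hy : lhom (pmap H nu y) by apply: pmap_lhom.
have kr u : pmap H nu y u = 0 -> u \in rad (pfree H nu).
  move=> yu; apply: rad_pco => j; apply/eqP; apply: contraT => cj.
  case: n => [|n] in nu y sy nmin Hy u yu j cj *; first by case: j cj.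
  have := nmin n; rewrite ltnn; apply.
  by exists (nu \o lift j), (y \o lift j); apply: drop_generator cj.
have [s Hs ys] := PP _ _ _ _ Hy sy (lhom1 P).
have ysE x : pmap H nu y (s x) = x by rewrite -comp_lfunE ys id_lfunE.
pose e : 'End(pfree H nu) := (\1 - (s \o pmap H nu y))%VF.
have eE u : e u = u - s (pmap H nu y u) by rewrite add_lfunE opp_lfunE id_lfunE comp_lfunE.
have He : lhom e.
  by apply: lhomD; [apply: lhom1 | apply: lhomN; apply: lhom_comp].
have ye u : pmap H nu y (e u) = 0 by rewrite eE linearB /= ysE subrr.
have e0 : e = 0.
  apply: (idem_rad (H := H)) => // [u|u]; last exact: kr.
  by rewrite eE ye linear0 subr0.
apply/isoP; exists (pmap H nu y); split=> //.
rewrite -subv0; apply/subvP=> u; rewrite memv_ker memv0 => /eqP yu.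
by have := eE u; rewrite e0 zero_lfunE yu linear0 subr0 => <-.
Qed.

(** The indecomposable projective [A vtx v]. *)
Definition proj v : lmod A := pfree H (fun _ : 'I_1 => v).

Lemma proj_projective v : projective (proj v).
Proof. exact: pfree_projective. Qed.

Lemma pfree_dsum n (nu : 'I_n -> bool) : is_dsum (fun i => proj (nu i)) (pfree H nu).
Proof.
pose inj i : 'Hom(proj (nu i), pfree H nu) := pmap H _ (fun _ => pgen H nu i).
pose prj i : 'Hom(pfree H nu, proj (nu i)) :=
  pmap H _ (fun j => if j == i then pgen H (fun _ : 'I_1 => nu i) ord0 else 0).
have injE i : inj i (pgen H (fun _ => nu i) ord0) = pgen H nu i.
  by rewrite pmap_gen pgen_vtx.
have prjE i j : prj i (pgen H nu j) = if j == i then pgen H (fun _ : 'I_1 => nu i) ord0 else 0.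
  rewrite pmap_gen; case: eqP => [->|_]; last by rewrite linear0.
  exact: (pgen_vtx H (fun _ : 'I_1 => nu i)).
have Hinj i : lhom (inj i) by apply: pmap_lhom.
have Hprj i : lhom (prj i) by apply: pmap_lhom.
exists inj, prj; split=> [i|i|i j ij|]; first by split.
- apply: pfree_ext => [||l]; [exact: lhom_comp (Hprj i) (Hinj i) | exact: lhom1 |].
  by rewrite ord1 comp_lfunE injE prjE eqxx id_lfunE.
- apply: pfree_ext => [||l]; [exact: lhom_comp (Hprj i) (Hinj j) | exact: lhom0 |].
  by rewrite ord1 comp_lfunE injE prjE eq_sym (negPf ij) zero_lfunE.
- apply: pfree_ext => [||l]; [|exact: lhom1|].
    by apply: lhom_sum => i; apply: lhom_comp (Hinj i) (Hprj i).
  rewrite sum_lfunE (bigD1 l) //= big1 => [|i il].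
    by rewrite addr0 comp_lfunE prjE eqxx injE id_lfunE.
  by rewrite comp_lfunE prjE eq_sym (negPf il) linear0.
Qed.

Lemma reg_dsum2 : is_dsum2 (proj true) (proj false) (reg A).
Proof.
pose inj v : 'Hom(proj v, reg A) := pmap H _ (fun _ => vtx v : reg A).
pose prj v : 'Hom(reg A, proj v) := orbit_map (pgen H (fun _ : 'I_1 => v) ord0).
have Hinj v : lhom (inj v) by apply: pmap_lhom.
have Hprj v : lhom (prj v) by apply: orbit_map_lhom.
have injE v : inj v (pgen H (fun _ => v) ord0) = vtx v.
  by rewrite pmap_gen reg_actE vtx_idem.
have comp v w : (prj v \o inj w)%VF (pgen H (fun _ => w) ord0) =
    lact (proj v) (vtx w) (pgen H (fun _ => v) ord0).
  by rewrite comp_lfunE injE orbit_mapE.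
have cross v : (prj v \o inj (~~ v) = 0)%VF.
  apply: pfree_ext => [||l]; [exact: lhom_comp (Hprj v) (Hinj _) | exact: lhom0 |].
  rewrite ord1 comp zero_lfunE -(pgen_vtx H (fun _ : 'I_1 => v) ord0).
  by rewrite -actM vtx_orth act0.
have same v : (prj v \o inj v = \1)%VF.
  apply: pfree_ext => [||l]; [exact: lhom_comp (Hprj v) (Hinj v) | exact: lhom1 |].
  by rewrite ord1 comp id_lfunE pgen_vtx.
apply/dsum2P; exists (inj true), (prj true), (inj false), (prj false).
split; [split; [exact: Hinj | exact: Hprj | exact: Hinj | exact: Hprj] | | |].
- by split; [exact: (same true) | exact: (same false)].
- by split; [exact: (cross true) | exact: (cross false)].
- apply/lfunP=> a; rewrite id_lfunE add_lfunE !comp_lfunE !orbit_mapE.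
  rewrite (lhomE _ _ (Hinj true)) (lhomE _ _ (Hinj false)) !injE.
  by rewrite !reg_actE -mulrDr vtx_sum mulr1.
Qed.

End Projectives.


(** * The module presented by a pencil *)

Section MatrixCombinations.
Variable k : fieldType.

Definition mxc (V : lmodType k) m n (T : 'M[k]_(m, n)) (y : 'I_n -> V) (i : 'I_m) : V :=
  \sum_j T i j *: y j.

Lemma mxcM (V : lmodType k) m n p (S : 'M[k]_(m, n)) (T : 'M[k]_(n, p)) (y : 'I_p -> V) i :
  mxc (S *m T) y i = mxc S (mxc T y) i.
Proof.
rewrite /mxc (eq_bigr (fun j => \sum_l (S i l * T l j) *: y j)) => [|j _].
  rewrite exchange_big; apply: eq_bigr => l _; rewrite scaler_sumr.
  by apply: eq_bigr => j _; rewrite scalerA.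
by rewrite mxE scaler_suml.
Qed.

Lemma mxcD (V : lmodType k) m n (S T : 'M[k]_(m, n)) (y : 'I_n -> V) i :
  mxc (S + T) y i = mxc S y i + mxc T y i.
Proof. by rewrite /mxc -big_split; apply: eq_bigr => j _; rewrite mxE scalerDl. Qed.

Lemma mxcN (V : lmodType k) m n (T : 'M[k]_(m, n)) (y : 'I_n -> V) i :
  mxc (- T) y i = - mxc T y i.
Proof. by rewrite /mxc -sumrN; apply: eq_bigr => j _; rewrite mxE scaleNr. Qed.

Lemma mxc1 (V : lmodType k) n (y : 'I_n -> V) i : mxc 1%:M y i = y i.
Proof.
rewrite /mxc (bigD1 i) //= big1 ?addr0 => [|j ji]; first by rewrite mxE eqxx scale1r.
by rewrite mxE eq_sym (negPf ji) scale0r.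
Qed.

Lemma mxc_scalar (V : lmodType k) n c (y : 'I_n -> V) i : mxc c%:M y i = c *: y i.
Proof.
rewrite /mxc (bigD1 i) //= big1 ?addr0 => [|j ji]; first by rewrite mxE eqxx.
by rewrite mxE eq_sym (negPf ji) scale0r.
Qed.

Lemma mxc0 (V : lmodType k) m n (y : 'I_n -> V) (i : 'I_m) : mxc 0 y i = 0.
Proof. by rewrite /mxc big1 // => j _; rewrite mxE scale0r. Qed.

Lemma eq_mxc (V : lmodType k) m n (T : 'M[k]_(m, n)) (y z : 'I_n -> V) i :
  y =1 z -> mxc T y i = mxc T z i.
Proof. by move=> E; apply: eq_bigr => j _; rewrite E. Qed.

Lemma mxcDr (V : lmodType k) m n (T : 'M[k]_(m, n)) (y z : 'I_n -> V) i :
  mxc T (fun j => y j + z j) i = mxc T y i + mxc T z i.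
Proof. by rewrite /mxc -big_split; apply: eq_bigr => j _; rewrite scalerDr. Qed.

Lemma mxc_lfun (V W : vectType k) m n (T : 'M[k]_(m, n)) (y : 'I_n -> V)
    (f : 'Hom(V, W)) i : f (mxc T y i) = mxc T (fun j => f (y j)) i.
Proof. by rewrite linear_sum; apply: eq_bigr => j _; rewrite linearZ. Qed.

Lemma mxc_mem (V : vectType k) m n (T : 'M[k]_(m, n)) (y : 'I_n -> V) (U : {vspace V}) i :
  (forall j, y j \in U) -> mxc T y i \in U.
Proof. by move=> HU; apply: memv_suml => j _; apply: memvZ. Qed.

Lemma mxc_row (V : lmodType k) m n (T : 'M[k]_(m, n)) (y : 'I_n -> V) i :
  mxc (row i T) y 0 = mxc T y i.
Proof. by apply: eq_bigr => j _; rewrite mxE. Qed.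

Lemma mxc_delta (V : lmodType k) n (y : 'I_n -> V) j :
  mxc (delta_mx 0 j : 'rV_n) y 0 = y j.
Proof.
rewrite /mxc (bigD1 j) //= big1 ?addr0 => [|l lj]; first by rewrite mxE !eqxx scale1r.
by rewrite mxE (negPf lj) scale0r.
Qed.

End MatrixCombinations.

Section Presented.
Variables (k : fieldType) (A : falgType k) (H : dk_data A) (v : bool).
Implicit Types M N P Q X Y : lmod A.
Implicit Types C : pencil k.
Notation vtx := (vtx H).
Notation arw := (arw H).
Notation cf0 := (cf0 H).
Notation cf1 := (cf1 H).
Notation rad := (rad H).

(** When [(X, Y)] is the pencil, [xsum X Y y i = 0] is the [i]-th relation between
    the generators [y] of the module that it presents. *)
Definition xsum M m n (X Y : 'M[k]_(m, n)) (y : 'I_n -> M) (i : 'I_m) : M :=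
  mxc X (fun j => lact M (arw v false) (y j)) i
  + mxc Y (fun j => lact M (arw v true) (y j)) i.

Lemma xsumE M m n (X Y : 'M[k]_(m, n)) (y : 'I_n -> M) i : xsum X Y y i =
  \sum_j (X i j *: lact M (arw v false) (y j) + Y i j *: lact M (arw v true) (y j)).
Proof. by rewrite big_split. Qed.

Lemma xsumM M m n p (S : 'M[k]_(m, n)) (X Y : 'M[k]_(n, p)) (y : 'I_p -> M) i :
  xsum (S *m X) (S *m Y) y i = mxc S (xsum X Y y) i.
Proof. by rewrite /xsum !mxcM -mxcDr. Qed.

Lemma xsum_mxc M m n p (X Y : 'M[k]_(m, n)) (T : 'M[k]_(n, p)) (y : 'I_p -> M) i :
  xsum X Y (mxc T y) i = xsum (X *m T) (Y *m T) y i.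
Proof.
rewrite /xsum !mxcM; congr (_ + _); apply: eq_mxc => j; exact: mxc_lfun.
Qed.

Lemma xsumD M m n (X Y X' Y' : 'M[k]_(m, n)) (y : 'I_n -> M) i :
  xsum (X + X') (Y + Y') y i = xsum X Y y i + xsum X' Y' y i.
Proof. by rewrite /xsum !mxcD addrACA. Qed.

Lemma xsumN M m n (X Y : 'M[k]_(m, n)) (y : 'I_n -> M) i :
  xsum (- X) (- Y) y i = - xsum X Y y i.
Proof. by rewrite /xsum !mxcN opprD. Qed.

Lemma xsum0 M m n (y : 'I_n -> M) (i : 'I_m) : xsum 0 0 y i = 0.
Proof. by rewrite /xsum !mxc0 addr0. Qed.

Lemma xsum_lhom M N m n (X Y : 'M[k]_(m, n)) (y : 'I_n -> M) (f : 'Hom(M, N)) i :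
  lhom f -> f (xsum X Y y i) = xsum X Y (fun j => f (y j)) i.
Proof.
move=> Hf; rewrite /xsum linearD /= !mxc_lfun.
by congr (_ + _); apply: eq_mxc => j; rewrite lhomE.
Qed.

Lemma eq_xsum M m n (X Y : 'M[k]_(m, n)) (y z : 'I_n -> M) i :
  (forall b j, lact M (arw v b) (y j) = lact M (arw v b) (z j)) -> xsum X Y y i = xsum X Y z i.
Proof. by move=> E; congr (_ + _); apply: eq_mxc => j; rewrite E. Qed.

Lemma xsum_vtx M m n (X Y : 'M[k]_(m, n)) (y : 'I_n -> M) i :
  lact M (vtx (~~ v)) (xsum X Y y i) = xsum X Y y i.
Proof.
by rewrite /xsum linearD /= !mxc_lfun; congr (_ + _); apply: eq_mxc => j; rewrite act_vtx_arw.
Qed.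

Lemma xsum_rad M m n (X Y : 'M[k]_(m, n)) (y : 'I_n -> M) i : xsum X Y y i \in rad M.
Proof. by apply: memvD; apply: mxc_mem => j; apply: mem_rad. Qed.

Lemma act_span_at M (m : M) f : lact M (vtx v) m = m ->
  exists c2 : bool -> bool -> k, lact M f m = cf0 v f *: m
    + \sum_b cf1 v b f *: lact M (arw v b) m
    + \sum_b \sum_c c2 b c *: lact M (arw (~~ v) c) (lact M (arw v b) m).
Proof.
move=> vm; have [c2 E] := act_span H m f; exists (c2 v); rewrite E.
have z w : w != v -> lact M (vtx w) m = 0.
  by move=> wv; rewrite -vm -actM vtxM (negPf wv) act0.
congr (_ + _ + _).
- by rewrite (bigD1 v) //= vm big1 ?addr0 // => w /z->; rewrite scaler0.
- rewrite (bigD1 v) //= [X in _ + X]big1 ?addr0 // => w /z mw.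
  by rewrite big1 // => b _; rewrite (act_arw0 _ mw) scaler0.
- rewrite (bigD1 v) //= [X in _ + X]big1 ?addr0 // => w /z mw.
  by rewrite big1 // => b _; rewrite big1 // => c _; rewrite (act_arw0 _ mw) linear0 scaler0.
Qed.

(** A path from [v] to the other vertex has odd length, hence is an arrow. *)
Lemma act_other M (m : M) f : lact M (vtx v) m = m ->
  lact M (vtx (~~ v)) (lact M f m) = \sum_b cf1 v b f *: lact M (arw v b) m.
Proof.
move=> vm; have [c2 ->] := act_span_at f vm; rewrite !linearD linearZ /=.
have -> : lact M (vtx (~~ v)) m = 0 by rewrite -vm -actM vtx_orth act0.
rewrite scaler0 add0r !linear_sum [X in _ + X]big1 ?addr0 => [|b _].
  by apply: eq_bigr => b _; rewrite linearZ /= act_vtx_arw.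
rewrite linear_sum big1 // => c _; rewrite linearZ /= -act_vtx_arw -actM.
by rewrite vtxM; case: (v); rewrite /= act0 scaler0.
Qed.

(** A path from [v] to itself is trivial or has length 2, and a path of length 2 is
    in the radical and killed by all arrows. *)
Lemma act_same M (m : M) f : lact M (vtx v) m = m -> exists2 r,
  r \in rad M /\ (forall b, lact M (arw v b) r = 0)
  & lact M (vtx v) (lact M f m) = cf0 v f *: m + r.
Proof.
move=> vm; have [c2 ->] := act_span_at f vm; rewrite !linearD linearZ /= vm.
exists (lact M (vtx v) (\sum_b \sum_c c2 b c *: lact M (arw (~~ v) c) (lact M (arw v b) m))).
  split; first (apply: submodP; first exact: rad_submodule).
    by do 2![apply: memv_suml => ? _]; apply: memvZ; apply: mem_rad.
  move=> d; rewrite act_arw_vtx linear_sum big1 // => b _; rewrite linear_sum big1 // => c _.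
  by rewrite linearZ /= -!actM -mulrA arw3 act0 scaler0.
congr (_ + _); rewrite -[RHS]addr0; congr (_ + _); rewrite linear_sum big1 // => b _.
rewrite linearZ /= -act_vtx_arw -actM vtxM; case: (v); by rewrite act0 scaler0.
Qed.

Section Module.
Variable C : pencil k.
Notation F1 := (pfree H (fun _ : 'I_(pa C) => ~~ v)).
Notation F0 := (pfree H (fun _ : 'I_(pd C) => v)).
Notation eps := (pgen H (fun _ : 'I_(pd C) => v)).

Definition prel : 'Hom(F1, F0) := pmap H _ (xsum (pG C) (pD C) eps).

Lemma prel_lhom : lhom prel. Proof. exact: pmap_lhom. Qed.

Lemma prel_gen i : prel (pgen H _ i) = xsum (pG C) (pD C) eps i.
Proof. by rewrite pmap_gen xsum_vtx. Qed.

(** The cokernel of the map of projectives whose matrix has entries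
    [G_ij arw v false + D_ij arw v true]. *)
Definition pres : lmod A := quo_mod (submodule_limg prel_lhom).
Definition pres_pi : 'Hom(F0, pres) := quo_pi (submodule_limg prel_lhom).
Definition mgen j : pres := pres_pi (eps j).

Lemma pres_pi_lhom : lhom pres_pi. Proof. exact: quo_pi_lhom. Qed.
Lemma pres_pi_surj : limg pres_pi = fullv. Proof. exact: quo_pi_surj. Qed.
Lemma pres_pi_ker : lker pres_pi = limg prel. Proof. exact: quo_pi_ker. Qed.

Lemma mgen_vtx j : lact pres (vtx v) (mgen j) = mgen j.
Proof. by rewrite /mgen -(lhomE _ _ pres_pi_lhom) pgen_vtx. Qed.

Lemma pi_xsum m (X Y : 'M_(m, pd C)) i : pres_pi (xsum X Y eps i) = xsum X Y mgen i.
Proof. exact: xsum_lhom pres_pi_lhom. Qed.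

Lemma mgen_rel i : xsum (pG C) (pD C) mgen i = 0.
Proof.
by rewrite -pi_xsum -prel_gen; apply/eqP; rewrite -memv_ker pres_pi_ker memv_img ?memvf.
Qed.

Lemma pres_map N (y : 'I_(pd C) -> N) : (forall j, lact N (vtx v) (y j) = y j) ->
  (forall i, xsum (pG C) (pD C) y i = 0) ->
  exists2 f : 'Hom(pres, N), lhom f & forall j, f (mgen j) = y j.
Proof.
move=> yv y0; pose g := pmap H (fun _ : 'I_(pd C) => v) y.
have Hg : lhom g by apply: pmap_lhom.
have ge j : g (eps j) = y j by rewrite pmap_gen yv.
have [|f Hf fE] := surj_factor pres_pi_lhom pres_pi_surj Hg.
  rewrite pres_pi_ker; apply/subvP=> _ /memv_imgP[u _ ->]; rewrite memv_ker.
  rewrite (phom_span u prel_lhom) linear_sum big1 // => i _.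
  apply: etrans (lhomE _ _ Hg) _; rewrite prel_gen (xsum_lhom _ _ _ _ Hg).
  by rewrite (eq_xsum _ _ _ (z := y)) ?y0 ?linear0 // => b j; rewrite ge.
by exists f => // j; rewrite fE ge.
Qed.

Lemma pres_ext N (f g : 'Hom(pres, N)) : lhom f -> lhom g ->
  (forall j, f (mgen j) = g (mgen j)) -> f = g.
Proof.
move=> Hf Hg E; apply/lfunP=> m; have /limgT/(_ m)[u <-] := pres_pi_surj.
rewrite -!comp_lfunE; congr (fun_of_lfun _ u); apply: pfree_ext => [||j].
- exact: lhom_comp Hf pres_pi_lhom.
- exact: lhom_comp Hg pres_pi_lhom.
- by rewrite !comp_lfunE E.
Qed.

Lemma pco_xsum m (X Y : 'M_(m, pd C)) i j :
  pco j (xsum X Y eps i) = X i j *: arw v false + Y i j *: arw v true.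
Proof.
rewrite /xsum linearD /= !linear_sum; congr (_ + _).
  rewrite (bigD1 j) //= big1 => [|l lj].
    by rewrite addr0 linearZ /= pco_act pco_gen eqxx arw_vtx.
  by rewrite linearZ /= pco_act pco_gen eq_sym (negPf lj) mulr0 scaler0.
rewrite (bigD1 j) //= big1 => [|l lj].
  by rewrite addr0 linearZ /= pco_act pco_gen eqxx arw_vtx.
by rewrite linearZ /= pco_act pco_gen eq_sym (negPf lj) mulr0 scaler0.
Qed.

Lemma cf1_xsum m (X Y : 'M_(m, pd C)) i j b :
  cf1 v b (pco j (xsum X Y eps i)) = if b then Y i j else X i j.
Proof.
rewrite pco_xsum cf1D !cf1Z !cf1_arw eqxx /=.
by case: b; rewrite /= ?mulr1 ?mulr0 ?addr0 ?add0r.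
Qed.

Lemma cf1_prel u j b : cf1 v b (pco j (prel u)) =
  if b then ((\row_i cf0 (~~ v) (pco i u)) *m pD C) 0 j
  else ((\row_i cf0 (~~ v) (pco i u)) *m pG C) 0 j.
Proof.
rewrite (phom_span u prel_lhom) linear_sum cf1_sum /=.
transitivity (\sum_i cf0 (~~ v) (pco i u) * (if b then pD C i j else pG C i j)).
  apply: eq_bigr => i _; rewrite prel_gen pco_act cf1M cf1_xsum.
  by rewrite pco_xsum cf0D !cf0Z !cf0_arw !mulr0 addr0 mulr0 addr0.
by case: b; rewrite mxE; apply: eq_bigr => i _; rewrite mxE.
Qed.

Lemma limg_prel_rad : (limg prel <= rad F0)%VS.
Proof.
apply/subvP=> _ /memv_imgP[u _ ->]; rewrite (phom_span u prel_lhom).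
apply: memv_suml => i _; apply: submodP; first exact: rad_submodule.
by rewrite prel_gen xsum_rad.
Qed.

(** The relation lifts to the image of [prel], where the coefficients at the arrows
    are those of the rows of the pencil, combined by the coefficients at the trivial
    paths. *)
Lemma xsum_eq0 m (X Y : 'M_(m, pd C)) : (forall i, xsum X Y mgen i = 0) ->
  exists S : 'M_(m, pa C), X = S *m pG C /\ Y = S *m pD C.
Proof.
move=> E.
have [u Eu] : exists u : 'I_m -> F1, forall i, xsum X Y eps i = prel (u i).
  apply: (fin_all_exists (P := fun i (u : F1) => xsum X Y eps i = prel u)) => i.
  have : xsum X Y eps i \in lker pres_pi by rewrite memv_ker pi_xsum E.
  by rewrite pres_pi_ker => /memv_imgP[u _ ->]; exists u.
pose S := \matrix_(i, l) cf0 (~~ v) (pco l (u i)); exists S.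
have rowS i : row i S = \row_l cf0 (~~ v) (pco l (u i)) by apply/rowP=> l; rewrite !mxE.
split; apply/matrixP=> i j.
  have := cf1_xsum X Y i j false; rewrite Eu cf1_prel /= => <-.
  by rewrite -rowS -row_mul mxE.
have := cf1_xsum X Y i j true; rewrite Eu cf1_prel /= => <-.
by rewrite -rowS -row_mul mxE.
Qed.

(** The relations lie in the radical, so the generators remain independent modulo it. *)
Lemma mgen_free m (T : 'M_(m, pd C)) : (forall i, mxc T mgen i \in rad pres) -> T = 0.
Proof.
move=> R; apply/matrixP=> i j; rewrite mxE.
have [u Ru Eu] := rad_surj pres_pi_lhom pres_pi_surj (R i).
have : mxc T eps i - u \in lker pres_pi.
  by rewrite memv_ker linearB /= Eu mxc_lfun subrr.
rewrite pres_pi_ker => /(subvP limg_prel_rad)/memvD/(_ Ru); rewrite subrK => RT.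
have := pco_rad j RT; rewrite /mxc linear_sum (bigD1 j) //= big1 => [|l lj].
  by rewrite addr0 linearZ /= pco_gen eqxx cf0Z cf0_vtx eqxx mulr1.
by rewrite linearZ /= pco_gen eq_sym (negPf lj) scaler0.
Qed.

Lemma pres_span (m : pres) : exists c : 'I_(pd C) -> A,
  m = \sum_j lact pres (c j) (mgen j).
Proof.
have /limgT/(_ m)[u <-] := pres_pi_surj; exists (fun j => pco j u).
by rewrite (phom_span u pres_pi_lhom).
Qed.

Lemma pres_vtx_other (m : pres) : exists X Y : 'rV_(pd C),
  lact pres (vtx (~~ v)) m = xsum X Y mgen 0.
Proof.
have [c ->] := pres_span m.
exists (\row_j cf1 v false (c j)), (\row_j cf1 v true (c j)).
rewrite linear_sum /xsum /mxc -big_split; apply: eq_bigr => j _.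
by apply: etrans (act_other _ (mgen_vtx j)) _; rewrite big_bool !mxE; apply: addrC.
Qed.

Lemma pres_vtx_same (m : pres) : exists (t : 'rV_(pd C)) (r : pres),
  [/\ r \in rad pres, forall b, lact pres (arw v b) r = 0
    & lact pres (vtx v) m = mxc t mgen 0 + r].
Proof.
have [c ->] := pres_span m.
have [r Hr] : exists r : 'I_(pd C) -> pres, forall j,
    (r j \in rad pres /\ forall b, lact pres (arw v b) (r j) = 0) /\
    lact pres (vtx v) (lact pres (c j) (mgen j)) = cf0 v (c j) *: mgen j + r j.
  apply: (fin_all_exists (P := fun j r => (r \in rad pres /\ forall b, lact pres (arw v b) r = 0) /\
    lact pres (vtx v) (lact pres (c j) (mgen j)) = cf0 v (c j) *: mgen j + r)) => j.
  by have [r ? ?] := act_same (c j) (mgen_vtx j); exists r.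
exists (\row_j cf0 v (c j)), (\sum_j r j); split.
- by apply: memv_suml => j _; have [[]] := Hr j.
- by move=> b; rewrite linear_sum big1 // => j _; have [[_ /(_ b)]] := Hr j.
- rewrite linear_sum /mxc -big_split; apply: eq_bigr => j _.
  by apply: etrans (proj2 (Hr j)) _; rewrite mxE.
Qed.

End Module.
End Presented.


(** * Generation and left mutations *)

Section Generation.
Variables (k : fieldType) (A : falgType k).
Implicit Types M N P Q X Y C D : lmod A.

(** [Y] is the sum of the images of the homomorphisms [C -> Y]; this is the
    form in which membership in [Fac C] is propagated below. *)
Definition gen C Y : Prop := forall U : {vspace Y},
  (forall f : 'Hom(C, Y), lhom f -> (limg f <= U)%VS) -> U = fullv.

Lemma gen_surj C X Y (p : 'Hom(X, Y)) : gen C X -> lhom p -> limg p = fullv -> gen C Y.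
Proof.
move=> GX Hp sp U HU; apply/eqP; rewrite eqEsubv subvf -sp -(GX (p @^-1: U)%VS).
  by apply/subvP=> _ /memv_imgP[x + ->]; rewrite -memv_preim.
move=> f Hf; apply/subvP=> _ /memv_imgP[c _ ->]; rewrite -memv_preim -comp_lfunE.
by apply: (subvP (HU _ (lhom_comp Hp Hf))); rewrite memv_img ?memvf.
Qed.

Lemma gen_retract C X Y : gen C X -> retract Y X -> gen C Y.
Proof.
move=> GX [i [p [_ Hp pi]]]; apply: (gen_surj GX Hp); apply/limgT=> y.
by exists (i y); rewrite -comp_lfunE pi id_lfunE.
Qed.

Lemma gen_dsum2 C N N' X : is_dsum2 N N' X -> gen C N -> gen C N' -> gen C X.
Proof.
move=> /dsum2P[i1 [p1 [i2 [p2 [[H1 H1' H2 H2'] _ _ s]]]]] GN GN' U HU.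
have sub M (i : 'Hom(M, X)) : lhom i -> gen C M -> (limg i <= U)%VS.
  move=> Hi GM; rewrite -(GM (i @^-1: U)%VS).
    by apply/subvP=> _ /memv_imgP[x + ->]; rewrite -memv_preim.
  move=> f Hf; apply/subvP=> _ /memv_imgP[c _ ->]; rewrite -memv_preim -comp_lfunE.
  by apply: (subvP (HU _ (lhom_comp Hi Hf))); rewrite memv_img ?memvf.
apply/eqP; rewrite eqEsubv subvf; apply/subvP=> x _.
rewrite -[x]id_lfunE -s add_lfunE !comp_lfunE; apply: memvD.
  by apply: (subvP (sub _ _ H1 GN)); rewrite memv_img ?memvf.
by apply: (subvP (sub _ _ H2 GN')); rewrite memv_img ?memvf.
Qed.

Lemma gen_zero C Y : zero_mod Y -> gen C Y.
Proof.
move=> /zero_modP Y0 U _; apply/eqP; rewrite eqEsubv subvf; apply/subvP=> y _.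
by rewrite [y]Y0 mem0v.
Qed.

Lemma gen_refl C : gen C C.
Proof.
move=> U HU; apply/eqP; rewrite eqEsubv subvf; apply/subvP=> y _.
by apply: (subvP (HU _ (lhom1 C))); rewrite -[y]id_lfunE memv_img ?memvf.
Qed.

(** A basis of [Hom(C, Y)] gives a surjection from a power of [C] to [Y]. *)
Lemma gen_in_Fac C M Y : gen C Y -> retract C M -> in_Fac M Y.
Proof.
move=> GY CM.
have [||W HW] := @exists_vspace k 'Hom(C, Y) (fun f => lhom f).
- exact: lhom0.
- move=> c f g Hf Hg; apply/lhomP=> a x; rewrite !add_lfunE !scale_lfunE !lhomE //.
  by rewrite linearP.
pose n := \dim W; pose h (i : 'I_n) : 'Hom(C, Y) := (vbasis W)`_i.
have Hh i : lhom (h i).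
  by apply/HW/vbasis_mem; rewrite mem_nth // size_tuple ltn_ord.
exists (pow_mod C n), (pow_map h); split; last 2 first.
- exact: pow_map_lhom.
- apply: GY => f /HW Wf; apply/subvP=> _ /memv_imgP[x _ ->].
  have -> : f x = pow_map h ([ffun i => coord (vbasis W) i f *: x] : pow_mod C n).
    rewrite pow_mapE {1}(coord_vbasis Wf) sum_lfunE; apply: eq_bigr => i _.
    by rewrite scale_lfunE ffunE linearZ.
  by rewrite memv_img ?memvf.
move=> Z IZ /summandP r; have [_ r'] := indec_retract_dsum IZ (pow_dsum C n) r.
exact/summandP/(retract_trans r').
Qed.

Lemma in_add_gen C M X : gen C M -> in_add M X -> gen C X.
Proof.
move=> GM; elim/indec_ind: X => [X z _|X IX add|N N' X s IN IN' add].
- exact: gen_zero.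
- by apply: gen_retract GM _; apply/summandP/add => //; apply/summandP/retract_refl.
- apply: (gen_dsum2 s); [apply: IN | apply: IN'] => Y IY /summandP r.
    by apply: add => //; apply/summandP; apply: retract_trans r (dsum2_retractl s).
  by apply: add => //; apply/summandP; apply: retract_trans r (dsum2_retractr s).
Qed.

Lemma in_Fac_gen C M Y : gen C M -> in_Fac M Y -> gen C Y.
Proof. by move=> GM [X [f [add Hf sf]]]; apply: gen_surj (in_add_gen GM add) Hf sf. Qed.

Lemma in_Fac_iso M N Y : iso M N -> in_Fac M Y -> in_Fac N Y.
Proof.
move=> MN [X [f [add Hf sf]]]; exists X, f; split=> // Z IZ s; apply/summandP.
by apply: retract_trans (iso_retract MN); apply/summandP/add.
Qed.

(** [C] generates [Fac (pmod U)], and [D] is the summand of [T] that is lost. *)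
Lemma left_mutation_intro (T U V : mpair A) C D :
  support_tau_tilting T -> support_tau_tilting U -> almost_complete V ->
  pair_summand V T -> pair_summand V U ->
  retract C (pmod T) -> gen C (pmod U) -> retract D (pmod T) -> ~ gen C D ->
  left_mutation T U.
Proof.
move=> sT sU aV VT VU CT GU DT nG.
have nD : ~ in_Fac (pmod U) D by move/(in_Fac_gen GU).
have yD : in_Fac (pmod T) D.
  by apply: gen_in_Fac DT; apply: gen_refl.
split; last by exists D.
  split=> //; last by exists V.
  by case=> [i _]; apply: nD; apply: in_Fac_iso i yD.
by move=> Y /(in_Fac_gen GU) G; apply: gen_in_Fac G CT.
Qed.

(** ** Basic pairs with few summands *)

Definition basic_dec m X : Prop := exists N : 'I_m -> lmod A,
  [/\ is_dsum N X, forall i, indecomposable (N i) & forall i j, iso (N i) (N j) -> i = j].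

Lemma basic_dec0 X : zero_mod X -> basic_dec 0 X.
Proof.
move=> z; exists (fun _ => X); split; last by case.
  exact/dsum_I0.
by case.
Qed.

Lemma basic_dec1 X : indecomposable X -> basic_dec 1 X.
Proof.
move=> IX; exists (fun _ => X); split=> // [|i j _]; first exact: dsum_I1.
by rewrite !ord1.
Qed.

Lemma basic_dec2 N N' X : is_dsum2 N N' X -> indecomposable N -> indecomposable N' ->
  ~ iso N N' -> basic_dec 2 X.
Proof.
move=> s IN IN' nI; exists (fun i : 'I_2 => if i == ord0 then N else N'); split.
- exact: dsum_I2.
- by move=> i; case: ifP.
- move=> i j; have [->|i0] := eqVneq i ord0; have [->|j0] // := eqVneq j ord0.
  + by move/iso_sym/nI.
  + move=> _; apply: val_inj; move: i0 j0; rewrite -!val_eqE /=.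
    by have := ltn_ord i; have := ltn_ord j; lia.
Qed.

Lemma basic_decP m X : basic_dec m X <-> basic X /\ num_summands X m.
Proof.
split=> [[N [s IN inj]]|[b nm]]; last exact: basic_num.
by split; [exists m, N | apply: num_of_dsum s IN inj].
Qed.

Lemma tau_rigid_pair_intro (T : mpair A) m p n : num_summands (reg A) n ->
  basic_dec m (pmod T) -> basic_dec p (pproj T) -> tau_rigid (pmod T) ->
  projective (pproj T) -> hom_zero (pproj T) (pmod T) ->
  tau_rigid_pair T /\ forall d, (m + p + d = n)%N -> pair_corank T d.
Proof.
move=> nA /basic_decP[bM nM] /basic_decP[bP nP] rM PP hz.
by split=> // d E; exists m, p, n.
Qed.

Lemma stt_dec (T : mpair A) n : num_summands (reg A) n -> support_tau_tilting T ->
  exists m p, [/\ basic_dec m (pmod T), basic_dec p (pproj T) & (m + p = n)%N].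
Proof.
move=> nA [[[bM bP] _ _ _] [m [p [n' [nM nP nA' E]]]]]; exists m, p.
split; [exact/basic_decP | exact/basic_decP |].
by rewrite -(num_summands_uniq nA' nA) -E addn0.
Qed.

Lemma basic_dec1_inv X : basic_dec 1 X -> indecomposable X.
Proof. by case=> N [/dsum_I1_iso i IN _]; apply: indec_iso i (IN _). Qed.

Lemma basic_dec2_inv X : basic_dec 2 X -> exists N N',
  [/\ is_dsum2 N N' X, indecomposable N, indecomposable N' & ~ iso N N'].
Proof.
case=> N [/dsum_I2_dsum2 s IN inj]; exists (N ord0), (N ord_max).
by split=> // /inj.
Qed.

Lemma basic_dec2_sum X Y Z W : basic_dec 2 X ->
  (forall N, indecomposable N -> retract N X -> iso N Y \/ iso N Z) ->
  is_dsum2 Y Z W -> iso X W.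
Proof.
move=> /basic_dec2_inv[N [N' [s IN IN' nI]]] HX sW.
have [i|i] := HX _ IN (dsum2_retractl s); have [i'|i'] := HX _ IN' (dsum2_retractr s).
- by case: nI; apply: iso_trans i (iso_sym i').
- by apply: dsum2_uniq sW; apply: dsum2_iso i i' (iso_refl X) s.
- by apply: dsum2_uniq sW; apply: dsum2_iso i' i (iso_refl X) (dsum2_sym s).
- by case: nI; apply: iso_trans i (iso_sym i').
Qed.

Lemma basic_dec_le1 m X Y : basic_dec m X ->
  (forall N, indecomposable N -> retract N X -> iso N Y) -> (m <= 1)%N.
Proof.
case: m => [|[|m]] // [N [s IN inj]] HX.
have i0 := HX _ (IN ord0) (dsum_retract ord0 s).
have i1 := HX _ (IN ord_max) (dsum_retract ord_max s).
by have /(congr1 val) := inj _ _ (iso_trans i0 (iso_sym i1)).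
Qed.

End Generation.


(** * From pencils to modules and back *)

Section Functor.
Variables (k : fieldType) (A : falgType k) (H : dk_data A).
Implicit Types M N P Q X Y : lmod A.
Implicit Types C : pencil k.
Notation vtx := (vtx H).
Notation arw := (arw H).
Notation rad := (rad H).
Notation pres := (pres H).
Notation mgen := (mgen H).
Notation xsum := (xsum H).

Section FixedVertex.
Variable v : bool.

Lemma pres_hom C C' (S : 'M_(pa C, pa C')) (T : 'M_(pd C, pd C')) : phom S T ->
  exists2 f : 'Hom(pres v C, pres v C'), lhom f & forall i, f (mgen v i) = mxc T (mgen v (C := C')) i.
Proof.
case=> HG HD; apply: pres_map => i.
  by rewrite mxc_lfun; apply: eq_mxc => j; rewrite mgen_vtx.
rewrite xsum_mxc -HG -HD xsumM; apply: big1 => j _.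
by rewrite mgen_rel scaler0.
Qed.

(** The matrix [T] records the images of the generators modulo the radical. Their
    remaining part is killed by the arrows out of [v], so that the relations of [C]
    are sent to relations between the generators for [C'], whence [S]. *)
Lemma pres_hom_mx C C' (f : 'Hom(pres v C, pres v C')) : lhom f ->
  exists T : 'M_(pd C, pd C'), (exists S : 'M_(pa C, pa C'), phom S T) /\
    forall i, f (mgen v i) - mxc T (mgen v (C := C')) i \in rad (pres v C').
Proof.
move=> Hf.
have fv i : lact (pres v C') (vtx v) (f (mgen v i)) = f (mgen v i).
  by rewrite -lhomE // mgen_vtx.
pose Q i (tr : 'rV[k]_(pd C') * pres v C') := [/\ tr.2 \in rad (pres v C'),
  forall b, lact (pres v C') (arw v b) tr.2 = 0 & f (mgen v i) = mxc tr.1 (mgen v (C := C')) 0 + tr.2].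
have [tr Htr] : exists tr, forall i : 'I_(pd C), Q i (tr i).
  apply: (fin_all_exists (P := Q)) => i; have [t [r [Rr ar E]]] := pres_vtx_same (f (mgen v i)).
  by exists (t, r); split=> //=; rewrite -E fv.
pose T := \matrix_(i, j) (tr i).1 0 j.
have TE i : mxc T (mgen v (C := C')) i = mxc (tr i).1 (mgen v (C := C')) 0.
  by apply: eq_bigr => j _; rewrite mxE.
exists T; split; last first.
  by move=> i; have [Rr _ ->] := Htr i; rewrite TE addrC addKr.
have [i|S [EG ED]] := @xsum_eq0 k A H v C' (pa C) (pG C *m T) (pD C *m T).
  transitivity (f (xsum v (pG C) (pD C) (mgen v (C := C)) i)); last by rewrite mgen_rel linear0.
  rewrite -xsum_mxc (xsum_lhom _ _ _ _ _ _ Hf); apply: eq_xsum => b j; have [_ ar ->] := Htr j.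
  by rewrite linearD /= ar addr0 TE.
by exists S.
Qed.

Lemma pres_iso C C' : piso C C' -> iso (pres v C) (pres v C').
Proof.
case=> S [T [S' [T' [HST HST' _ [TT' T'T]]]]].
have [f Hf fE] := pres_hom HST; have [g Hg gE] := pres_hom HST'.
exists f, g; split=> //; apply: pres_ext => [||j]; do ?[exact: lhom1 | exact: lhom_comp].
  rewrite comp_lfunE fE mxc_lfun id_lfunE -[RHS]mxc1 -TT' mxcM.
  by apply: eq_mxc => l; rewrite gE.
rewrite comp_lfunE gE mxc_lfun id_lfunE -[RHS]mxc1 -T'T mxcM.
by apply: eq_mxc => l; rewrite fE.
Qed.

Lemma pres_dsum2 C C' : is_dsum2 (pres v C) (pres v C') (pres v (psum C C')).
Proof.
have [i1 Hi1 i1E] := pres_hom (phom_inl C C').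
have [i2 Hi2 i2E] := pres_hom (phom_inr C C').
have [p1 Hp1 p1E] := pres_hom (phom_prl C C').
have [p2 Hp2 p2E] := pres_hom (phom_prr C C').
have comp C1 C2 C3 (f : 'Hom(pres v C1, pres v C2)) (g : 'Hom(pres v C2, pres v C3)) T U i :
    (forall i, f (mgen v i) = mxc T (mgen v (C := C2)) i) ->
    (forall i, g (mgen v i) = mxc U (mgen v (C := C3)) i) ->
    (g \o f)%VF (mgen v i) = mxc (T *m U) (mgen v (C := C3)) i.
  by move=> fE gE; rewrite comp_lfunE fE mxc_lfun mxcM; apply: eq_mxc.
apply/dsum2P; exists i1, p1, i2, p2; split; [by split | split | split | ].
- apply: pres_ext => [||i]; [exact: lhom_comp | exact: lhom1 |].
  by rewrite (comp _ _ _ _ _ _ _ _ i1E p1E) mul_row_col mul1mx mul0mx addr0 mxc1 id_lfunE.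
- apply: pres_ext => [||i]; [exact: lhom_comp | exact: lhom1 |].
  by rewrite (comp _ _ _ _ _ _ _ _ i2E p2E) mul_row_col mul1mx mul0mx add0r mxc1 id_lfunE.
- apply: pres_ext => [||i]; [exact: lhom_comp | exact: lhom0 |].
  by rewrite (comp _ _ _ _ _ _ _ _ i2E p1E) mul_row_col mulmx0 mul0mx addr0 mxc0 zero_lfunE.
- apply: pres_ext => [||i]; [exact: lhom_comp | exact: lhom0 |].
  by rewrite (comp _ _ _ _ _ _ _ _ i1E p2E) mul_row_col mulmx0 mul0mx addr0 mxc0 zero_lfunE.
- apply: pres_ext => [||i]; [by apply: lhomD; apply: lhom_comp | exact: lhom1 |].
  rewrite add_lfunE (comp _ _ _ _ _ _ _ _ p1E i1E) (comp _ _ _ _ _ _ _ _ p2E i2E) -mxcD.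
  rewrite id_lfunE -[RHS]mxc1 !mul_col_row !mul1mx !mul0mx ?mulmx0 add_block_mx.
  by rewrite !addr0 !add0r -scalar_mx_block.
Qed.

Lemma mgen_notin_rad C j : mgen v j \notin rad (pres v C).
Proof.
apply/negP=> R; have : delta_mx 0 j = 0 :> 'rV[k]_(pd C).
  by apply: (mgen_free (H := H) (v := v)) => i; rewrite ord1 mxc_delta.
by move/matrixP/(_ 0 j)/eqP; rewrite !mxE !eqxx oner_eq0.
Qed.

Lemma pres_nonzero C : (0 < pd C)%N -> ~ zero_mod (pres v C).
Proof.
move=> d0 /zero_modP z; have := mgen_notin_rad (Ordinal d0).
by rewrite [mgen _ _]z mem0v.
Qed.

Lemma pres_img_rad C N (f : 'Hom(pres v C, N)) : lhom f ->
  (forall j, f (mgen v j) \in rad N) -> forall m, f m \in rad N.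
Proof.
move=> Hf R m; have [c ->] := pres_span m; rewrite linear_sum.
apply: memv_suml => j _.
suff: f (lact (pres v C) (c j) (mgen v j)) \in rad N by [].
by rewrite lhomE //; apply: submodP; first exact: rad_submodule.
Qed.

(** Only [T] is constrained, as it alone is visible on the generators of the module. *)
Definition brick C := forall S T, @phom k C C S T -> exists c : k, T = c%:M.

(** Modulo the radical, an endomorphism is a homomorphism of pencils, hence a
    scalar; an idempotent one is 0 or 1 there, so one summand is in the radical. *)
Lemma pres_indec C : (0 < pd C)%N -> brick C -> indecomposable (pres v C).
Proof.
move=> d0 B; split; first exact: pres_nonzero.
move=> N N' /dsum2P[i1 [p1 [i2 [p2 [[Hi1 Hp1 Hi2 Hp2] [e1 e2] [z1 z2] s]]]]].
have key (Z : lmod A) (i : 'Hom(Z, pres v C)) (p : 'Hom(pres v C, Z)) : lhom i -> lhom p ->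
    (p \o i = \1)%VF -> (forall j, i (p (mgen v j)) \in rad (pres v C)) -> zero_mod Z.
  move=> Hi Hp pi R; have ip0 : (i \o p)%VF = 0.
    apply: (idem_rad (H := H)); first exact: lhom_comp.
      by move=> m; rewrite !comp_lfunE -[p (i _)]comp_lfunE pi id_lfunE.
    by apply: pres_img_rad; [exact: lhom_comp | move=> j; rewrite comp_lfunE].
  apply/zero_modP=> z; have piz y : p (i y) = y by rewrite -comp_lfunE pi id_lfunE.
  by rewrite -(piz z) -(piz z) -[i (p _)]comp_lfunE ip0 zero_lfunE linear0.
have He : lhom (i1 \o p1)%VF by apply: lhom_comp.
have [T [[S HST] R]] := pres_hom_mx He; have [c Tc] := B _ _ HST.
pose j0 := Ordinal d0.
have Rc j : i1 (p1 (mgen v j)) - c *: mgen v j \in rad (pres v C).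
  by have := R j; rewrite comp_lfunE Tc mxc_scalar.
(* The scalar [c] is idempotent, because the generators are not in the radical. *)
have cc : (1 - c) * c = 0.
  apply/eqP; apply: contraT => nz.
  have := mgen_notin_rad j0; rewrite -[mgen v j0](scalerK nz) => /negP[]; apply: memvZ.
  have E : i1 (p1 (i1 (p1 (mgen v j0)))) = i1 (p1 (mgen v j0)).
    by rewrite -[p1 (i1 _)]comp_lfunE e1 id_lfunE.
  have := lhom_rad He (Rc j0); rewrite comp_lfunE !linearB !linearZ /= E => R2.
  have := memvB R2 (memvZ (1 - c) (Rc j0)).
  by rewrite scalerBr scalerA [(1 - c) *: i1 _]scalerBl scale1r scalerN subKr.
have [c0|c1] : c = 0 \/ c = 1.
  move/eqP: cc; rewrite mulf_eq0 subr_eq0 eq_sym.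
  by case/orP=> /eqP->; [right|left].
- left; apply: (key N i1 p1) => // j.
  by have := Rc j; rewrite c0 scale0r subr0.
- right; apply: (key N' i2 p2) => // j.
  have E : i2 (p2 (mgen v j)) = mgen v j - i1 (p1 (mgen v j)).
    by rewrite -{2}[mgen v j]id_lfunE -s add_lfunE !comp_lfunE [RHS]addrC addKr.
  by rewrite E -opprB memvN; have := Rc j; rewrite c1 scale1r.
Qed.

End FixedVertex.
End Functor.


Lemma mx_inv_dim (k : fieldType) m n (T : 'M[k]_(m, n)) (T' : 'M[k]_(n, m)) :
  T *m T' = 1%:M -> T' *m T = 1%:M -> m = n.
Proof.
move=> E E'; apply/eqP; rewrite eqn_leq.
have f : row_free T by apply/row_freeP; exists T'.
have f' : row_free T' by apply/row_freeP; exists T.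
by have := rank_leq_col T; have := rank_leq_col T'; rewrite (eqP f) (eqP f') => -> ->.
Qed.

Section Presentations.
Variables (k : fieldType) (A : falgType k) (H : dk_data A).
Implicit Types M N P Q X Y : lmod A.
Implicit Types C : pencil k.
Notation vtx := (vtx H).
Notation arw := (arw H).
Notation cf0 := (cf0 H).
Notation cf1 := (cf1 H).
Notation rad := (rad H).
Notation pres := (pres H).
Notation mgen := (mgen H).
Notation xsum := (xsum H).

(** A generator at [v] is sent to the part of the target at [v], which consists of
    arrows applied to generators at the other vertex. *)
Lemma pres_other_rad v C C' (f : 'Hom(pres v C, pres (~~ v) C')) m : lhom f ->
  f m \in rad (pres (~~ v) C').
Proof.
move=> Hf; apply: pres_img_rad => // j; rewrite -(mgen_vtx H v j) (lhomE _ _ Hf).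
have [X [Y]] := pres_vtx_other (H := H) (v := ~~ v) (f (mgen v j)); rewrite negbK => ->.
exact: xsum_rad.
Qed.

(** Modulo the radical, mutually inverse isomorphisms give mutually inverse matrices
    [T] and [T']; row independence then makes [S] and [S'] mutually inverse. *)
Lemma pres_iso_inv v v' C C' : iso (pres v C) (pres v' C') -> (0 < pd C)%N ->
  row_indep C -> row_indep C' -> [/\ v = v', pa C = pa C' & pd C = pd C'].
Proof.
case=> f [g [Hf Hg gf fg]] d0 RC RC'.
have vv : v = v'.
  apply/eqP; apply: contraT => nv; have ev : v' = ~~ v by clear -nv; case: v v' nv => -[].
  subst v'; have := mgen_notin_rad H v (Ordinal d0).
  rewrite -[mgen v _]id_lfunE -gf comp_lfunE => /negP[].
  by apply: lhom_rad => //; apply: pres_other_rad.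
subst v'.
have [T [[S HST] R]] := pres_hom_mx Hf; have [T' [[S' HST'] R']] := pres_hom_mx Hg.
have comp C1 C2 (f1 : 'Hom(pres v C1, pres v C2)) (f2 : 'Hom(pres v C2, pres v C1)) T1 T2 :
    lhom f1 -> lhom f2 -> (f2 \o f1 = \1)%VF ->
    (forall i, f1 (mgen v i) - mxc T1 (mgen v (C := C2)) i \in rad (pres v C2)) ->
    (forall i, f2 (mgen v i) - mxc T2 (mgen v (C := C1)) i \in rad (pres v C1)) ->
    T1 *m T2 = 1%:M.
  move=> H1 H2 f21 R1 R2; apply/esym/eqP; rewrite -subr_eq0; apply/eqP.
  apply: (mgen_free (H := H) (v := v)) => i; rewrite mxcD mxcN mxc1 mxcM.
  have Rab := lhom_rad H2 (R1 i).
  rewrite linearB /= mxc_lfun -[f2 (f1 _)]comp_lfunE f21 id_lfunE in Rab.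
  have Rbc : mxc T1 (fun j => f2 (mgen v j) - mxc T2 (mgen v (C := C1)) j) i \in rad (pres v C1).
    exact: mxc_mem.
  have E : mxc T1 (fun j => f2 (mgen v j) - mxc T2 (mgen v (C := C1)) j) i =
      mxc T1 (fun j => f2 (mgen v j)) i - mxc T1 (mxc T2 (mgen v (C := C1))) i.
    by rewrite /mxc -sumrB; apply: eq_bigr => j _; rewrite scalerBr.
  by rewrite E in Rbc; have := memvD Rab Rbc; rewrite addrA subrK.
have TT' := comp _ _ _ _ _ _ Hf Hg gf R R'; have T'T := comp _ _ _ _ _ _ Hg Hf fg R' R.
have sz C1 C2 (S1 : 'M_(pa C1, pa C2)) S2 (T1 : 'M_(pd C1, pd C2)) T2 :
    row_indep C1 -> phom S1 T1 -> phom S2 T2 -> T1 *m T2 = 1%:M -> S1 *m S2 = 1%:M.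
  move=> RC1 [g1 d1] [g2 d2] E; apply/eqP; rewrite -subr_eq0; apply/eqP/row_matrixP=> i.
  rewrite row0; apply: RC1; rewrite -row_mul mulmxBl mul1mx -mulmxA.
    by rewrite g2 mulmxA g1 -mulmxA E mulmx1 subrr row0.
  by rewrite d2 mulmxA d1 -mulmxA E mulmx1 subrr row0.
split=> //; last exact: mx_inv_dim TT' T'T.
exact: mx_inv_dim (sz _ _ _ _ _ _ RC HST HST' TT') (sz _ _ _ _ _ _ RC' HST' HST T'T).
Qed.

(** ** Rigidity *)

Section FixedVertex.
Variable v : bool.

(** A homomorphism [u] from the first term of the presentation to the module picks one
    element [xsum X Y mgen i] for each row, and is thus a pair of matrices [(X, Y)]. That
    [u] factors through the presentation by a map with matrix [T] on the generators
    means that [(X - G T, Y - D T)] gives relations of the module, hence is [(S G, S D)]. *)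
Lemma pres_lift_rigid C :
  (forall u : 'Hom(pfree H (fun _ : 'I_(pa C) => ~~ v), pres v C), lhom u ->
     exists2 w : 'Hom(pfree H (fun _ : 'I_(pd C) => v), pres v C), lhom w & u = (w \o prel H v C)%VF) ->
  rigid C.
Proof.
move=> lift X Y; pose u := pmap H (fun _ : 'I_(pa C) => ~~ v) (xsum v X Y (mgen v (C := C))).
have [w Hw E] := lift u (pmap_lhom _ _ _).
have wv j : lact (pres v C) (vtx v) (w (pgen H (fun _ => v) j)) = w (pgen H (fun _ => v) j).
  by rewrite -lhomE // pgen_vtx.
pose Q j (tr : 'rV[k]_(pd C) * pres v C) := (forall b, lact (pres v C) (arw v b) tr.2 = 0)
  /\ w (pgen H (fun _ => v) j) = mxc tr.1 (mgen v (C := C)) 0 + tr.2.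
have [tr Htr] : exists tr, forall j : 'I_(pd C), Q j (tr j).
  apply: (fin_all_exists (P := Q)) => j; have [t [r [_ ar Er]]] := pres_vtx_same (w (pgen H (fun _ => v) j)).
  by exists (t, r); split=> //=; rewrite -Er wv.
pose T := \matrix_(i, j) (tr i).1 0 j.
have TE i : mxc T (mgen v (C := C)) i = mxc (tr i).1 (mgen v (C := C)) 0.
  by apply: eq_bigr => j _; rewrite mxE.
have [i|S [ES ES']] := @xsum_eq0 k A H v C (pa C) (X - pG C *m T) (Y - pD C *m T).
  have -> : xsum v (X - pG C *m T) (Y - pD C *m T) (mgen v (C := C)) i =
      xsum v X Y (mgen v (C := C)) i - xsum v (pG C) (pD C) (mxc T (mgen v (C := C))) i.
    by rewrite xsum_mxc xsumD xsumN.
  apply/eqP; rewrite subr_eq0; apply/eqP.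
  have -> : xsum v X Y (mgen v (C := C)) i = u (pgen H _ i) by rewrite pmap_gen xsum_vtx.
  rewrite E comp_lfunE prel_gen (xsum_lhom _ _ _ _ _ _ Hw); apply: eq_xsum => b j.
  by have [ar ->] := Htr j; rewrite linearD /= ar addr0 TE.
by exists S, T; rewrite -ES -ES' !subrK.
Qed.

(** The same dictionary, read backwards. *)
Lemma rigid_pres_lift C : rigid C ->
  forall u : 'Hom(pfree H (fun _ : 'I_(pa C) => ~~ v), pres v C), lhom u ->
  exists2 w : 'Hom(pfree H (fun _ : 'I_(pd C) => v), pres v C), lhom w & u = (w \o prel H v C)%VF.
Proof.
move=> R u Hu.
pose Q i (XY : 'rV[k]_(pd C) * 'rV[k]_(pd C)) :=
  u (pgen H (fun _ => ~~ v) i) = xsum v XY.1 XY.2 (mgen v (C := C)) 0.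
have [XY HXY] : exists XY, forall i : 'I_(pa C), Q i (XY i).
  apply: (fin_all_exists (P := Q)) => i.
  have [X [Y E]] := pres_vtx_other (H := H) (u (pgen H (fun _ => ~~ v) i)).
  by exists (X, Y); rewrite /Q /= -E -lhomE // pgen_vtx.
pose X := \matrix_(i, j) (XY i).1 0 j; pose Y := \matrix_(i, j) (XY i).2 0 j.
have uE i : u (pgen H (fun _ => ~~ v) i) = xsum v X Y (mgen v (C := C)) i.
  by rewrite HXY; congr (_ + _); apply: eq_bigr => j _; rewrite mxE.
have [S [T [EX EY]]] := R X Y.
exists (pmap H (fun _ => v) (mxc T (mgen v (C := C)))); first exact: pmap_lhom.
have Hw := pmap_lhom H (fun _ => v) (mxc T (mgen v (C := C))).
apply: pfree_ext => [||i] //; first exact: lhom_comp Hw (prel_lhom _ _ _).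
rewrite comp_lfunE prel_gen (xsum_lhom _ _ _ _ _ _ Hw) uE EX EY xsumD xsumM.
rewrite [X in X + _]big1 ?add0r => [|j _]; last by rewrite mgen_rel scaler0.
rewrite -xsum_mxc; apply: eq_xsum => b j; congr (fun_of_lfun (lact _ _) _).
by rewrite pmap_gen mxc_lfun; apply: eq_mxc => l; rewrite mgen_vtx.
Qed.

Lemma pres_minimal C : row_indep C -> minimal_presentation (prel H v C) (pres_pi H v C).
Proof.
move=> RC; split.
- by split; apply: pfree_projective.
- by split; [apply: prel_lhom | apply: pres_pi_lhom].
- by split; [apply: pres_pi_surj | rewrite pres_pi_ker].
split; apply: (superfluous_rad (H := H)); first by rewrite pres_pi_ker limg_prel_rad.
apply/subvP=> u; rewrite memv_ker => /eqP u0; apply: rad_pco => i.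
have z j : pco j (0 : pfree H (fun _ : 'I_(pd C) => v)) = 0 by rewrite linear0.
have c0 b : cf1 v b 0 = 0 by have := cf1Z H v b 0 0; rewrite scale0r mul0r.
have /rowP/(_ i) : \row_i cf0 (~~ v) (pco i u) = 0 :> 'rV_(pa C).
  apply: RC; apply/rowP=> j; rewrite [RHS]mxE.
    by have := cf1_prel u j false; rewrite u0 z c0.
  by have := cf1_prel u j true; rewrite u0 z c0.
by rewrite !mxE.
Qed.

Lemma pres_tau_rigid C : row_indep C -> rigid C -> tau_rigid (pres v C).
Proof. by move=> RC R; apply: lift_tau_rigid (pres_minimal RC) (rigid_pres_lift R). Qed.

(** ** Generation *)

Lemma covers_gen C C' : covers C C' -> gen (pres v C) (pres v C').
Proof.
move=> cov U HU; apply/eqP; rewrite eqEsubv subvf; apply/subvP=> m _.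
have [c ->] := pres_span m; apply: memv_suml => j _.
have [S [T [i [HST Ti]]]] := cov j; have [f Hf fE] := @pres_hom _ _ H v _ _ _ _ HST.
apply: (subvP (HU _ Hf)); apply: submodP; first exact: submodule_limg.
have <- : f (mgen v i) = mgen v j by rewrite fE -mxc_row Ti mxc_delta.
by rewrite memv_img ?memvf.
Qed.

Lemma img_rad_not_gen M N : ~ zero_mod N ->
  (forall (f : 'Hom(M, N)) m, lhom f -> f m \in rad N) -> ~ gen M N.
Proof.
move=> nz R G; apply: nz; apply: (rad_full (H := H)); apply: G => f Hf.
by apply/subvP=> _ /memv_imgP[m _ ->]; apply: R.
Qed.

Lemma hom0_not_gen C C' : (0 < pd C')%N ->
  (forall (S : 'M_(pa C, pa C')) (T : 'M_(pd C, pd C')), phom S T -> T = 0) ->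
  ~ gen (pres v C) (pres v C').
Proof.
move=> d0 h0; apply: img_rad_not_gen; first exact: pres_nonzero.
move=> f m Hf; apply: pres_img_rad => // j; have [T [[S HST] R]] := pres_hom_mx Hf.
by have := R j; rewrite (h0 _ _ HST) mxc0 subr0.
Qed.

Lemma other_not_gen C C' : (0 < pd C')%N -> ~ gen (pres v C) (pres (~~ v) C').
Proof.
move=> d0; apply: img_rad_not_gen; first exact: pres_nonzero.
by move=> f m; apply: pres_other_rad.
Qed.

Lemma pres_proj C : pa C = 0%N -> iso (pfree H (fun _ : 'I_(pd C) => v)) (pres v C).
Proof.
move=> a0; apply/isoP; exists (pres_pi H v C); split; [exact: pres_pi_lhom | | exact: pres_pi_surj].
rewrite pres_pi_ker -subv0; apply/subvP=> _ /memv_imgP[u _ ->].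
rewrite (phom_span u (prel_lhom H v C)) big1 ?mem0v // => i _.
by exfalso; have := ltn_ord i; move: (nat_of_ord i) => x; rewrite a0.
Qed.

(** ** Presentations by free modules *)

(** A homomorphism between these projectives has its entries in [vtx (~~ v) A vtx v],
    which is spanned by the two arrows. *)
Lemma pfree_rel a d (f : 'Hom(pfree H (fun _ : 'I_a => ~~ v), pfree H (fun _ : 'I_d => v))) :
  lhom f -> exists G D : 'M_(a, d), f = prel H v (Pencil G D).
Proof.
move=> Hf.
pose G := \matrix_(i, j) cf1 v false (pco j (f (pgen H (fun _ : 'I_a => ~~ v) i))).
pose D := \matrix_(i, j) cf1 v true (pco j (f (pgen H (fun _ : 'I_a => ~~ v) i))).
exists G, D; apply: pfree_ext => // [|i]; first exact: (prel_lhom H v (Pencil G D)).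
apply: etrans _ (esym (@prel_gen _ _ H v (Pencil G D) i)).
rewrite -[in LHS](pgen_vtx H (fun _ : 'I_a => ~~ v) i) (lhomE _ _ Hf).
rewrite {1}[f _]pgen_span linear_sum xsumE; apply: eq_bigr => j _.
apply: etrans (act_other _ (pgen_vtx H (fun _ => v) j)) _.
by rewrite big_bool !mxE; apply: addrC.
Qed.

(** The functional reading the coefficient at the trivial path of a generator has a
    maximal submodule as its kernel, and a superfluous submodule is contained in it. *)
Lemma superfluous_pfree n (nu : 'I_n -> bool) (K : {vspace pfree H nu}) :
  superfluous K -> (K <= rad (pfree H nu))%VS.
Proof.
move=> sK; apply/subvP=> u Ku; apply: rad_pco => i; apply/eqP; apply: contraT => ci.
have FL : linear (fun u : pfree H nu => cf0 (nu i) (pco i u) : k^o).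
  by move=> c w w'; rewrite linearP cf0D cf0Z.
pose F : 'Hom(pfree H nu, k^o) := lin_hom FL.
have HF : submodule (lker F).
  move=> a; apply/subvP=> _ /memv_imgP[w + ->]; rewrite !memv_ker !lin_homE pco_act cf0M.
  by move/eqP->; rewrite mulr0.
have full : lker F = fullv.
  apply: sK => //; apply/eqP; rewrite eqEsubv subvf; apply/subvP=> w _.
  pose c := cf0 (nu i) (pco i w) / cf0 (nu i) (pco i u).
  rewrite -[w](subrK (c *: u)) addrC; apply: memv_add; first exact: memvZ.
  by rewrite memv_ker linearB linearZ /= !lin_homE /c /GRing.scale /= divfK ?subrr.
have : pgen H nu i \in lker F by rewrite full memvf.
by rewrite memv_ker lin_homE pco_gen eqxx cf0_vtx eqxx oner_eq0.
Qed.

(** Minimality of the presentation gives independent rows, and the lifting property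
    gives rigidity. *)
Lemma presentation_pencil a d M
    (f : 'Hom(pfree H (fun _ : 'I_a => ~~ v), pfree H (fun _ : 'I_d => v)))
    (g : 'Hom(pfree H (fun _ : 'I_d => v), M)) :
  lhom f -> lhom g -> limg g = fullv -> limg f = lker g -> superfluous (lker f) ->
  (forall u : 'Hom(pfree H (fun _ : 'I_a => ~~ v), M), lhom u ->
    exists2 w : 'Hom(pfree H (fun _ : 'I_d => v), M), lhom w & u = (w \o f)%VF) ->
  exists C, [/\ pd C = d, row_indep C, rigid C & iso M (pres v C)].
Proof.
move=> Hf Hg sg fg sf lift; have [G [D E]] := pfree_rel Hf; subst f.
have i : iso M (pres v (Pencil G D)).
  apply: (surj_iso Hg sg (pres_pi_lhom H v (Pencil G D)) (pres_pi_surj H v (Pencil G D))).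
  exact: etrans (esym fg) (esym (pres_pi_ker H v (Pencil G D))).
exists (Pencil G D); split=> //.
- move=> /= c cG cD.
  pose u := \sum_l c 0 l *: pgen H (fun _ : 'I_a => ~~ v) l.
  have cE l : cf0 (~~ v) (pco l u) = c 0 l.
    rewrite linear_sum (bigD1 l) //= big1 => [|l' ll].
      by rewrite addr0 linearZ /= pco_gen eqxx cf0Z cf0_vtx eqxx mulr1.
    by rewrite linearZ /= pco_gen eq_sym (negPf ll) scaler0.
  have uK : u \in lker (prel H v (Pencil G D)).
    rewrite memv_ker linear_sum; apply/eqP.
    transitivity (mxc c (xsum v G D (pgen H (fun _ : 'I_d => v))) 0).
      apply: eq_bigr => l _; rewrite linearZ; congr (_ *: _).
      exact: (@prel_gen _ _ H v (Pencil G D) l).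
    by rewrite -xsumM cG cD xsum0.
  apply/rowP=> l; rewrite -cE mxE.
  by apply: pco_rad; apply: (subvP (superfluous_pfree sf)).
- apply: pres_lift_rigid => u Hu; have [p [q [Hp Hq qp pq]]] := i.
  have [w Hw Ew] := lift (q \o u)%VF (lhom_comp Hq Hu).
  exists (p \o w)%VF; first exact: lhom_comp.
  by rewrite -comp_lfunA -Ew comp_lfunA pq comp_lfun1l.
Qed.

End FixedVertex.

(** A vertex cannot occur in both terms of the presentation of a tau-rigid module:
    all homomorphisms from the first term land in the radical. *)
Lemma lift_img_rad n1 n0 (nu1 : 'I_n1 -> bool) (nu0 : 'I_n0 -> bool) M
    (f : 'Hom(pfree H nu1, pfree H nu0)) (g : 'Hom(pfree H nu0, M)) i m :
  lhom g -> limg f = lker g -> superfluous (lker g) ->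
  (forall u : 'Hom(pfree H nu1, M), lhom u ->
    exists2 w : 'Hom(pfree H nu0, M), lhom w & u = (w \o f)%VF) ->
  lact M (vtx (nu1 i)) m \in rad M.
Proof.
move=> Hg fg sg lift; have [w Hw E] := lift _ (pmap_lhom H nu1 (fun _ => m)).
rewrite -(pmap_gen H nu1 (fun _ => m)) E comp_lfunE; apply: lhom_rad => //.
by apply: (subvP (superfluous_pfree sg)); rewrite -fg memv_img ?memvf.
Qed.

Lemma vtx_rad_notin n (nu : 'I_n -> bool) M (g : 'Hom(pfree H nu, M)) j :
  lhom g -> limg g = fullv -> superfluous (lker g) ->
  ~ (forall m, lact M (vtx (nu j)) m \in rad M).
Proof.
move=> Hg sg kg R; have [u Ru Eu] := rad_surj Hg sg (R (g (pgen H nu j))).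
have : pgen H nu j - u \in lker g.
  by rewrite memv_ker linearB /= Eu -lhomE // pgen_vtx subrr.
move/(subvP (superfluous_pfree kg))/memvD/(_ Ru); rewrite subrK => /(pco_rad j)/eqP.
by rewrite pco_gen eqxx cf0_vtx eqxx oner_eq0.
Qed.

End Presentations.


(** * The support tau-tilting pairs *)

Section Pairs.
Variables (k : fieldType) (A : falgType k) (H : dk_data A).
Implicit Types M N P Q X Y Z : lmod A.
Implicit Types C : pencil k.
Notation vtx := (vtx H).
Notation pres := (pres H).

Definition zmod : lmod A := pow_mod (reg A) 0.

Lemma zmod_zero : zero_mod zmod.
Proof. by apply/zero_modP=> f; apply/ffunP=> -[]. Qed.

Lemma zero_retract Z X : zero_mod Z -> retract Z X.
Proof.
move=> /zero_modP Z0; exists 0, 0; split; try exact: lhom0.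
by apply/lfunP=> z; rewrite [LHS]Z0 [RHS]Z0.
Qed.

Lemma zero_projective Z : zero_mod Z -> projective Z.
Proof.
move=> /zero_modP Z0 X Y g f _ _ _; exists 0; first exact: lhom0.
by apply/lfunP=> z; rewrite [z]Z0 !linear0.
Qed.

Lemma zero_hom_zero Z X : zero_mod Z -> hom_zero Z X.
Proof. by move=> /zero_modP Z0 f _; apply/lfunP=> z; rewrite [z]Z0 !linear0. Qed.

(** The presentation with zero first term has the lifting property. *)
Lemma projective_tau_rigid P : projective P -> tau_rigid P.
Proof.
move=> PP; have z := zmod_zero.
apply: (@lift_tau_rigid _ _ _ zmod P 0 \1%VF); last first.
  by move=> u _; exists 0; [exact: lhom0 | apply/lfunP=> x; move/zero_modP: z => z; rewrite [x]z !linear0].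
have k1 : lker (\1%VF : 'End(P)) = 0%VS by apply/eqP/lker0P => x y; rewrite !id_lfunE.
split.
- by split=> //; apply: zero_projective.
- by split; [apply: lhom0 | apply: lhom1].
- split; first by apply/limgT=> x; exists x; rewrite id_lfunE.
  by rewrite k1 lim0g.
- split=> U HU; first by rewrite k1 add0v.
  move=> _; apply/eqP; rewrite eqEsubv subvf; apply/subvP=> x _.
  by move/zero_modP: z => z; rewrite [x]z mem0v.
Qed.

Definition prepro v n : lmod A := pres v (kron k n).
(** The index is shifted because [cokron 0] has no generator. *)
Definition preinj v n : lmod A := pres v (cokron k n.+1).

Lemma prepro_indec v n : indecomposable (prepro v n).
Proof.
by apply: pres_indec => // S T /kron_brick[c [_ ->]]; exists c.
Qed.

Lemma preinj_indec v n : indecomposable (preinj v n).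
Proof. by apply: pres_indec => // S T /cokron_brick. Qed.

Lemma prepro_rigid v n : tau_rigid (prepro v n).
Proof. by apply: pres_tau_rigid; [apply: row_indep_kron | apply: ext_free_kron]. Qed.

Lemma ext_free_cokron n : ext_free (cokron k n) (cokron k n).
Proof. exact/ext_free_tr/ext_free_kron. Qed.

Lemma preinj_rigid v n : tau_rigid (preinj v n).
Proof. by apply: pres_tau_rigid; [apply: row_indep_cokron | apply: ext_free_cokron]. Qed.

Lemma prepro_inj v n v' n' : iso (prepro v n) (prepro v' n') -> v = v' /\ n = n'.
Proof.
by case/pres_iso_inv => //; apply: row_indep_kron.
Qed.

Lemma preinj_inj v n v' n' : iso (preinj v n) (preinj v' n') -> v = v' /\ n = n'.
Proof.
by case/pres_iso_inv => // [||-> _ [->]]; try exact: row_indep_cokron.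
Qed.

Lemma prepro_preinj v n v' n' : ~ iso (prepro v n) (preinj v' n').
Proof.
case/pres_iso_inv => // [||_ /= E E']; [exact: row_indep_kron | exact: row_indep_cokron |].
by lia.
Qed.

Lemma proj_prepro v : iso (proj H v) (prepro v 0).
Proof. exact: (@pres_proj _ _ H v (kron k 0)). Qed.

Lemma prepro0_projective v : projective (prepro v 0).
Proof.
have [j [l [Hj Hl _ jl]]] := proj_prepro v; move=> X Y g f Hg sg Hf.
have [h Hh gh] := proj_projective Hg sg (lhom_comp Hf Hj).
exists (h \o l)%VF; first exact: lhom_comp.
by rewrite comp_lfunA gh -comp_lfunA jl comp_lfun1r.
Qed.

Lemma prepro_reg v : is_dsum2 (prepro v 0) (prepro (~~ v) 0) (reg A).
Proof.
have s : is_dsum2 (prepro true 0) (prepro false 0) (reg A).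
  by apply: dsum2_iso (reg_dsum2 H); try exact: proj_prepro; apply: iso_refl.
by case: v => //; apply: dsum2_sym.
Qed.

Lemma reg_dec : basic_dec 2 (reg A).
Proof.
apply: basic_dec2 (prepro_reg true) _ _ _; try exact: prepro_indec.
by case/prepro_inj.
Qed.

Lemma reg_num : num_summands (reg A) 2.
Proof. by have /basic_decP[] := reg_dec. Qed.

Lemma reg_projective : projective (reg A).
Proof.
move=> X Y g f Hg /limgT sg Hf; have [x Ex] := sg (f (1 : A)).
exists (orbit_map x); first exact: orbit_map_lhom.
apply/lfunP=> a; rewrite comp_lfunE orbit_mapE lhomE // Ex -lhomE //.
by rewrite reg_actE mulr1.
Qed.

Lemma stt_intro m p M P : (m + p = 2)%N -> basic_dec m M -> basic_dec p P ->
  tau_rigid M -> projective P -> hom_zero P M -> support_tau_tilting (MPair M P).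
Proof.
move=> E bM bP rM PP hz.
have [rp cr] := @tau_rigid_pair_intro _ _ (MPair M P) m p 2 reg_num bM bP rM PP hz.
by split=> //; apply: cr; rewrite addn0.
Qed.

Lemma almost_intro m p M P : (m + p = 1)%N -> basic_dec m M -> basic_dec p P ->
  tau_rigid M -> projective P -> hom_zero P M -> almost_complete (MPair M P).
Proof.
move=> E bM bP rM PP hz.
have [rp cr] := @tau_rigid_pair_intro _ _ (MPair M P) m p 2 reg_num bM bP rM PP hz.
by split=> //; apply: cr; rewrite E.
Qed.

Lemma almost_module X : indecomposable X -> tau_rigid X -> almost_complete (MPair X zmod).
Proof.
move=> IX rX; apply: (@almost_intro 1 0) => //; first exact: basic_dec1.
- exact/basic_dec0/zmod_zero.
- exact/zero_projective/zmod_zero.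
- exact/zero_hom_zero/zmod_zero.
Qed.

Lemma stt_module M : basic_dec 2 M -> tau_rigid M -> support_tau_tilting (MPair M zmod).
Proof.
move=> bM rM; apply: (@stt_intro 2 0) => //.
- exact/basic_dec0/zmod_zero.
- exact/zero_projective/zmod_zero.
- exact/zero_hom_zero/zmod_zero.
Qed.

Definition pair_reg : mpair A := MPair (reg A) zmod.
Definition pair_zero : mpair A := MPair zmod (reg A).
Definition pair_pro v n : mpair A := MPair (pres v (psum (kron k n) (kron k n.+1))) zmod.
Definition pair_mixed v : mpair A := MPair (preinj v 0) (prepro (~~ v) 0).
Definition pair_inj v n : mpair A :=
  MPair (pres v (psum (cokron k n.+1) (cokron k n.+2))) zmod.

Lemma pro_dsum2 v n : is_dsum2 (prepro v n) (prepro v n.+1) (pmod (pair_pro v n)).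
Proof. exact: pres_dsum2. Qed.

Lemma inj_dsum2 v n : is_dsum2 (preinj v n) (preinj v n.+1) (pmod (pair_inj v n)).
Proof. exact: pres_dsum2. Qed.

Lemma stt_reg : support_tau_tilting pair_reg.
Proof. by apply: stt_module; [apply: reg_dec | apply/projective_tau_rigid/reg_projective]. Qed.

Lemma stt_zero : support_tau_tilting pair_zero.
Proof.
apply: (@stt_intro 0 2) => //.
- exact/basic_dec0/zmod_zero.
- exact: reg_dec.
- exact/projective_tau_rigid/zero_projective/zmod_zero.
- exact: reg_projective.
- move=> f _; apply/lfunP=> x; have /zero_modP z := zmod_zero.
  by rewrite [LHS]z [RHS]z.
Qed.

Lemma stt_pro v n : support_tau_tilting (pair_pro v n).
Proof.
apply: stt_module.
  apply: basic_dec2 (pro_dsum2 v n) _ _ _; try exact: prepro_indec.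
  by case/prepro_inj => _; lia.
apply: pres_tau_rigid; first by apply: row_indep_sum; apply: row_indep_kron.
apply: ext_free_suml; apply: ext_free_sumr.
- exact: ext_free_kron.
- exact: ext_free_kronSr.
- exact: ext_free_kronSl.
- exact: ext_free_kron.
Qed.

Lemma stt_inj v n : support_tau_tilting (pair_inj v n).
Proof.
apply: stt_module.
  apply: basic_dec2 (inj_dsum2 v n) _ _ _; try exact: preinj_indec.
  by case/preinj_inj => _; lia.
apply: pres_tau_rigid; first by apply: row_indep_sum; apply: row_indep_cokron.
apply: ext_free_suml; apply: ext_free_sumr; apply: ext_free_tr.
- exact: ext_free_kron.
- exact: ext_free_kronSl.
- exact: ext_free_kronSr.
- exact: ext_free_kron.
Qed.

(** The relations of [preinj v 0] say that both arrows kill its generator: it is the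
    simple module at [v]. *)
Lemma preinj0_vtx v (m : preinj v 0) : lact _ (vtx (~~ v)) m = 0.
Proof.
have [X [Y ->]] := pres_vtx_other m.
pose S : 'rV[k]_2 := \row_i if i == ord0 then X 0 ord0 else Y 0 ord0.
have -> : X = S *m pG (cokron k 1).
  apply/rowP=> j; rewrite ord1 mxE big_ord_recl big_ord1 !mxE /=.
  by rewrite mulr1 mulr0 addr0.
have -> : Y = S *m pD (cokron k 1).
  apply/rowP=> j; rewrite ord1 mxE big_ord_recl big_ord1 !mxE /=.
  by rewrite mulr0 add0r mulr1.
rewrite xsumM; apply: big1 => i _; by rewrite mgen_rel scaler0.
Qed.

Lemma stt_mixed v : support_tau_tilting (pair_mixed v).
Proof.
apply: (@stt_intro 1 1) => //.
- exact/basic_dec1/preinj_indec.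
- exact/basic_dec1/prepro_indec.
- exact: preinj_rigid.
- exact: prepro0_projective.
- move=> f Hf; apply: pres_ext => // [|j]; first exact: lhom0.
  by rewrite -(mgen_vtx H (~~ v) j) (lhomE _ _ Hf) preinj0_vtx zero_lfunE.
Qed.

(** ** Left mutations between them *)

Lemma pair_summand_module X (T : mpair A) : retract X (pmod T) -> pair_summand (MPair X zmod) T.
Proof. by move=> r; split; apply/summandP => //; apply/zero_retract/zmod_zero. Qed.

Lemma mutation_reg v : left_mutation pair_reg (pair_pro v 0).
Proof.
have C := prepro_indec v 0.
apply: (@left_mutation_intro _ _ _ _ (MPair (prepro v 0) zmod) (prepro v 0) (prepro (~~ v) 0)).
- exact: stt_reg.
- exact: stt_pro.
- by apply: almost_module => //; apply: prepro_rigid.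
- exact/pair_summand_module/(dsum2_retractl (prepro_reg v)).
- exact/pair_summand_module/(dsum2_retractl (pro_dsum2 v 0)).
- exact: dsum2_retractl (prepro_reg v).
- apply: gen_dsum2 (pro_dsum2 v 0) _ _; first exact: gen_refl.
  exact/covers_gen/covers_kron.
- exact: dsum2_retractr (prepro_reg v).
- exact: other_not_gen.
Qed.

Lemma mutation_pro v n : left_mutation (pair_pro v n) (pair_pro v n.+1).
Proof.
apply: (@left_mutation_intro _ _ _ _ (MPair (prepro v n.+1) zmod) (prepro v n.+1) (prepro v n)).
- exact: stt_pro.
- exact: stt_pro.
- by apply: almost_module; [apply: prepro_indec | apply: prepro_rigid].
- exact/pair_summand_module/(dsum2_retractr (pro_dsum2 v n)).
- exact/pair_summand_module/(dsum2_retractl (pro_dsum2 v n.+1)).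
- exact: dsum2_retractr (pro_dsum2 v n).
- apply: gen_dsum2 (pro_dsum2 v n.+1) _ _; first exact: gen_refl.
  exact/covers_gen/covers_kron.
- exact: dsum2_retractl (pro_dsum2 v n).
- by apply: hom0_not_gen => // S T /kron_hom0[].
Qed.

Lemma mutation_zero v : left_mutation (pair_mixed v) pair_zero.
Proof.
have z := zmod_zero.
apply: (@left_mutation_intro _ _ _ _ (MPair zmod (prepro (~~ v) 0)) zmod (preinj v 0)).
- exact: stt_mixed.
- exact: stt_zero.
- apply: (@almost_intro 0 1) => //.
  + exact: basic_dec0.
  + exact/basic_dec1/prepro_indec.
  + exact/projective_tau_rigid/zero_projective.
  + exact: prepro0_projective.
  + move=> f _; apply/lfunP=> x; move/zero_modP: z => z.
    by rewrite [LHS]z [RHS]z.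
- by split; apply/summandP; [apply: zero_retract | apply: retract_refl].
- by split; apply/summandP; [apply: retract_refl | apply: (dsum2_retractr (prepro_reg v))].
- exact: zero_retract.
- exact: gen_refl.
- exact: retract_refl.
- apply: (@img_rad_not_gen _ _ H); first by case: (preinj_indec v 0).
  by move=> f m Hf; rewrite (zero_hom_zero z Hf) zero_lfunE mem0v.
Qed.

Lemma mutation_mixed v : left_mutation (pair_inj v 0) (pair_mixed v).
Proof.
apply: (@left_mutation_intro _ _ _ _ (MPair (preinj v 0) zmod) (preinj v 0) (preinj v 1)).
- exact: stt_inj.
- exact: stt_mixed.
- by apply: almost_module; [apply: preinj_indec | apply: preinj_rigid].
- exact/pair_summand_module/(dsum2_retractl (inj_dsum2 v 0)).
- exact/pair_summand_module/retract_refl.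
- exact: dsum2_retractl (inj_dsum2 v 0).
- exact: gen_refl.
- exact: dsum2_retractr (inj_dsum2 v 0).
- by apply: hom0_not_gen => // S T /cokron_hom0.
Qed.

Lemma mutation_inj v n : left_mutation (pair_inj v n.+1) (pair_inj v n).
Proof.
apply: (@left_mutation_intro _ _ _ _ (MPair (preinj v n.+1) zmod) (preinj v n.+1) (preinj v n.+2)).
- exact: stt_inj.
- exact: stt_inj.
- by apply: almost_module; [apply: preinj_indec | apply: preinj_rigid].
- exact/pair_summand_module/(dsum2_retractl (inj_dsum2 v n.+1)).
- exact/pair_summand_module/(dsum2_retractr (inj_dsum2 v n)).
- exact: dsum2_retractl (inj_dsum2 v n.+1).
- apply: gen_dsum2 (inj_dsum2 v n) _ _; last exact: gen_refl.
  exact/covers_gen/covers_cokron.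
- exact: dsum2_retractr (inj_dsum2 v n.+1).
- by apply: hom0_not_gen => // S T /cokron_hom0.
Qed.

End Pairs.


(** * Classification of the support tau-tilting pairs *)

Section Classification.
Variables (k : fieldType) (A : falgType k) (H : dk_data A).
Implicit Types M N P Q X Y Z : lmod A.
Implicit Types C : pencil k.
Notation vtx := (vtx H).
Notation arw := (arw H).
Notation pres := (pres H).
Notation prepro := (prepro H).
Notation preinj := (preinj H).

Lemma superfluous_iso (F P : lmod A) (j : 'Hom(F, P)) (K : {vspace P}) (K' : {vspace F}) :
  lhom j -> lker j == 0%VS -> limg j = fullv -> (forall x, x \in K' <-> j x \in K) ->
  superfluous K -> superfluous K'.
Proof.
move=> Hj kj sj KK sK U HU s.
have full : (j @: U)%VS = fullv.
  apply: sK.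
    move=> a; apply/subvP=> _ /memv_imgP[_ /memv_imgP[u Uu ->] ->].
    by rewrite -lhomE // memv_img // submodP.
  apply/eqP; rewrite eqEsubv subvf; apply/subvP=> p _.
  have /limgT/(_ p)[x <-] := sj; have := memvf x; rewrite -s => /memv_addP[y Ky [u Uu ->]].
  by rewrite linearD; apply: memv_add; [apply/KK | apply: memv_img].
apply/eqP; rewrite eqEsubv subvf; apply/subvP=> x _.
have := memvf (j x); rewrite -full => /memv_imgP[u Uu E].
by have /lker0P/(_ _ _ E)-> := kj.
Qed.

(** The minimal presentation of the criterion, with its projectives identified as
    sums of the [A vtx v]. *)
Lemma tau_rigid_presentation M : tau_rigid M ->
  exists n1 (nu1 : 'I_n1 -> bool) n0 (nu0 : 'I_n0 -> bool)
    (f : 'Hom(pfree H nu1, pfree H nu0)) (g : 'Hom(pfree H nu0, M)),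
  [/\ lhom f /\ lhom g, limg g = fullv /\ limg f = lker g,
      superfluous (lker g) /\ superfluous (lker f)
    & forall u : 'Hom(pfree H nu1, M), lhom u ->
        exists2 w : 'Hom(pfree H nu0, M), lhom w & u = (w \o f)%VF].
Proof.
case/tau_rigid_lift=> P1 [P0 [f [g [[[PP1 PP0] [Hf Hg] [sg fg] [sKg sKf]] lift]]]].
have [n1 [nu1 /isoP[j1 [Hj1 kj1 sj1]]]] := projective_pfree H PP1.
have [n0 [nu0 /isoP[j0 [Hj0 kj0 sj0]]]] := projective_pfree H PP0.
have Hi0 := lhom_inv Hj0 kj0 sj0; have Hi1 := lhom_inv Hj1 kj1 sj1.
have j0i x : j0 (j0^-1%VF x) = x by rewrite limg_lfunVK // sj0 memvf.
have j1i x : j1 (j1^-1%VF x) = x by rewrite limg_lfunVK // sj1 memvf.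
have i0j x : j0^-1%VF (j0 x) = x by rewrite lker0_lfunK.
exists n1, nu1, n0, nu0, (j0^-1 \o (f \o j1))%VF, (g \o j0)%VF; split.
- by split; do !apply: lhom_comp => //.
- split.
    apply/limgT=> m; have /limgT/(_ m)[x <-] := sg; exists (j0^-1%VF x).
    by rewrite comp_lfunE j0i.
  apply/vspaceP=> x; rewrite memv_ker comp_lfunE; apply/memv_imgP/eqP=> [[y _ ->]|].
    rewrite !comp_lfunE j0i; apply/eqP; rewrite -memv_ker -fg.
    by rewrite memv_img ?memvf.
  move/eqP; rewrite -memv_ker -fg => /memv_imgP[y _ E].
  by exists (j1^-1%VF y); rewrite ?memvf // !comp_lfunE j1i -E i0j.
- split.
    by apply: (superfluous_iso Hj0 kj0 sj0 _ sKg) => x; rewrite !memv_ker comp_lfunE.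
  apply: (superfluous_iso Hj1 kj1 sj1 _ sKf) => x; rewrite !memv_ker !comp_lfunE.
  split=> /eqP E; apply/eqP; last by rewrite E linear0.
  by rewrite -[LHS]j0i E linear0.
- move=> u Hu; have [w Hw E] := lift (u \o j1^-1)%VF (lhom_comp Hu Hi1).
  exists (w \o j0)%VF; first exact: lhom_comp.
  apply/lfunP=> x; rewrite !comp_lfunE j0i -[w _]comp_lfunE -E comp_lfunE.
  by rewrite lker0_lfunK.
Qed.

Lemma basic_dec_zero m X : zero_mod X -> basic_dec m X -> m = 0%N.
Proof.
case: m => // m z [N [s IN _]]; case: (IN ord0) => nz _; case: nz.
exact: retract_zero z (dsum_retract ord0 s).
Qed.

Lemma pfree_retract n (nu : 'I_n -> bool) X N : iso (pfree H nu) X ->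
  indecomposable N -> retract N X -> exists i, iso N (prepro (nu i) 0).
Proof.
move=> FX IN r.
have [i ri] := indec_retract_dsum IN (pfree_dsum H nu) (retract_trans r (iso_retract (iso_sym FX))).
exists i; apply: indec_retract_iso; [by case: IN | exact: prepro_indec |].
by apply: retract_trans ri _; apply: iso_retract; apply: proj_prepro.
Qed.

Lemma pfree0_zero (nu : 'I_0 -> bool) X : iso (pfree H nu) X -> zero_mod X.
Proof.
by move=> i; apply: (iso_zero i); apply/zero_modP=> u; apply: pco_inj => -[].
Qed.

Lemma basic_two_projectives n (nu : 'I_n -> bool) X : iso (pfree H nu) X ->
  basic_dec 2 X -> iso X (reg A).
Proof.
move=> FX bX; apply: basic_dec2_sum bX _ (prepro_reg H true) => N IN r.
by have [i] := pfree_retract FX IN r; case: (nu i); [left|right].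
Qed.

(** If the idempotent of one vertex acts as zero, then so do all arrows, and every
    subspace is a submodule. *)
Lemma semisimple_dim1 v X : indecomposable X -> (forall x : X, lact X (vtx (~~ v)) x = 0) ->
  exists x : X, x != 0 /\ forall y, exists c, y = c *: x.
Proof.
move=> IX z.
have vid (x : X) : lact X (vtx v) x = x by rewrite -[RHS](act_vtx_sum H v) z addr0.
have a0 u b (x : X) : lact X (arw u b) x = 0.
  have [->|uv] := eqVneq u v; first by rewrite -(act_vtx_arw H) z.
  have -> : u = ~~ v by clear -uv; case: u v uv => -[].
  by apply: act_arw0.
have sub (U : {vspace X}) : submodule U.
  apply: (submodule_gen (H := H)) => [w x Ux|w b x _]; last by rewrite a0 mem0v.
  have [->|wv] := eqVneq w v; first by rewrite vid.
  have -> : w = ~~ v by clear -wv; case: w v wv => -[].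
  by rewrite z mem0v.
have [x x0] : exists x : X, x != 0.
  apply: NNPP => N; case: IX => nz _; apply: nz; apply/zero_modP=> x.
  by apply/eqP; apply: contra_notT N => x0; exists x.
exists x; split=> // y.
have [] := indec_split IX (sub <[x]>%VS) (sub (<[x]>^C)%VS) (addv_complf _) (capv_compl _).
  by move=> E; have := memv_line x; rewrite E memv0 (negPf x0).
move=> E; have := addv_complf <[x]>%VS; rewrite E addv0 => full.
by have := memvf y; rewrite -full => /vlineP.
Qed.

Lemma semisimple_iso v X Y : indecomposable X -> indecomposable Y ->
  (forall x : X, lact X (vtx (~~ v)) x = 0) -> (forall y : Y, lact Y (vtx (~~ v)) y = 0) ->
  iso X Y.
Proof.
move=> IX IY zX zY.
have [x [x0 Hx]] := semisimple_dim1 IX zX; have [y [y0 Hy]] := semisimple_dim1 IY zY.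
have scal (Z : lmod A) (z : Z) a : (forall z : Z, lact Z (vtx (~~ v)) z = 0) ->
    lact Z a z = cf0 H v a *: z.
  move=> zZ; have vid : lact Z (vtx v) z = z by rewrite -[RHS](act_vtx_sum H v) zZ addr0.
  have a0 u b (w : Z) : lact Z (arw u b) w = 0.
    have [->|uv] := eqVneq u v; first by rewrite -(act_vtx_arw H) zZ.
    have -> : u = ~~ v by clear -uv; case: u v uv => -[].
    by apply: act_arw0.
  have [c2 ->] := act_span_at a vid; rewrite !big1 ?addr0 // => b _.
    by rewrite big1 // => c _; rewrite a0 scaler0.
  by rewrite a0 scaler0.
pose c (u : X) := coord [tuple x] ord0 u.
have fx : free [tuple x] by rewrite seq1_free.
have cx d : c (d *: x) = d.
  have x1 : coord [tuple x] ord0 x = 1 := coord_free ord0 ord0 fx.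
  by rewrite /c linearZ /= x1 mulr1.
have cE u : u = c u *: x by have [d ->] := Hx u; rewrite cx.
have FL : linear (fun u : X => c u *: y).
  by move=> a u w; rewrite /c linearP scalerDl scalerA.
apply/isoP; exists (lin_hom FL); split.
- apply/lhomP=> a u; rewrite !lin_homE !scal // /c linearZ /= scalerA //.
- rewrite -subv0; apply/subvP=> u; rewrite memv_ker lin_homE scaler_eq0 (negPf y0) orbF.
  by move=> /eqP cu; rewrite [u]cE cu scale0r mem0v.
- apply/limgT=> w; have [d ->] := Hy w; exists (d *: x).
  by rewrite lin_homE cx.
Qed.

Lemma pres_zero v C : pd C = 0%N -> zero_mod (pres v C).
Proof.
move=> d0; apply/zero_modP=> m; have [c ->] := pres_span m.
by rewrite big1 // => j _; exfalso; have := ltn_ord j; move: (nat_of_ord j) => x; rewrite d0.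
Qed.

Lemma pmul_retract v C n N : indecomposable (pres v C) -> indecomposable N ->
  retract N (pres v (pmul C n)) -> iso N (pres v C).
Proof.
move=> IC IN; elim: n => [|n IH] r.
  by case: IN => nz _; case: nz; apply: retract_zero r; apply: pres_zero.
have [r'|/IH//] := indec_retract_dsum2 IN (pres_dsum2 H v C (pmul C n)) r.
by apply: indec_retract_iso => //; case: IN.
Qed.

Lemma sum_retract v C C' x y N : indecomposable (pres v C) -> indecomposable (pres v C') ->
  indecomposable N -> retract N (pres v (psum (pmul C x) (pmul C' y))) ->
  iso N (pres v C) \/ iso N (pres v C').
Proof.
move=> IC IC' IN r.
by have [/(pmul_retract IC IN)|/(pmul_retract IC' IN)] := indec_retract_dsum2 IN (pres_dsum2 H v _ _) r;
  [left|right].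
Qed.

Inductive listed (T : mpair A) : Prop :=
  | ListedReg of pair_iso T (pair_reg A)
  | ListedPro v n of pair_iso T (pair_pro H v n)
  | ListedZero of pair_iso T (pair_zero A)
  | ListedMixed v of pair_iso T (pair_mixed H v)
  | ListedInj v n of pair_iso T (pair_inj H v n).

(** The module is a sum of copies of two indecomposable modules, and being basic with
    two summands it contains each of them once. *)
Lemma pencil_listed v C M : basic_dec 2 M -> row_indep C -> rigid C -> (0 < pd C)%N ->
  iso M (pres v C) ->
  (exists n, iso M (pmod (pair_pro H v n))) \/ (exists n, iso M (pmod (pair_inj H v n))).
Proof.
move=> bM RC R d0 i; have [lt|gt|eq] := ltngtP (pa C) (pd C).
- have [x [y /(pres_iso H v) j]] := rigid_kron R lt; left; eexists.
  apply: basic_dec2_sum bM _ (pro_dsum2 H v _) => N IN r.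
  have {}r := retract_trans r (iso_retract (iso_trans i j)).
  exact: (sum_retract (prepro_indec H v _) (prepro_indec H v _) IN r).
- have [n [x [y /(pres_iso H v) j]]] := rigid_cokron R gt (row_indep_le RC); right; exists n.
  apply: basic_dec2_sum bM _ (inj_dsum2 H v _) => N IN r.
  have {}r := retract_trans r (iso_retract (iso_trans i j)).
  exact: (sum_retract (preinj_indec H v _) (preinj_indec H v _) IN r).
- by have := rigid_not_square R eq; move: d0; case: (pd C).
Qed.

(** If [M = 0], then [P = A]. Otherwise let [F1 -> F0] be the minimal presentation of
    [M]. By [lift_img_rad] no vertex occurs both in [F1] and in [F0]. If both vertices
    occur in [F0], then [F1 = 0] and [M] is projective, hence [A]. Otherwise [F0] is
    concentrated at one vertex and [F1] at the other. If [P = 0], the presentation is a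
    rigid pencil. If [P] is not zero, then [M] vanishes at a vertex and is simple. *)
Theorem stt_listed T : support_tau_tilting T -> listed T.
Proof.
case: T => M P sT; have [m [p [/= bM bP mp]]] := stt_dec (reg_num H) sT.
have z := zmod_zero A.
case: sT => -[_ rM PP hz] _; rewrite /= in rM PP hz.
have [nP [nuP FP]] := projective_pfree H PP.
have [n1 [nu1 [n0 [nu0 [f [g [[Hf Hg] [sg fg] [sKg sKf] lift]]]]]]] := tau_rigid_presentation rM.
have [zM|nzM] := classic (zero_mod M).
  have m0 := basic_dec_zero zM bM; subst m; rewrite add0n in mp; subst p.
  apply: ListedZero; split; first exact: zero_iso.
  exact: basic_two_projectives FP bP.
(* No homomorphism from [P] to [M] means that [M] vanishes at the vertices of [P]. *)
have vP l (x : M) : lact M (vtx (nuP l)) x = 0.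
  have [q [q' [Hq Hq' q'q qq']]] := FP.
  pose u := pmap H nuP (fun _ => x).
  have Hu : lhom u by apply: pmap_lhom.
  have := hz (u \o q')%VF (lhom_comp Hu Hq') => uq.
  rewrite -(pmap_gen H nuP (fun _ => x) l) -/u -[pgen H nuP l]id_lfunE -q'q -comp_lfunE.
  by rewrite comp_lfunA uq comp_lfun0l zero_lfunE.
(* A vertex of [F0] is visible in [M] modulo the radical, which excludes those of
   [P] and, by lifting, those of [F1]. *)
have n0P j l : nuP l != nu0 j.
  apply/eqP=> E; apply: (vtx_rad_notin (j := j) Hg sg sKg) => x.
  by rewrite -E vP mem0v.
have n01 j i : nu1 i != nu0 j.
  apply/eqP=> E; apply: (vtx_rad_notin (j := j) Hg sg sKg) => x.
  by rewrite -E; apply: lift_img_rad Hg fg sKg lift.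
have [j0 _] : exists j0 : 'I_n0, True.
  apply: NNPP => N; apply: nzM; apply/zero_modP=> x; have /limgT/(_ x)[u <-] := sg.
  suff -> : u = 0 by rewrite linear0.
  by apply: pco_inj => i; case: N; exists i.
have [nP0|nPpos] := posnP nP.
  have zP : zero_mod P by subst nP; apply: pfree0_zero FP.
  have p0 := basic_dec_zero zP bP; subst p; rewrite addn0 in mp; subst m.
  have [[j1 ne]|only] := classic (exists j1, nu0 j1 != nu0 j0).
    have n10 : n1 = 0%N.
      apply/eqP; case: posnP => // n1pos; have := n01 j0 (Ordinal n1pos).
      have := n01 j1 (Ordinal n1pos); clear -ne.
      by case: (nu1 _) (nu0 j0) (nu0 j1) ne => -[] [].
    have z1 : zero_mod (pfree H nu1) by subst n1; apply: pfree0_zero (iso_refl _).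
    apply: ListedReg; split; last exact: zero_iso.
    apply: (basic_two_projectives (nu := nu0)) bM; apply/isoP; exists g; split=> //.
    rewrite -fg -subv0; apply/subvP=> _ /memv_imgP[x _ ->].
    by move/zero_modP: z1 => z1; rewrite [x]z1 linear0 mem0v.
  have [v nu0v] : exists v, nu0 = fun _ => v.
    exists (nu0 j0); apply: functional_extensionality => j; apply/eqP.
    by apply: contraT => ne; case: only; exists j.
  have nu1v : nu1 = fun _ => ~~ v.
    apply: functional_extensionality => i; have := n01 j0 i; rewrite nu0v.
    by case: (nu1 i); case: (v).
  subst nu0 nu1; have [C [dC RC R i]] := presentation_pencil Hf Hg sg fg sKf lift.
  have d0 : (0 < pd C)%N by rewrite dC; apply: leq_ltn_trans (ltn_ord j0).
  have zz := zero_iso zP z.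
  by have [[n j]|[n j]] := pencil_listed bM RC R d0 i; [apply: ListedPro | apply: ListedInj]; split; eauto.
pose w := nuP (Ordinal nPpos); pose v := ~~ w.
have wM x : lact M (vtx (~~ v)) x = 0 by rewrite /v negbK; apply: vP.
have nuPw l : nuP l = w.
  have := n0P j0 l; have := n0P j0 (Ordinal nPpos); rewrite -/w.
  by case: (nu0 j0); case: (w); case: (nuP l).
have simple N : indecomposable N -> retract N M -> iso N (preinj v 0).
  move=> IN [i [q [Hi Hq qi]]]; apply: (@semisimple_iso v) => // [|x|x].
  - exact: preinj_indec.
  - rewrite -[x]id_lfunE -qi comp_lfunE -(lhomE _ _ Hq) wM linear0 //.
  - exact: preinj0_vtx.
have one N : indecomposable N -> retract N P -> iso N (prepro w 0).
  by move=> IN r; have [l] := pfree_retract FP IN r; rewrite nuPw.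
have m1 := basic_dec_le1 bM simple; have p1 := basic_dec_le1 bP one.
have [m1' p1'] : m = 1%N /\ p = 1%N by lia.
subst m p; apply: (@ListedMixed _ v); split.
  by apply: simple; [apply: basic_dec1_inv bM | apply: retract_refl].
have := one P (basic_dec1_inv bP) (retract_refl P).
by rewrite /v /= negbK.
Qed.

(** * Two components *)

(** These turn out to be the pairs linked to [(A, 0)], and the negative ones those
    linked to [(0, A)]. *)
Definition positive (T : mpair A) : Prop := zero_mod (pproj T) /\
  forall X, indecomposable X -> retract X (pmod T) -> exists v n, iso X (prepro v n).

Definition negative (T : mpair A) : Prop :=
  forall X, indecomposable X -> retract X (pmod T) -> exists v n, iso X (preinj v n).

Lemma listed_sign T : listed T -> positive T \/ negative T.
Proof.
have z := zmod_zero A.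
have sum X N N' Y (Q : lmod A -> Prop) : is_dsum2 N N' Y -> indecomposable N -> indecomposable N' ->
    indecomposable X -> retract X Y -> (iso X N -> Q X) -> (iso X N' -> Q X) -> Q X.
  move=> s IN IN' IX r Q1 Q2; have [r'|r'] := indec_retract_dsum2 IX s r.
    by apply/Q1/indec_retract_iso => //; case: IX.
  by apply/Q2/indec_retract_iso => //; case: IX.
case=> [[i j]|v n [i j]|[i j]|v [i j]|v n [i j]].
- left; split=> [|X IX r]; first exact: iso_zero (iso_sym j) z.
  apply: (sum _ _ _ _ (fun X => exists v n, iso X (prepro v n)) (prepro_reg H true) _ _ IX
    (retract_trans r (iso_retract i))); try exact: prepro_indec.
    by exists true, 0%N.
  by exists false, 0%N.
- left; split=> [|X IX r]; first exact: iso_zero (iso_sym j) z.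
  apply: (sum _ _ _ _ (fun X => exists v n, iso X (prepro v n)) (pro_dsum2 H v n) _ _ IX
    (retract_trans r (iso_retract i))); try exact: prepro_indec.
    by exists v, n.
  by exists v, n.+1.
- right=> X [nz _] r; case: nz; apply: retract_zero r.
  exact: iso_zero (iso_sym i) z.
- right=> X IX r; exists v, 0%N; apply: indec_retract_iso; [by case: IX | exact: preinj_indec |].
  exact: retract_trans r (iso_retract i).
- right=> X IX r.
  apply: (sum _ _ _ _ (fun X => exists v n, iso X (preinj v n)) (inj_dsum2 H v n) _ _ IX
    (retract_trans r (iso_retract i))); try exact: preinj_indec.
    by exists v, n.
  by exists v, n.+1.
Qed.

Lemma pair_iso_sym (T U : mpair A) : pair_iso T U -> pair_iso U T.
Proof. by case=> i j; split; apply: iso_sym. Qed.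

Lemma pair_iso_trans (T U V : mpair A) : pair_iso T U -> pair_iso U V -> pair_iso T V.
Proof. by case=> i j [i' j']; split; [apply: iso_trans i i' | apply: iso_trans j j']. Qed.

Lemma positive_iso T U : pair_iso T U -> positive T -> positive U.
Proof.
case=> i j [z pT]; split=> [|X IX r]; first exact: iso_zero j z.
by apply: pT => //; apply: retract_trans r (iso_retract (iso_sym i)).
Qed.

(** Mutation preserves the sign: the common almost complete pair is not zero, and
    a module summand of it determines the sign, while a projective summand only
    occurs in negative pairs. *)
Lemma mutation_positive T U : mutation T U -> positive T -> positive U.
Proof.
case=> sT sU _ [V [[_ cV] [/summandP VT VT'] [/summandP VU VU']]] [zT pT].
have [//|nU] := listed_sign (stt_listed sU).
have zP : zero_mod (pproj V) by apply: retract_zero zT _; apply/summandP.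
have [zV|nzV] := classic (zero_mod (pmod V)).
  case: cV => m [p [n [nM nP nA E]]].
  have n2 := num_summands_uniq nA (reg_num H); have /basic_decP[_ n0] := basic_dec0 zV.
  have /basic_decP[_ n0'] := basic_dec0 zP.
  by move: E; rewrite n2 (num_summands_uniq nM n0) (num_summands_uniq nP n0').
have [X IX r] := exists_indec nzV.
have [v [n i]] := pT X IX (retract_trans r VT).
have [v' [n' i']] := nU X IX (retract_trans r VU).
by case: (prepro_preinj (iso_trans (iso_sym i) i')).
Qed.

Lemma mutation_sym (T U : mpair A) : mutation T U -> mutation U T.
Proof.
case=> sT sU n [V [aV VT VU]]; split=> //; first by move/pair_iso_sym.
by exists V.
Qed.

Lemma positive_reg : positive (pair_reg A).
Proof.
have [//|n] := listed_sign (ListedReg (conj (iso_refl _) (iso_refl _)) : listed (pair_reg A)).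
have r := dsum2_retractl (prepro_reg H true).
have [v [m i]] := n _ (prepro_indec H true 0) r.
by case: (prepro_preinj i).
Qed.

Lemma not_positive_zero : ~ positive (pair_zero A).
Proof.
case=> z _; have [nz _] := prepro_indec H true 0; apply: nz.
exact: retract_zero z (dsum2_retractl (prepro_reg H true)).
Qed.

Definition stt_class_of (T : mpair A) (sT : support_tau_tilting T) : stt_class A :=
  exist _ (pair_iso T) (ex_intro2 _ _ T sT erefl).

Notation linked := (clos_refl_sym_trans (stt_class A) (@mutation_arrow k A)).

Definition class_positive (C : stt_class A) : Prop := exists2 T, sval C T & positive T.

Lemma class_positiveE (C : stt_class A) T : sval C T -> class_positive C <-> positive T.
Proof.
case: C => C [T0 s0 E] /=; subst C => i; split=> [[T' i' pT']|]; last by exists T.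
by apply: positive_iso pT'; apply: pair_iso_trans (pair_iso_sym i') i.
Qed.

Lemma linked_positive (C D : stt_class A) : linked C D -> class_positive C <-> class_positive D.
Proof.
elim=> {C D} [C D [T [U [CT DU [mTU _ _]]]]|C|C D _ [? ?]|C D E _ [? ?] _ [? ?]]; try by split; auto.
rewrite (class_positiveE CT) (class_positiveE DU).
by split; apply: mutation_positive => //; apply: mutation_sym.
Qed.

Lemma linked_arrow T U (sT : support_tau_tilting T) (sU : support_tau_tilting U) :
  left_mutation T U -> linked (stt_class_of sT) (stt_class_of sU).
Proof.
move=> m; apply: rst_step; exists T, U.
by split=> //=; split; apply: iso_refl.
Qed.

(** A class is a predicate together with a proof that it is an isomorphism class, so
    that equality of classes is equality of predicates. *)
Lemma class_eq (C : stt_class A) T (sT : support_tau_tilting T) : sval C T -> C = stt_class_of sT.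
Proof.
case: C => C pC /= CT; have [T0 s0 E] := pC.
have EC : C = pair_iso T.
  rewrite E; apply: functional_extensionality => U; apply: propositional_extensionality.
  rewrite E in CT; split=> i; first exact: pair_iso_trans (pair_iso_sym CT) i.
  exact: pair_iso_trans CT i.
by clear E; subst C; rewrite (proof_irrelevance _ pC (ex_intro2 _ _ T sT erefl)).
Qed.

Theorem two_components : num_components (@mutation_arrow k A) 2.
Proof.
pose c (i : 'I_2) := if i == ord0 then stt_class_of (stt_reg H) else stt_class_of (stt_zero H).
have refl (T : mpair A) : pair_iso T T by split; apply: iso_refl.
have pos0 : class_positive (c ord0) by exists (pair_reg A); [apply: refl | apply: positive_reg].
have pos1 : ~ class_positive (c ord_max).
  have E : sval (c ord_max) (pair_zero A) by apply: refl.
  by move/(class_positiveE E); apply: not_positive_zero.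
have pro v n : linked (c ord0) (stt_class_of (stt_pro H v n)).
  elim: n => [|n IH]; first exact/linked_arrow/mutation_reg.
  by apply: rst_trans IH _; apply/linked_arrow/mutation_pro.
have mixed v : linked (c ord_max) (stt_class_of (stt_mixed H v)).
  by apply/rst_sym/linked_arrow/mutation_zero.
have inj v n : linked (c ord_max) (stt_class_of (stt_inj H v n)).
  elim: n => [|n IH].
    by apply: rst_trans (mixed v) _; apply/rst_sym/linked_arrow/mutation_mixed.
  by apply: rst_trans IH _; apply/rst_sym/linked_arrow/mutation_inj.
exists c; split.
  move=> i j /linked_positive E; move: pos0 pos1.
  have I2 (l : 'I_2) : l = ord0 \/ l = ord_max.
    by case: l => -[|[|//]] p; [left|right]; apply: val_inj.
  by case: (I2 i) (I2 j) E => -> [] -> // [E E'] p q; case: q; auto.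
move=> C; have [T sT E] := svalP C.
have CT : sval C T by rewrite E.
have CU U : pair_iso T U -> sval C U by rewrite E.
have [i|v n i|i|v i|v n i] := stt_listed sT.
- by exists ord0; rewrite (class_eq (stt_reg H) (CU _ i)); apply: rst_refl.
- by exists ord0; rewrite (class_eq (stt_pro H v n) (CU _ i)).
- by exists ord_max; rewrite (class_eq (stt_zero H) (CU _ i)); apply: rst_refl.
- by exists ord_max; rewrite (class_eq (stt_mixed H v) (CU _ i)).
- by exists ord_max; rewrite (class_eq (stt_inj H v n) (CU _ i)).
Qed.

End Classification.


(** * The double Kronecker quiver *)

Section DoubleKronecker.
Variable k : fieldType.
Notation Q := double_kronecker.
Notation A := (trunc_alg k Q 2).
Notation path := (qpath Q 2).

Definition dk_vert (v : bool) : vert Q := if v then ord_max else ord0 : 'I_2.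

Fact dk_arrow_subproof (v b : bool) : (v.*2 + b < 4)%N.
Proof. by case: v b => [] []. Qed.

Definition dk_arrow (v b : bool) : arrow Q := Ordinal (dk_arrow_subproof v b).

Lemma dk_vert_eq v w : (dk_vert v == dk_vert w) = (v == w).
Proof. by case: v w => [] []. Qed.

Lemma dk_src v b : src (dk_arrow v b) = dk_vert v.
Proof. by case: v b => [] []. Qed.

Lemma dk_tgt v b : tgt (dk_arrow v b) = dk_vert (~~ v).
Proof. by case: v b => [] []. Qed.

Lemma dk_arrow_eq v b w c : (dk_arrow v b == dk_arrow w c) = (v == w) && (b == c).
Proof. by case: v b w c => [] [] [] []. Qed.

Lemma dk_vertP (x : vert Q) : exists v, x = dk_vert v.
Proof. by exists (val x == 1%N); apply/val_inj; case: x => [[|[|n]] lt_n]. Qed.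

Lemma dk_arrowP (a : arrow Q) : exists v b, a = dk_arrow v b.
Proof.
exists (1 < val a)%N, (odd (val a)); apply/val_inj.
by case: a => [[|[|[|[|n]]]] lt_n].
Qed.

Lemma dk_walk1 v b : is_walk (dk_vert v) [:: dk_arrow v b].
Proof. by case: v b => [] []. Qed.

Lemma dk_walk2 v b c : is_walk (dk_vert v) [:: dk_arrow v b; dk_arrow (~~ v) c].
Proof. by case: v b c => [] [] []. Qed.

Definition arrow_path v b : path := s2val (@qpath_of Q 2 _ _ (dk_walk1 v b) isT).

Lemma arrow_pathE v b :
  (pstart (arrow_path v b) = dk_vert v) * (parrows (arrow_path v b) = [:: dk_arrow v b]).
Proof. by rewrite /arrow_path; case: qpath_of. Qed.

Definition arrow2_path v b c : path := s2val (@qpath_of Q 2 _ _ (dk_walk2 v b c) isT).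

Lemma arrow2_pathE v b c : (pstart (arrow2_path v b c) = dk_vert v) *
  (parrows (arrow2_path v b c) = [:: dk_arrow v b; dk_arrow (~~ v) c]).
Proof. by rewrite /arrow2_path; case: qpath_of. Qed.

Let dvtx v : A := trunc_vert k 2 (dk_vert v).
Let darw v b : A := trunc_arrow k 2 (dk_arrow v b).
Let dcf0 v (f : A) : k := f (triv_path 2 (dk_vert v)).
Let dcf1 v b (f : A) : k := f (arrow_path v b).

Let pres_A := trunc_alg_presentation k Q 2.

Lemma dk_pathP (u : path) : exists v, pstart u = dk_vert v /\
  [\/ parrows u = [::], exists b, parrows u = [:: dk_arrow v b]
    | exists b c, parrows u = [:: dk_arrow v b; dk_arrow (~~ v) c]].
Proof.
have [v uv] := dk_vertP (pstart u); exists v; split=> //.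
have := pwalk u; have := psize u; rewrite uv.
have walk_cons x a s : is_walk x (a :: s) = (src a == x) && is_walk (tgt a) s by [].
case: (parrows u) => [|a [|a' [|? ?]]] // _; first by constructor 1.
  have [w [b ->]] := dk_arrowP a.
  by rewrite walk_cons dk_src dk_vert_eq andbT => /eqP->; constructor 2; exists b.
have [w [b ->]] := dk_arrowP a; have [w' [c ->]] := dk_arrowP a'.
rewrite !walk_cons !dk_src dk_tgt !dk_vert_eq andbT => /andP[/eqP-> /eqP->].
by constructor 3; exists b, c.
Qed.

Lemma dk_vtxE v u : dvtx v u = ((pstart u == dk_vert v) && (parrows u == [::]))%:R.
Proof. by rewrite ffunE. Qed.

Lemma dk_arwE v b u : darw v b u = (parrows u == [:: dk_arrow v b])%:R.
Proof. by rewrite ffunE. Qed.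

Lemma dk_vtxM v w : dvtx v * dvtx w = if v == w then dvtx v else 0.
Proof. by rewrite (pres_idem pres_A) dk_vert_eq. Qed.

Lemma dk_vtx_sum : dvtx true + dvtx false = 1.
Proof.
rewrite -(pres_one pres_A) addrC big_ord_recl big_ord1 /dvtx.
by rewrite (_ : lift ord0 ord0 = ord_max :> 'I_2) //; apply: val_inj.
Qed.

Lemma dk_vtx_arw v b : dvtx (~~ v) * darw v b = darw v b.
Proof. by rewrite /dvtx -(dk_tgt v b) (pres_tgt pres_A). Qed.

Lemma dk_arw_vtx v b : darw v b * dvtx v = darw v b.
Proof. by rewrite /dvtx -(dk_src v b) (pres_src pres_A). Qed.

Lemma dk_arw3 u v w b c d : darw u b * (darw v c * darw w d) = 0.
Proof.
have := pres_nil pres_A (erefl : size [:: dk_arrow u b; dk_arrow v c; dk_arrow w d] = 3).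
by rewrite !big_cons big_nil mulr1.
Qed.

Lemma dk_arw2E v b c u : (darw (~~ v) c * darw v b) u =
  ((pstart u == dk_vert v) && (parrows u == [:: dk_arrow v b; dk_arrow (~~ v) c]))%:R.
Proof.
have <- : (\prod_(a <- rev [:: dk_arrow v b; dk_arrow (~~ v) c]) trunc_arrow k 2 a)
            * trunc_vert k 2 (dk_vert v) = darw (~~ v) c * darw v b.
  by rewrite /rev /= !big_cons big_nil mulr1 -mulrA -/(dvtx v) -/(darw v b) dk_arw_vtx.
by rewrite trunc_prodE ffunE.
Qed.

(** A trivial path factors only as itself times itself, and an arrow only with a
    trivial path on one side; whence [dk_cf0M] and [dk_cf1M]. *)
Lemma dk_cf0M v f g : dcf0 v (f * g) = dcf0 v f * dcf0 v g.
Proof.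
rewrite /dcf0 trunc_mulE; set t := triv_path _ _.
rewrite (bigD1 t) // (big_pred1 t) => [|q]; last first.
  rewrite -[RHS]/(q == t) qpath_eq /is_concat /pend /t !triv_pathE /walk_end /= eqxx /=.
  by rewrite [_ == pstart q]eq_sym [[::] == _]eq_sym.
rewrite big1 => [|p pt]; first exact: addr0.
rewrite big1 // => q /and3P[_ /eqP s /eqP a].
case/negP: pt; rewrite qpath_eq -s eqxx; move: a; rewrite /t triv_pathE.
by case: (parrows p).
Qed.

Lemma dk_cf1M v b f g :
  dcf1 v b (f * g) = dcf0 (~~ v) f * dcf1 v b g + dcf1 v b f * dcf0 v g.
Proof.
rewrite /dcf1 /dcf0 trunc_mulE; set r := arrow_path v b.
set t := triv_path _ _; set s := triv_path _ _.
have tr : t != r by rewrite qpath_eq !triv_pathE !arrow_pathE andbF.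
have er : pend r = dk_vert (~~ v).
  by rewrite -(dk_tgt v b) /pend /walk_end !arrow_pathE.
have sr : s != r by rewrite qpath_eq /s !triv_pathE !arrow_pathE andbF.
rewrite (bigD1 r) // (big_pred1 t) => [|q]; last first.
  rewrite -[RHS]/(q == t) /is_concat er eqxx qpath_eq /t !triv_pathE /r !arrow_pathE /=.
  by rewrite [_ == pstart q]eq_sym eqseq_cons eqxx [[::] == _]eq_sym.
rewrite (bigD1 s) // (big_pred1 r) => [|q]; last first.
  rewrite -[RHS]/(q == r) qpath_eq /is_concat /pend /s !triv_pathE /walk_end /r !arrow_pathE eqxx /=.
  by rewrite [_ == pstart q]eq_sym [[:: _] == _]eq_sym.
rewrite big1 => [|p /andP[pr ps]]; first by rewrite /= addr0.
rewrite big1 // => q /and3P[_ /eqP s1 /eqP a].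
move: s1 a pr ps; rewrite !qpath_eq /s /r !triv_pathE !arrow_pathE => <-; rewrite eqxx /=.
by case: (parrows p) => [|x [|y z]] //= [<-]; rewrite eqxx.
Qed.

Lemma dk_path_span f : exists c2 : bool -> bool -> bool -> k,
    f = \sum_v dcf0 v f *: dvtx v + \sum_v \sum_b dcf1 v b f *: darw v b
        + \sum_v \sum_b \sum_c c2 v b c *: (darw (~~ v) c * darw v b).
Proof.
have [c2 c2E] : exists c2, forall v b c, c2 v b c = f (arrow2_path v b c) by eexists.
exists c2; apply/ffunP=> u.
transitivity (\sum_v dcf0 v f * ((pstart u == dk_vert v) && (parrows u == [::]))%:R
  + \sum_v \sum_b dcf1 v b f * (parrows u == [:: dk_arrow v b])%:R
  + \sum_v \sum_b \sum_c c2 v b c * ((pstart u == dk_vert v)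
      && (parrows u == [:: dk_arrow v b; dk_arrow (~~ v) c]))%:R); last first.
  rewrite [RHS]ffunE [X in _ = X + _]ffunE !sum_ffunE; congr (_ + _ + _).
  - by apply: eq_bigr => v _; rewrite trunc_scaleE dk_vtxE.
  - apply: eq_bigr => v _; rewrite sum_ffunE; apply: eq_bigr => b _.
    by rewrite trunc_scaleE dk_arwE.
  apply: eq_bigr => v _; rewrite sum_ffunE; apply: eq_bigr => b _.
  by rewrite sum_ffunE; apply: eq_bigr => c _; rewrite trunc_scaleE dk_arw2E.
have [v [uv [ua | [b ua] | [b [c ua]]]]] := dk_pathP u.
- transitivity (dcf0 v f).
    by congr (f _); apply/eqP; rewrite qpath_eq !triv_pathE uv ua !eqxx.
  rewrite !big_bool uv ua !dk_vert_eq.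
  by case: v {uv}; rewrite /= ?andbF !mulr0 !mulr1 ?addr0 ?add0r.
- transitivity (dcf1 v b f).
    by congr (f _); apply/eqP; rewrite qpath_eq !arrow_pathE uv ua !eqxx.
  rewrite !big_bool uv ua !dk_vert_eq !eqseq_cons !dk_arrow_eq.
  by case: v b {uv ua} => [] []; rewrite /= ?andbF !mulr0 !mulr1 ?addr0 ?add0r.
transitivity (c2 v b c).
  by rewrite c2E; congr (f _); apply/eqP; rewrite qpath_eq !arrow2_pathE uv ua !eqxx.
rewrite !big_bool uv ua !dk_vert_eq !eqseq_cons !dk_arrow_eq.
by case: v b c {uv ua} => [] [] []; rewrite /= ?andbF !mulr0 !mulr1 ?addr0 ?add0r.
Qed.

Definition dk_trunc : dk_data A.
Proof.
apply: (@DKData k A dvtx darw dcf0 dcf1).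
- exact: dk_vtxM.
- exact: dk_vtx_sum.
- exact: dk_vtx_arw.
- exact: dk_arw_vtx.
- exact: dk_arw3.
- by move=> v c f g; rewrite /dcf0 !ffunE.
- by move=> v b c f g; rewrite /dcf1 !ffunE.
- exact: dk_cf0M.
- exact: dk_cf1M.
- by move=> v w; rewrite /dcf0 ffunE !triv_pathE eqxx andbT dk_vert_eq.
- by move=> v w b; rewrite /dcf0 ffunE !triv_pathE.
- move=> v b w c; rewrite /dcf1 ffunE !arrow_pathE eqseq_cons andbT.
  by rewrite dk_arrow_eq.
- exact: dk_path_span.
Qed.

End DoubleKronecker.

Theorem theorem3p6 (k : fieldType) :
  num_components (@mutation_arrow k (trunc_alg k double_kronecker 2)) 2.
Proof. exact: two_components (dk_trunc k). Qed.
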